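(* Let $k$ be a field of characteristic not equal to $2$. Let $Q$ be the quiver with vertices $1,2,3$, two arrows $\beta_1,\beta_2: 3\to 2$ and two arrows $\alpha_1,\alpha_2: 2\to 1$ (so $Q$ has no oriented cycles). Let $I=\langle \alpha_1\beta_1,\ \alpha_2\beta_2\rangle$ and $A=kQ/I$. Then $\pi_1(Q,I)$ is isomorphic to the free group on two generators. Moreover $kQ/I\simeq kQ/I_1\simeq kQ/I_2\simeq kQ/I_3\simeq kQ/I_4$, where: (1) $I_1=\langle(\alpha_1-\alpha_2)\beta_1,\ \alpha_2\beta_2\rangle=\phi_{\alpha_1,\alpha_2,-1}(I)$, and $\pi_1(Q,I_1)\simeq\mathbb{Z}$; (2) $I_2=\langle\alpha_1(\beta_1-\beta_2),\ \alpha_2\beta_2\rangle=\phi_{\beta_1,\beta_2,-1}(I)$, and $\pi_1(Q,I_2)\simeq\mathbb{Z}$; (3) $I_3=\langle\alpha_1\beta_1-\alpha_2\beta_1-\alpha_1\beta_2,\ \alpha_2\beta_2\rangle=\phi_{\alpha_1,\alpha_2,-1}(I_2)=\phi_{\beta_1,\beta_2,-1}(I_1)$, and $\pi_1(Q,I_3)$ is trivial; (4) $I_4=\langle\alpha_1\beta_1+\alpha_2\beta_2,\ \alpha_2\beta_1+\alpha_1\beta_2\rangle=\phi(I)$, where $\phi$ is the automorphism of $kQ$ fixing the trivial paths and given by $\phi(\alpha_1)=\frac12(\alpha_1-\alpha_2)$, $\phi(\alpha_2)=\frac12(\alpha_1+\alpha_2)$, $\phi(\beta_1)=\frac12(\beta_1-\beta_2)$,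 $\phi(\beta_2)=\beta_1+\beta_2$, and $\pi_1(Q,I_4)\simeq\mathbb{Z}/2\mathbb{Z}$. The quiver $\Gamma$ of homotopy relations of the admissible presentations of $A$ has exactly the five distinct vertices $\sim_I,\sim_{I_1},\sim_{I_2},\sim_{I_3},\sim_{I_4}$ and exactly the five arrows $$\sim_I\to\sim_{I_1},\quad \sim_I\to\sim_{I_2},\quad \sim_{I_1}\to\sim_{I_3},\quad \sim_{I_2}\to\sim_{I_3},\quad \sim_{I_4}\to\sim_{I_3}.$$ There is a surjective group homomorphism $\pi_1(Q,I)\to\pi_1(Q,I_4)$, but there is no path from $\sim_I$ to $\sim_{I_4}$ in $\Gamma$. Consequently $\Gamma$ does not have a unique source (even when $k$ has characteristic zero).
   Context: Paths are composed from right to left: $\alpha_i\beta_j$ denotes the path from $3$ to $1$ which first follows $\beta_j$ and then $\alpha_i$. $kQ$ is the path algebra, $kQ^+$ is the ideal generated by the arrows, and $\langle\cdots\rangle$ denotes the two-sided ideal generated by the listed elements. An ideal $J$ of $kQ$ is admissible if $(kQ^+)^N\subseteq J\subseteq (kQ^+)^2$ for some $N\ge 2$. An admissible presentation of $A$ is an admissible ideal $J$ of $kQ$ with $kQ/J\simeq A$ as $k$-algebras. Homotopy relation and fundamental group. Let $J$ be an admissible ideal. A minimal relation of $J$ is an element $\sum_{i=1}^n t_iu_i\in J$ with $t_i\in k\setminus\{0\}$ and $u_1,\dots,u_n$ pairwise distinct paths with the same source and the same target, such that no subsum $\sum_{i\in S}t_iu_i$ with $\emptyset\ne S\subsetneq\{1,\dots,n\}$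 lies in $J$. A walk in $Q$ is a path in the quiver obtained from $Q$ by adding a formal inverse $\alpha^{-1}:y\to x$ for each arrow $\alpha:x\to y$. The homotopy relation $\sim_J$ is the smallest equivalence relation on the set of walks in $Q$ such that: (i) $\alpha\alpha^{-1}\sim_J e_y$ and $\alpha^{-1}\alpha\sim_J e_x$ for every arrow $\alpha:x\to y$ (where $e_x$ is the trivial path at $x$); (ii) if $v\sim_J v'$ then $wvu\sim_J wv'u$ for all walks $u,w$ for which these compositions are defined; (iii) $u_i\sim_J u_j$ whenever $u_i,u_j$ are paths occurring in a common minimal relation of $J$. The fundamental group $\pi_1(Q,J)$ is the group of $\sim_J$-classes of closed walks at a fixed base vertex (up to isomorphism independent of the base vertex since $Q$ is connected). Transvections. A bypass in $Q$ is a pair $(\alpha,u)$ where $\alpha$ is an arrow and $u\neq\alpha$ is a path with the same source and the same target as $\alpha$. For a bypass $(\alpha,u)$ and $\tau\in k\setminus\{0\}$, $\phi_{\alpha,u,\tau}$ is the $k$-algebra automorphism of $kQ$ sending $\alpha$ to $\alpha+\tau u$ and fixing all trivial paths and all other arrows. The quiver $\Gamma$. Its vertices are the homotopy relations $\sim_J$, where $J$ runs over the admissible presentations of $A$ (equal relations give the same vertex). There is exactly one arrow $\sim\,\to\,\sim'$ if $\sim'$ is a direct successor of $\sim$, and no arrow otherwise. Here $\sim'$ is a direct successor of $\sim$ if there exist admissible presentations $J,J'$ of $A$, a bypass $(\alpha,u)$ and $\tau\in k\setminus\{0\}$ such that $\sim\,=\,\sim_J$, $\sim'\,=\,\sim_{J'}$,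 $J'=\phi_{\alpha,u,\tau}(J)$, $\alpha\not\sim_J u$ and $\alpha\sim_{J'}u$. A source of $\Gamma$ is a vertex with no incoming arrow. *)

(* Defs.v *)
From Stdlib Require Import Relations.
From HB Require Import structures.
From mathcomp Require Import all_boot all_order all_algebra.
From mathcomp Require Import finmap boolp.
From mathcomp.multinomials Require Import monalg.

Set Implicit Arguments.
Unset Strict Implicit.
Unset Printing Implicit Defensive.

Import GRing.Theory.
Local Open Scope ring_scope.

(* The set of vertices is nonempty, so that the path algebra is nonzero. *)
Record quiver := Quiver {
  vert : finType;
  arrow : finType;
  asrc : arrow -> vert;
  atgt : arrow -> vert;
  quiver_nonempty : (0 < #|vert|)%N
}.

Arguments asrc {q} _.
Arguments atgt {q} _.

Section Paths.
Variable Q : quiver.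
Implicit Types (x : vert Q) (w : seq (arrow Q)).

(* A pair (x, [:: a_n; ...; a_1]) encodes the path a_n ... a_1 which starts
   at x and follows a_1 first: words are read from right to left. *)
Definition word_tgt x w : vert Q := if w is a :: _ then atgt a else x.

Fixpoint word_ok x w : bool :=
  if w is a :: w' then (asrc a == word_tgt x w') && word_ok x w' else true.

Record qpath := QPath {
  qpath_val : vert Q * seq (arrow Q);
  qpath_valP : word_ok qpath_val.1 qpath_val.2
}.

HB.instance Definition _ := [isSub for qpath_val].
HB.instance Definition _ := [Choice of qpath by <:].

Implicit Types p q r : qpath.

Definition psrc p : vert Q := (val p).1.
Definition pword p : seq (arrow Q) := (val p).2.
Definition ptgt p : vert Q := word_tgt (psrc p) (pword p).

Definition parallel p q : bool := (psrc p == psrc q) && (ptgt p == ptgt q).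

Definition epath x : qpath := @QPath (x, [::]) isT.

Lemma apath_subproof (a : arrow Q) : word_ok (asrc a) [:: a].
Proof. by rewrite /= eqxx. Qed.

Definition apath (a : arrow Q) : qpath :=
  @QPath (asrc a, [:: a]) (apath_subproof a).

Definition composable p q : bool := psrc p == ptgt q.

(* The composite pq (first q, then p); it is only meaningful when p and q are
   composable, and is q by convention otherwise. *)
Definition path_comp p q : qpath := insubd q (psrc q, pword p ++ pword q).

Lemma word_tgt_cat x w1 w2 :
  word_tgt x (w1 ++ w2) = word_tgt (word_tgt x w2) w1.
Proof. by case: w1. Qed.

Lemma word_ok_cat x w1 w2 :
  word_ok x (w1 ++ w2) = word_ok (word_tgt x w2) w1 && word_ok x w2.
Proof. by elim: w1 => //= a w1 ->; rewrite word_tgt_cat andbA. Qed.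

Lemma qpath_eq p q : psrc p = psrc q -> pword p = pword q -> p = q.
Proof.
move=> e1 e2; apply: val_inj.
by rewrite [val p]surjective_pairing [val q]surjective_pairing; congr (_, _).
Qed.

Lemma val_path_comp p q : composable p q ->
  val (path_comp p q) = (psrc q, pword p ++ pword q).
Proof.
move=> /eqP pq; apply: insubdK; rewrite unfold_in /= word_ok_cat.
by rewrite -[word_tgt _ _]/(ptgt q) -pq (valP p) (valP q).
Qed.

Lemma psrc_path_comp p q : composable p q -> psrc (path_comp p q) = psrc q.
Proof. by move=> pq; rewrite /psrc val_path_comp. Qed.

Lemma pword_path_comp p q : composable p q ->
  pword (path_comp p q) = pword p ++ pword q.
Proof. by move=> pq; rewrite /pword val_path_comp. Qed.

Lemma ptgt_path_comp p q : composable p q -> ptgt (path_comp p q) = ptgt p.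
Proof.
move=> pq; rewrite /ptgt pword_path_comp // psrc_path_comp // word_tgt_cat.
by rewrite -/(ptgt q) -(eqP pq).
Qed.

Lemma psrc_epath x : psrc (epath x) = x. Proof. by []. Qed.
Lemma ptgt_epath x : ptgt (epath x) = x. Proof. by []. Qed.
Lemma psrc_apath a : psrc (apath a) = asrc a. Proof. by []. Qed.
Lemma ptgt_apath a : ptgt (apath a) = atgt a. Proof. by []. Qed.

Lemma path_compA p q r : composable p q -> composable q r ->
  path_comp p (path_comp q r) = path_comp (path_comp p q) r.
Proof.
move=> pq qr.
have pqr : composable p (path_comp q r) by rewrite /composable ptgt_path_comp.
have pqr' : composable (path_comp p q) r by rewrite /composable psrc_path_comp.
by apply: qpath_eq; rewrite ?psrc_path_comp ?pword_path_comp // catA.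
Qed.

Lemma path_comp_epath_l p : path_comp (epath (ptgt p)) p = p.
Proof.
have cp : composable (epath (ptgt p)) p by exact: eqxx.
by apply: qpath_eq; rewrite ?psrc_path_comp ?pword_path_comp.
Qed.

Lemma path_comp_epath_r p : path_comp p (epath (psrc p)) = p.
Proof.
have cp : composable p (epath (psrc p)) by exact: eqxx.
by apply: qpath_eq; rewrite ?psrc_path_comp ?pword_path_comp // cats0.
Qed.

End Paths.

(* kQ is the space of finitely supported functions on the set of paths.  Its
   operations are locked: otherwise unification unfolds them down to finite
   maps and does not terminate in practice. *)
Definition path_algebra (k : fieldType) (Q : quiver) : Type :=
  {malg k[qpath Q]}.

HB.instance Definition _ (k : fieldType) (Q : quiver) :=
  Choice.copy (path_algebra k Q) {malg k[qpath Q]}.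

HB.lock Definition pcoef (k : fieldType) (Q : quiver) (p : qpath Q)
  (f : path_algebra k Q) : k := mcoeff p (f : {malg k[qpath Q]}).

HB.lock Definition pa_zero (k : fieldType) (Q : quiver) : path_algebra k Q :=
  0 : {malg k[qpath Q]}.

HB.lock Definition pa_opp (k : fieldType) (Q : quiver) (f : path_algebra k Q) :
  path_algebra k Q := - (f : {malg k[qpath Q]}).

HB.lock Definition pa_add (k : fieldType) (Q : quiver)
  (f g : path_algebra k Q) : path_algebra k Q :=
  (f : {malg k[qpath Q]}) + (g : {malg k[qpath Q]}).

HB.lock Definition pa_scale (k : fieldType) (Q : quiver) (c : k)
  (f : path_algebra k Q) : path_algebra k Q := c *: (f : {malg k[qpath Q]}).

(* The path p, as a basis element of kQ. *)
HB.lock Definition pelt (k : fieldType) (Q : quiver) (p : qpath Q) :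
  path_algebra k Q := << 1 *g p >> : {malg k[qpath Q]}.

HB.lock Definition psupp (k : fieldType) (Q : quiver) (f : path_algebra k Q) :
  {fset qpath Q} := msupp (f : {malg k[qpath Q]}).

Arguments pelt k {Q} p.

Section PathAlgebraModule.
Variables (k : fieldType) (Q : quiver).
Local Notation kQ := (path_algebra k Q).
Implicit Types (f g h : kQ) (p q : qpath Q).

Fact pa_addA : associative (@pa_add k Q).
Proof. by move=> f g h; rewrite pa_add.unlock addrA. Qed.

Fact pa_addC : commutative (@pa_add k Q).
Proof. by move=> f g; rewrite pa_add.unlock addrC. Qed.

Fact pa_add0 : left_id (@pa_zero k Q) (@pa_add k Q).
Proof. by move=> f; rewrite pa_add.unlock pa_zero.unlock add0r. Qed.

Fact pa_addN : left_inverse (@pa_zero k Q) (@pa_opp k Q) (@pa_add k Q).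
Proof.
by move=> f; rewrite pa_add.unlock pa_zero.unlock pa_opp.unlock addNr.
Qed.

HB.instance Definition _ := GRing.isZmodule.Build kQ
  pa_addA pa_addC pa_add0 pa_addN.

Fact pa_scaleA c d f : pa_scale c (pa_scale d f) = pa_scale (c * d) f.
Proof. by rewrite pa_scale.unlock scalerA. Qed.

Fact pa_scale1 : left_id 1 (@pa_scale k Q).
Proof. by move=> f; rewrite pa_scale.unlock scale1r. Qed.

Fact pa_scaleDr : right_distributive (@pa_scale k Q) +%R.
Proof.
move=> c f g; rewrite -[f + g]/(pa_add f g) -[RHS]/(pa_add _ _).
by rewrite pa_scale.unlock pa_add.unlock scalerDr.
Qed.

Fact pa_scaleDl f : {morph (@pa_scale k Q)^~ f : c d / c + d}.
Proof.
move=> c d; rewrite -[RHS]/(pa_add _ _).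
by rewrite pa_scale.unlock pa_add.unlock scalerDl.
Qed.

HB.instance Definition _ := GRing.Zmodule_isLmodule.Build k kQ
  pa_scaleA pa_scale1 pa_scaleDr pa_scaleDl.

Fact pcoef_is_linear p : linear (@pcoef k Q p : kQ -> k^o).
Proof.
move=> c f g; rewrite -[_ + g]/(pa_add (pa_scale c f) g) pcoef.unlock.
by rewrite pa_add.unlock pa_scale.unlock mcoeffD mcoeffZ.
Qed.

HB.instance Definition _ p :=
  GRing.isLinear.Build k kQ k^o _ (@pcoef k Q p) (pcoef_is_linear p).

Lemma pcoef_ext f g : (forall p, pcoef p f = pcoef p g) -> f = g.
Proof. by rewrite pcoef.unlock => fg; apply/malgP. Qed.

Lemma pcoefD p f g : pcoef p (f + g) = pcoef p f + pcoef p g.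
Proof. exact: raddfD. Qed.

Lemma pcoefZ p c f : pcoef p (c *: f) = c * pcoef p f.
Proof. exact: linearZ. Qed.

Lemma pcoef_sum p I (r : seq I) (P : pred I) (F : I -> kQ) :
  pcoef p (\sum_(i <- r | P i) F i) = \sum_(i <- r | P i) pcoef p (F i).
Proof. exact: raddf_sum. Qed.

Lemma pcoef_pelt p q : pcoef p (pelt k q) = (q == p)%:R.
Proof. by rewrite pcoef.unlock pelt.unlock mcoeffU. Qed.

Lemma psupp_out f p : p \notin psupp f -> pcoef p f = 0.
Proof. by rewrite pcoef.unlock psupp.unlock; exact: mcoeff_outdom. Qed.

Lemma psupp_in f p : (p \in psupp f) = (pcoef p f != 0).
Proof. by rewrite pcoef.unlock psupp.unlock mcoeff_neq0. Qed.

Lemma pa_expand f : f = \sum_(p <- psupp f) pcoef p f *: pelt k p.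
Proof.
apply: pcoef_ext => q; rewrite pcoef_sum.
under eq_bigr => p _ do rewrite pcoefZ pcoef_pelt.
have [qf|qf] := boolP (q \in psupp f); last first.
  rewrite (psupp_out qf) big_seq big1 // => p pf.
  by case: eqP => [pq|]; [rewrite -pq pf in qf | rewrite mulr0].
rewrite (big_fsetD1 q) //= eqxx mulr1 big_seq big1 ?addr0 // => p.
by rewrite in_fsetD1 => /andP[/negbTE -> _]; rewrite mulr0.
Qed.

Lemma pa_ind (P : kQ -> Prop) :
  P 0 -> (forall f g, P f -> P g -> P (f + g)) ->
  (forall c p, P (c *: pelt k p)) -> forall f, P f.
Proof. by move=> P0 PD PU f; rewrite (pa_expand f); elim/big_ind: _. Qed.

End PathAlgebraModule.

(* The product of two paths is their composite, and 0 if they do not compose. *)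
Definition pelt_mul (k : fieldType) (Q : quiver) (p q : qpath Q) :
  path_algebra k Q := if composable p q then pelt k (path_comp p q) else 0.

HB.lock Definition pa_mul (k : fieldType) (Q : quiver)
  (f g : path_algebra k Q) : path_algebra k Q :=
  \sum_(p <- psupp f) \sum_(q <- psupp g)
    (pcoef p f * pcoef q g) *: pelt_mul k p q.

Definition pa_one (k : fieldType) (Q : quiver) : path_algebra k Q :=
  \sum_(x : vert Q) pelt k (epath x).

Section PathAlgebra.
Variables (k : fieldType) (Q : quiver).
Local Notation kQ := (path_algebra k Q).
Implicit Types (f g h : kQ) (p q : qpath Q).

Lemma pa_mulw (d1 d2 : {fset qpath Q}) f g :
  (psupp f `<=` d1)%fset -> (psupp g `<=` d2)%fset ->
  pa_mul f g =
  \sum_(p <- d1) \sum_(q <- d2) (pcoef p f * pcoef q g) *: pelt_mul k p q.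
Proof.
move=> le1 le2; rewrite pa_mul.unlock (big_fset_incl _ le1) /=.
  apply/eq_bigr=> p _; apply/big_fset_incl => // q _ /psupp_out ->.
  by rewrite mulr0 scale0r.
move=> p _ /psupp_out fp; rewrite big1 // => q _.
by rewrite fp mul0r scale0r.
Qed.

Lemma pa_mulww f g (d : {fset qpath Q}) :
  (psupp f `|` psupp g `<=` d)%fset ->
  pa_mul f g =
  \sum_(p <- d) \sum_(q <- d) (pcoef p f * pcoef q g) *: pelt_mul k p q.
Proof. by rewrite fsubUset => /andP[? ?]; exact: pa_mulw. Qed.

Lemma pa_mulP c f g h : pa_mul (c *: f + g) h = c *: pa_mul f h + pa_mul g h.
Proof.
pose d := (psupp (c *: f + g)%R `|` psupp f `|` psupp g `|` psupp h)%fset.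
rewrite !(@pa_mulww _ _ d); first last.
- by apply/fsubsetP => p; rewrite !inE => /orP[] ->; rewrite ?orbT.
- by apply/fsubsetP => p; rewrite !inE => /orP[] ->; rewrite ?orbT.
- by apply/fsubsetP => p; rewrite !inE => /orP[] ->; rewrite ?orbT.
rewrite scaler_sumr -big_split /=; apply: eq_bigr => p _.
rewrite scaler_sumr -big_split /=; apply: eq_bigr => q _.
by rewrite pcoefD pcoefZ mulrDl scalerDl scalerA mulrA.
Qed.

Lemma pa_mulPr c f g h : pa_mul h (c *: f + g) = c *: pa_mul h f + pa_mul h g.
Proof.
pose d := (psupp (c *: f + g)%R `|` psupp f `|` psupp g `|` psupp h)%fset.
rewrite !(@pa_mulww _ _ d); first last.
- by apply/fsubsetP => p; rewrite !inE => /orP[] ->; rewrite ?orbT.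
- by apply/fsubsetP => p; rewrite !inE => /orP[] ->; rewrite ?orbT.
- by apply/fsubsetP => p; rewrite !inE => /orP[] ->; rewrite ?orbT.
rewrite scaler_sumr -big_split /=; apply: eq_bigr => p _.
rewrite scaler_sumr -big_split /=; apply: eq_bigr => q _.
by rewrite pcoefD pcoefZ mulrDr scalerDl scalerA mulrCA.
Qed.

Lemma pa_mulDl : left_distributive (@pa_mul k Q) +%R.
Proof. by move=> f g h; have := pa_mulP 1 f g h; rewrite !scale1r. Qed.

Lemma pa_mulDr : right_distributive (@pa_mul k Q) +%R.
Proof. by move=> h f g; have := pa_mulPr 1 f g h; rewrite !scale1r. Qed.

Lemma pa_mul0l f : pa_mul 0 f = 0.
Proof. by apply: (addrI (pa_mul 0 f)); rewrite -pa_mulDl !addr0. Qed.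

Lemma pa_mul0r f : pa_mul f 0 = 0.
Proof. by apply: (addrI (pa_mul f 0)); rewrite -pa_mulDr !addr0. Qed.

Lemma pa_scale_mull c f g : c *: pa_mul f g = pa_mul (c *: f) g.
Proof. by have := pa_mulP c f 0 g; rewrite pa_mul0l !addr0. Qed.

Lemma pa_scale_mulr c f g : c *: pa_mul f g = pa_mul f (c *: g).
Proof. by have := pa_mulPr c g 0 f; rewrite pa_mul0r !addr0. Qed.

Lemma pa_mul_pelt p q : pa_mul (pelt k p) (pelt k q) = pelt_mul k p q.
Proof.
have supp1 (r : qpath Q) : (psupp (pelt k r) `<=` [fset r])%fset.
  apply/fsubsetP => s; rewrite psupp_in pcoef_pelt !inE.
  by rewrite [s == r]eq_sym; case: (r == s); rewrite ?eqxx.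
rewrite (pa_mulw (supp1 p) (supp1 q)) !big_seq_fset1 !pcoef_pelt !eqxx.
by rewrite mulr1 scale1r.
Qed.

Lemma pelt_mulA p q r :
  pa_mul (pelt k p) (pelt_mul k q r) = pa_mul (pelt_mul k p q) (pelt k r).
Proof.
rewrite /pelt_mul; case qr: (composable q r); case pq: (composable p q).
- have pqr : composable p (path_comp q r) by rewrite /composable ptgt_path_comp.
  have pqr' : composable (path_comp p q) r.
    by rewrite /composable psrc_path_comp.
  by rewrite !pa_mul_pelt /pelt_mul pqr pqr' path_compA.
- have pqr : composable p (path_comp q r) = false.
    by rewrite /composable ptgt_path_comp.
  by rewrite pa_mul0l pa_mul_pelt /pelt_mul pqr.
- have pqr : composable (path_comp p q) r = false.
    by rewrite /composable psrc_path_comp.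
  by rewrite pa_mul0r pa_mul_pelt /pelt_mul pqr.
- by rewrite pa_mul0l pa_mul0r.
Qed.

Lemma pa_mulA : associative (@pa_mul k Q).
Proof.
move=> f g h; elim/pa_ind: f => [|f1 f2 IH1 IH2|c p].
- by rewrite !pa_mul0l.
- by rewrite !pa_mulDl IH1 IH2.
elim/pa_ind: g => [|g1 g2 IH1 IH2|d q].
- by rewrite pa_mul0l pa_mul0r pa_mul0l.
- by rewrite pa_mulDl !pa_mulDr pa_mulDl IH1 IH2.
elim/pa_ind: h => [|h1 h2 IH1 IH2|e r].
- by rewrite !pa_mul0r.
- by rewrite !pa_mulDr IH1 IH2.
rewrite -!pa_scale_mulr -!pa_scale_mull -!pa_scale_mulr !pa_mul_pelt.
by rewrite pelt_mulA !scalerA mulrAC.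
Qed.

Lemma pa_mul_onel f :
  pa_mul (pa_one k Q) f = \sum_x pa_mul (pelt k (epath x)) f.
Proof.
exact: (big_morph (@pa_mul k Q ^~ f) (fun _ _ => pa_mulDl _ _ _) (pa_mul0l f)).
Qed.

Lemma pa_mul_oner f :
  pa_mul f (pa_one k Q) = \sum_x pa_mul f (pelt k (epath x)).
Proof.
exact: (big_morph (@pa_mul k Q f) (fun _ _ => pa_mulDr _ _ _) (pa_mul0r f)).
Qed.

Lemma pa_mul1l : left_id (pa_one k Q) (@pa_mul k Q).
Proof.
elim/pa_ind => [|f g IH1 IH2|c p]; first exact: pa_mul0r.
  by rewrite pa_mulDr IH1 IH2.
rewrite -pa_scale_mulr; congr (_ *: _).
rewrite pa_mul_onel (bigD1 (ptgt p)) //= big1 => [|x xp].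
  by rewrite addr0 pa_mul_pelt /pelt_mul /composable eqxx path_comp_epath_l.
by rewrite pa_mul_pelt /pelt_mul /composable psrc_epath (negbTE xp).
Qed.

Lemma pa_mul1r : right_id (pa_one k Q) (@pa_mul k Q).
Proof.
elim/pa_ind => [|f g IH1 IH2|c p]; first exact: pa_mul0l.
  by rewrite pa_mulDl IH1 IH2.
rewrite -pa_scale_mull; congr (_ *: _).
rewrite pa_mul_oner (bigD1 (psrc p)) //= big1 => [|x xp].
  by rewrite addr0 pa_mul_pelt /pelt_mul /composable eqxx path_comp_epath_r.
by rewrite pa_mul_pelt /pelt_mul /composable ptgt_epath eq_sym (negbTE xp).
Qed.

Lemma pa_one_neq0 : pa_one k Q != 0.
Proof.
have /card_gt0P [x _] := quiver_nonempty Q.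
apply/eqP => /(congr1 (pcoef (epath x))).
rewrite raddf0 pcoef_sum (bigD1 x) //= pcoef_pelt eqxx big1 ?addr0.
  by apply/eqP; rewrite oner_eq0.
move=> y yx; rewrite pcoef_pelt; case: eqP => // /(congr1 (@psrc Q)) e.
by rewrite -(psrc_epath y) e psrc_epath eqxx in yx.
Qed.

HB.instance Definition _ := GRing.Zmodule_isNzRing.Build kQ
  pa_mulA pa_mul1l pa_mul1r pa_mulDl pa_mulDr pa_one_neq0.
HB.instance Definition _ :=
  GRing.Lmodule_isLalgebra.Build k kQ pa_scale_mull.
HB.instance Definition _ :=
  GRing.Lalgebra_isAlgebra.Build k kQ pa_scale_mulr.

Lemma peltM p q :
  pelt k p * pelt k q = if composable p q then pelt k (path_comp p q) else 0.
Proof. exact: pa_mul_pelt. Qed.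

Lemma pa_oneE : 1 = \sum_(x : vert Q) pelt k (epath x) :> kQ.
Proof. by []. Qed.

End PathAlgebra.

Record ideal (A : pzRingType) := Ideal {
  ideal_mem :> A -> Prop;
  ideal0 : ideal_mem 0;
  idealB : forall a b, ideal_mem a -> ideal_mem b -> ideal_mem (a - b);
  idealMl : forall a b, ideal_mem b -> ideal_mem (a * b);
  idealMr : forall a b, ideal_mem b -> ideal_mem (b * a)
}.

Section IdealOperations.
Variable A : pzRingType.

Definition gen_mem (S : A -> Prop) (a : A) : Prop :=
  forall J : ideal A, (forall s, S s -> J s) -> J a.

(* The smallest two-sided ideal containing S. *)
Definition gen (S : A -> Prop) : ideal A.
Proof.
apply: (@Ideal A (gen_mem S)).
- by move=> J _; exact: ideal0.
- by move=> a b Sa Sb J SJ; apply: idealB; [exact: Sa | exact: Sb].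
- by move=> a b Sb J SJ; apply: idealMl; exact: Sb.
- by move=> a b Sb J SJ; apply: idealMr; exact: Sb.
Defined.

Definition gens (s : seq A) : ideal A := gen (fun a => a \in s).

Definition ideal_mul (I J : ideal A) : ideal A :=
  gen (fun c => exists a b, [/\ I a, J b & c = a * b]).

Fixpoint ideal_exp (I : ideal A) (n : nat) : ideal A :=
  if n is m.+1 then ideal_mul I (ideal_exp I m) else gens [:: 1].

Definition ideal_sub (I J : ideal A) : Prop := forall a, I a -> J a.

End IdealOperations.

Definition is_image (A B : pzRingType) (f : A -> B) (I : ideal A) (J : ideal B)
  : Prop := forall b, J b <-> exists2 a, I a & b = f a.

Section Quotient.
Variables (k : fieldType) (A : algType k) (J : ideal A).

Definition ideal_pred (a : A) : bool := `[< J a >].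

Lemma ideal_predP a : reflect (J a) (a \in ideal_pred).
Proof. exact: asboolP. Qed.

Lemma ideal_pred_zmod : zmod_closed ideal_pred.
Proof.
split=> [|a b /ideal_predP Ja /ideal_predP Jb]; apply/ideal_predP.
  exact: ideal0.
exact: idealB.
Qed.

Definition ideal_zmod : zmodClosed A := HB.pack ideal_pred
  (GRing.isZmodClosed.Build A ideal_pred ideal_pred_zmod).

(* The quotient algebra A / J; it is the zero ring when J = A. *)
Definition quot_alg := Quotient.quot ideal_zmod.

HB.instance Definition _ := GRing.Zmodule.on quot_alg.

Definition quot_pi (a : A) : quot_alg := \pi_(quot_alg)%qT a.
Definition quot_repr (u : quot_alg) : A := repr u.

Lemma quot_reprK u : quot_pi (quot_repr u) = u.
Proof. exact: reprK. Qed.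

Lemma quot_piP a b : quot_pi a = quot_pi b <-> J (a - b).
Proof.
have E : (a - b \in ideal_pred) = (quot_pi a == quot_pi b).
  exact: (@Quotient.idealrBE A ideal_zmod a b).
by split=> [/eqP|Jab]; [rewrite -E => /ideal_predP
  | apply/eqP; rewrite -E; apply/ideal_predP].
Qed.

Lemma quot_piD : {morph quot_pi : a b / a + b}.
Proof. exact: (@Quotient.pi_add A ideal_zmod). Qed.

Lemma quot_pi_repr a : J (quot_repr (quot_pi a) - a).
Proof. by apply/quot_piP; rewrite quot_reprK. Qed.

Lemma quot_ind (P : quot_alg -> Prop) :
  (forall a, P (quot_pi a)) -> forall u, P u.
Proof. by move=> PJ u; rewrite -(quot_reprK u). Qed.

Lemma idealD a b : J a -> J b -> J (a + b).
Proof.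
move=> Ja Jb; rewrite -[b]opprK -[- b]sub0r; apply: idealB => //.
by apply: idealB => //; exact: ideal0.
Qed.

End Quotient.

HB.lock Definition quot_mul (k : fieldType) (A : algType k) (J : ideal A)
  (u v : quot_alg J) : quot_alg J := quot_pi J (quot_repr u * quot_repr v).

HB.lock Definition quot_scale (k : fieldType) (A : algType k) (J : ideal A)
  (c : k) (u : quot_alg J) : quot_alg J := quot_pi J (c *: quot_repr u).

Section QuotientAlgebra.
Variables (k : fieldType) (A : algType k) (J : ideal A).
Local Notation quot_alg := (quot_alg J).
Local Notation quot_pi := (quot_pi J).
Local Notation quot_mul := (@quot_mul k A J).
Local Notation quot_scale := (@quot_scale k A J).
Local Notation quot_one := (quot_pi 1).
Implicit Types u v : quot_alg.

Lemma quot_piM a b : quot_pi (a * b) = quot_mul (quot_pi a) (quot_pi b).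
Proof.
rewrite quot_mul.unlock; apply/esym/quot_piP.
set a' := quot_repr _; set b' := quot_repr _.
have -> : a' * b' - a * b = (a' - a) * b' + a * (b' - b).
  by rewrite mulrBl mulrBr addrA subrK.
apply: (idealD (J := J)); [apply: idealMr | apply: idealMl];
  exact: quot_pi_repr.
Qed.

Lemma quot_piZ c a : quot_pi (c *: a) = quot_scale c (quot_pi a).
Proof.
rewrite quot_scale.unlock; apply/esym/quot_piP; rewrite -scalerBr -mulr_algl.
by apply: idealMl; exact: quot_pi_repr.
Qed.

Fact quot_mulA : associative quot_mul.
Proof.
elim/quot_ind=> a; elim/quot_ind=> b; elim/quot_ind=> c.
by rewrite -!quot_piM mulrA.
Qed.

Fact quot_mul1l : left_id quot_one quot_mul.
Proof. by elim/quot_ind=> a; rewrite -quot_piM mul1r. Qed.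

Fact quot_mul1r : right_id quot_one quot_mul.
Proof. by elim/quot_ind=> a; rewrite -quot_piM mulr1. Qed.

Fact quot_mulDl : left_distributive quot_mul +%R.
Proof.
elim/quot_ind=> a; elim/quot_ind=> b; elim/quot_ind=> c.
by rewrite -!quot_piD -!quot_piM mulrDl quot_piD.
Qed.

Fact quot_mulDr : right_distributive quot_mul +%R.
Proof.
elim/quot_ind=> a; elim/quot_ind=> b; elim/quot_ind=> c.
by rewrite -!quot_piD -!quot_piM mulrDr quot_piD.
Qed.

HB.instance Definition _ := GRing.Zmodule_isPzRing.Build quot_alg
  quot_mulA quot_mul1l quot_mul1r quot_mulDl quot_mulDr.

Fact quot_scaleA c d u : quot_scale c (quot_scale d u) = quot_scale (c * d) u.
Proof. by elim/quot_ind: u => a; rewrite -!quot_piZ scalerA. Qed.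

Fact quot_scale1 : left_id 1 quot_scale.
Proof. by elim/quot_ind=> a; rewrite -quot_piZ scale1r. Qed.

Fact quot_scaleDr : right_distributive quot_scale +%R.
Proof.
move=> c; elim/quot_ind=> a; elim/quot_ind=> b.
by rewrite -quot_piD -!quot_piZ scalerDr quot_piD.
Qed.

Fact quot_scaleDl u : {morph quot_scale^~ u : c d / c + d}.
Proof.
by elim/quot_ind: u => a c d; rewrite -!quot_piZ scalerDl quot_piD.
Qed.

HB.instance Definition _ := GRing.Zmodule_isLmodule.Build k quot_alg
  quot_scaleA quot_scale1 quot_scaleDr quot_scaleDl.

Lemma quot_pi1 : quot_pi 1 = 1. Proof. by []. Qed.

Lemma quot_pi_mul : {morph quot_pi : a b / a * b}.
Proof. exact: quot_piM. Qed.

Lemma quot_pi_scale c : {morph quot_pi : a / c *: a}.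
Proof. exact: quot_piZ. Qed.

End QuotientAlgebra.

(* A / I and B / J are isomorphic as k-algebras.  The algebra structures of the
   library exclude the zero ring, hence the k-linear ring isomorphisms. *)
Definition quot_iso (k : fieldType) (A B : algType k) (I : ideal A)
  (J : ideal B) : Prop :=
  exists f : {rmorphism quot_alg I -> quot_alg J}, scalable f /\ bijective f.

Record pregroup := PreGroup {
  pg_sort :> choiceType;
  pg_one : pg_sort;
  pg_mul : pg_sort -> pg_sort -> pg_sort;
  pg_inv : pg_sort -> pg_sort;
  pg_eqv : pg_sort -> pg_sort -> Prop;
  pg_refl : forall u, pg_eqv u u;
  pg_sym : forall u v, pg_eqv u v -> pg_eqv v u;
  pg_trans : forall u v w, pg_eqv u v -> pg_eqv v w -> pg_eqv u w;
  pg_cong : forall u u' v v',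
    pg_eqv u u' -> pg_eqv v v' -> pg_eqv (pg_mul u v) (pg_mul u' v');
  pg_mulA : forall u v w,
    pg_eqv (pg_mul u (pg_mul v w)) (pg_mul (pg_mul u v) w);
  pg_mul1 : forall u, pg_eqv (pg_mul pg_one u) u;
  pg_mulr1 : forall u, pg_eqv (pg_mul u pg_one) u;
  pg_mulV : forall u, pg_eqv (pg_mul (pg_inv u) u) pg_one;
  pg_mulrV : forall u, pg_eqv (pg_mul u (pg_inv u)) pg_one
}.

Section GroupQuotient.
Variable P : pregroup.
Implicit Types u v w : P.

Definition pg_rel : rel P := fun u v => `[< pg_eqv u v >].

Lemma pg_rel_equiv : equiv_class_of pg_rel.
Proof.
split=> [u|u v|v u w]; first by apply/asboolP; exact: pg_refl.
  by apply/asboolP/asboolP; exact: pg_sym.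
by move=> /asboolP uv /asboolP vw; apply/asboolP; exact: pg_trans uv vw.
Qed.

Canonical pg_equiv := EquivRelPack pg_rel_equiv.
Canonical pg_encModRel := defaultEncModRel pg_rel.

Definition grp_quot := {eq_quot pg_rel}%qT.

HB.instance Definition _ := Choice.on grp_quot.

Definition grp_pi (u : P) : grp_quot := \pi_(grp_quot)%qT u.
Definition grp_repr (x : grp_quot) : P := repr x.

Lemma grp_reprK x : grp_pi (grp_repr x) = x.
Proof. exact: reprK. Qed.

Lemma grp_piP u v : grp_pi u = grp_pi v <-> pg_eqv u v.
Proof.
have E : (grp_pi u == grp_pi v) = pg_rel u v by exact: eqmodE.
split=> [/eqP|uv]; first by rewrite E => /asboolP.
by apply/eqP; rewrite E; apply/asboolP.
Qed.

Lemma grp_pi_repr u : pg_eqv (grp_repr (grp_pi u)) u.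
Proof. by apply/grp_piP; rewrite grp_reprK. Qed.

Lemma grp_ind (R : grp_quot -> Prop) :
  (forall u, R (grp_pi u)) -> forall x, R x.
Proof. by move=> PR x; rewrite -(grp_reprK x). Qed.

End GroupQuotient.

HB.lock Definition grp_mul (P : pregroup) (x y : grp_quot P) : grp_quot P :=
  grp_pi (pg_mul (grp_repr x) (grp_repr y)).

HB.lock Definition grp_inv (P : pregroup) (x : grp_quot P) : grp_quot P :=
  grp_pi (pg_inv (grp_repr x)).

Section GroupQuotientOps.
Variable P : pregroup.
Local Notation grp_quot := (grp_quot P).
Local Notation grp_one := (grp_pi (pg_one P)).
Local Notation grp_mul := (@grp_mul P).
Local Notation grp_inv := (@grp_inv P).
Implicit Types u v w : P.

Lemma grp_piM u v : grp_pi (pg_mul u v) = grp_mul (grp_pi u) (grp_pi v).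
Proof.
by rewrite grp_mul.unlock; apply/esym/grp_piP/pg_cong; exact: grp_pi_repr.
Qed.

Lemma grp_piV u : grp_pi (pg_inv u) = grp_inv (grp_pi u).
Proof.
set v := pg_inv u; set x := grp_inv _.
have vu : grp_mul (grp_pi v) (grp_pi u) = grp_one.
  by rewrite -grp_piM; apply/grp_piP/pg_mulV.
have ux : grp_mul (grp_pi u) x = grp_one.
  rewrite /x grp_inv.unlock -[X in grp_mul X _]grp_reprK -grp_piM.
  exact/grp_piP/pg_mulrV.
have e1 : grp_mul grp_one x = x.
  by rewrite -[x]grp_reprK -grp_piM; apply/grp_piP/pg_mul1.
rewrite -[RHS]e1 -vu -{1}[x]grp_reprK -!grp_piM.
apply/grp_piP; apply: pg_trans (pg_mulA _ _ _).
apply: pg_trans (pg_sym (pg_mulr1 v)) _; apply: pg_cong; first exact: pg_refl.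
by apply/grp_piP; rewrite grp_piM grp_reprK ux.
Qed.

Fact grp_mulA : associative grp_mul.
Proof.
elim/grp_ind=> u; elim/grp_ind=> v; elim/grp_ind=> w.
by rewrite -!grp_piM; apply/grp_piP; exact: pg_mulA.
Qed.

Fact grp_mul1 : left_id grp_one grp_mul.
Proof. by elim/grp_ind=> u; rewrite -grp_piM; apply/grp_piP/pg_mul1. Qed.

Fact grp_mulr1 : right_id grp_one grp_mul.
Proof. by elim/grp_ind=> u; rewrite -grp_piM; apply/grp_piP/pg_mulr1. Qed.

Fact grp_mulV : left_inverse grp_one grp_inv grp_mul.
Proof.
move=> x; rewrite grp_inv.unlock -[x in grp_mul _ x]grp_reprK -grp_piM.
exact/grp_piP/pg_mulV.
Qed.

Fact grp_mulrV : right_inverse grp_one grp_inv grp_mul.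
Proof.
move=> x; rewrite grp_inv.unlock -[x in grp_mul x _]grp_reprK -grp_piM.
exact/grp_piP/pg_mulrV.
Qed.

HB.instance Definition _ := isGroup.Build grp_quot
  grp_mulA grp_mul1 grp_mulr1 grp_mulV grp_mulrV.

Lemma grp_pi_mul u v : grp_pi (pg_mul u v) = (grp_pi u * grp_pi v)%g.
Proof. exact: grp_piM. Qed.

Lemma grp_pi_inv u : grp_pi (pg_inv u) = (grp_pi u)^-1%g.
Proof. exact: grp_piV. Qed.

Lemma grp_pi_one : grp_pi (pg_one P) = 1%g.
Proof. by []. Qed.

End GroupQuotientOps.

Definition group_iso (G H : groupType) : Prop :=
  exists f : {multiplicative G -> H}, bijective f.

(* Isomorphism with an additively written abelian group. *)
Definition group_iso_zmod (G : groupType) (V : zmodType) : Prop :=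
  exists f : G -> V, bijective f /\ {morph f : x y / (x * y)%g >-> x + y}.

Definition trivial_group (G : groupType) : Prop := forall x : G, x = 1%g.

Definition surjects_onto (G H : groupType) : Prop :=
  exists f : {multiplicative G -> H}, forall y, exists x, f x = y.

Section FreeGroup.
Variable T : choiceType.

(* (t, false) stands for the generator t, and (t, true) for its inverse. *)
Definition fletter_inv (l : T * bool) : T * bool := (l.1, ~~ l.2).

Inductive free_eqv : seq (T * bool) -> seq (T * bool) -> Prop :=
| free_refl w : free_eqv w w
| free_sym w1 w2 : free_eqv w1 w2 -> free_eqv w2 w1
| free_trans w1 w2 w3 : free_eqv w1 w2 -> free_eqv w2 w3 -> free_eqv w1 w3
| free_cancel w1 l w2 : free_eqv (w1 ++ l :: fletter_inv l :: w2) (w1 ++ w2).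

Definition free_inv (w : seq (T * bool)) := rev (map fletter_inv w).

Lemma fletter_invK : involutive fletter_inv.
Proof. by case=> t b; rewrite /fletter_inv /= negbK. Qed.

Lemma free_invK : involutive free_inv.
Proof.
by move=> w; rewrite /free_inv map_rev revK mapK //; exact: fletter_invK.
Qed.

Lemma free_cong_l w u v : free_eqv u v -> free_eqv (w ++ u) (w ++ v).
Proof.
elim=> [u'|u1 u2 _|u1 u2 u3 _ h1 _ h2|w1 l w2]; first exact: free_refl.
- exact: free_sym.
- exact: free_trans h1 h2.
- by rewrite !catA; exact: free_cancel.
Qed.

Lemma free_cong_r w u v : free_eqv u v -> free_eqv (u ++ w) (v ++ w).
Proof.
elim=> [u'|u1 u2 _|u1 u2 u3 _ h1 _ h2|w1 l w2]; first exact: free_refl.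
- exact: free_sym.
- exact: free_trans h1 h2.
- by rewrite -!catA /=; exact: free_cancel.
Qed.

Lemma free_cong u u' v v' :
  free_eqv u u' -> free_eqv v v' -> free_eqv (u ++ v) (u' ++ v').
Proof.
by move=> uu vv; apply: free_trans (free_cong_l _ vv); exact: free_cong_r.
Qed.

Lemma free_mulrV w : free_eqv (w ++ free_inv w) [::].
Proof.
elim: w => [|l w IHw]; first exact: free_refl.
rewrite /free_inv map_cons rev_cons -cats1 -/(free_inv w) cat_cons catA.
apply: free_trans (free_cancel [::] l [::]).
exact: (free_cong_l [:: l] (free_cong_r [:: fletter_inv l] IHw)).
Qed.

Lemma free_mulV w : free_eqv (free_inv w ++ w) [::].
Proof. by rewrite -{2}(free_invK w); exact: free_mulrV. Qed.

Definition free_pregroup : pregroup.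
Proof.
apply: (@PreGroup (seq (T * bool)) [::] cat free_inv free_eqv).
- exact: free_refl.
- exact: free_sym.
- exact: free_trans.
- exact: free_cong.
- by move=> u v w; rewrite catA; exact: free_refl.
- by move=> u; exact: free_refl.
- by move=> u; rewrite cats0; exact: free_refl.
- exact: free_mulV.
- exact: free_mulrV.
Defined.

Definition free_group := grp_quot free_pregroup.

HB.instance Definition _ := Group.on free_group.

End FreeGroup.

(* Q with a formal inverse inr a added for each arrow a, which itself becomes
   inl a. *)
Definition double_quiver (Q : quiver) : quiver :=
  @Quiver (vert Q) (arrow Q + arrow Q)%type
  (fun l => match l with inl a => asrc a | inr a => atgt a end)
  (fun l => match l with inl a => atgt a | inr a => asrc a end)
  (quiver_nonempty Q).

Definition walk (Q : quiver) := qpath (double_quiver Q).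

HB.instance Definition _ (Q : quiver) := Choice.on (walk Q).

Section Walks.
Variable Q : quiver.

Definition fwd (a : arrow Q) : walk Q := @apath (double_quiver Q) (inl a).
Definition bwd (a : arrow Q) : walk Q := @apath (double_quiver Q) (inr a).
Definition ewalk (x : vert Q) : walk Q := @epath (double_quiver Q) x.

Lemma walk_of_subproof (p : qpath Q) :
  @word_ok (double_quiver Q) (psrc p) (map inl (pword p)).
Proof.
case: p => -[x w] /=; rewrite /psrc /pword /=.
elim: w => //= a w IHw /andP[aw ww]; rewrite IHw // andbT.
by move: aw; case: w {IHw ww}.
Qed.

(* A path of Q, seen as a walk. *)
Definition walk_of (p : qpath Q) : walk Q :=
  @QPath (double_quiver Q) (psrc p, map inl (pword p)) (walk_of_subproof p).

Lemma psrc_walk_of p : psrc (walk_of p) = psrc p. Proof. by []. Qed.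

Lemma ptgt_walk_of p : ptgt (walk_of p) = ptgt p.
Proof. by case: p => -[x w] ok; rewrite /ptgt /psrc /pword; case: w ok. Qed.

Definition letter_inv (l : arrow (double_quiver Q)) : arrow (double_quiver Q) :=
  match l with inl a => inr a | inr a => inl a end.

Lemma letter_invK : involutive letter_inv. Proof. by case. Qed.
Lemma asrc_letter_inv l : asrc (letter_inv l) = atgt l. Proof. by case: l. Qed.
Lemma atgt_letter_inv l : atgt (letter_inv l) = asrc l. Proof. by case: l. Qed.

Lemma winv_word (x : vert (double_quiver Q)) w : word_ok x w ->
  word_ok (word_tgt x w) (rev (map letter_inv w)) /\
  word_tgt (word_tgt x w) (rev (map letter_inv w)) = x.
Proof.
elim: w => // l w IHw /andP[/eqP lw /IHw [ok tgt]].
rewrite map_cons rev_cons -cats1 word_ok_cat word_tgt_cat.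
have -> : word_tgt (word_tgt x (l :: w)) [:: letter_inv l] = word_tgt x w.
  by rewrite -lw -atgt_letter_inv.
rewrite ok tgt; split=> //.
by rewrite /word_ok asrc_letter_inv !eqxx.
Qed.

Lemma winv_subproof (w : walk Q) :
  @word_ok (double_quiver Q) (ptgt w) (rev (map letter_inv (pword w))).
Proof. by case: (winv_word (valP w)). Qed.

Definition winv (w : walk Q) : walk Q :=
  @QPath (double_quiver Q) (ptgt w, rev (map letter_inv (pword w)))
    (winv_subproof w).

Lemma psrc_winv w : psrc (winv w) = ptgt w. Proof. by []. Qed.

Lemma ptgt_winv w : ptgt (winv w) = psrc w.
Proof. by case: (winv_word (valP w)). Qed.

Lemma winvK : involutive winv.
Proof.
move=> w; apply: qpath_eq; rewrite ?psrc_winv ?ptgt_winv //.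
by rewrite /pword /= map_rev revK mapK //; exact: letter_invK.
Qed.

End Walks.

Section Homotopy.
Variables (k : fieldType) (Q : quiver) (J : ideal (path_algebra k Q)).

Definition minimal_relation n (t : 'I_n -> k) (u : 'I_n -> qpath Q) : Prop :=
  [/\ forall i, t i != 0,
      injective u,
      forall i j, parallel (u i) (u j),
      J (\sum_i t i *: pelt k (u i)) &
      forall S : {set 'I_n}, S != set0 -> S \proper setT ->
        ~ J (\sum_(i in S) t i *: pelt k (u i))].

Inductive homotopic : walk Q -> walk Q -> Prop :=
| hom_refl w : homotopic w w
| hom_sym v w : homotopic v w -> homotopic w v
| hom_trans u v w : homotopic u v -> homotopic v w -> homotopic u w
| hom_fwd_bwd a : homotopic (path_comp (fwd a) (bwd a)) (ewalk (atgt a))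
| hom_bwd_fwd a : homotopic (path_comp (bwd a) (fwd a)) (ewalk (asrc a))
| hom_comp w v v' u :
    composable w v -> composable v u -> composable w v' -> composable v' u ->
    homotopic v v' ->
    homotopic (path_comp w (path_comp v u)) (path_comp w (path_comp v' u))
| hom_rel n (t : 'I_n -> k) (u : 'I_n -> qpath Q) i j :
    minimal_relation t u -> homotopic (walk_of (u i)) (walk_of (u j)).

Lemma homotopic_parallel v w : homotopic v w -> parallel v w.
Proof.
have cfb (a : arrow Q) : composable (fwd a) (bwd a) by exact: eqxx.
have cbf (a : arrow Q) : composable (bwd a) (fwd a) by exact: eqxx.
elim=> {v w}.
- by move=> w; rewrite /parallel !eqxx.
- by move=> v w _; rewrite /parallel eq_sym [ptgt v == _]eq_sym.
- move=> u v w _ /andP[/eqP uv1 /eqP uv2] _ /andP[/eqP vw1 /eqP vw2].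
  by rewrite /parallel uv1 uv2 vw1 vw2 !eqxx.
- by move=> a; rewrite /parallel psrc_path_comp ?ptgt_path_comp // !eqxx.
- by move=> a; rewrite /parallel psrc_path_comp ?ptgt_path_comp // !eqxx.
- move=> w v v' u wv vu wv' v'u _ _.
  have c1 : composable w (path_comp v u) by rewrite /composable ptgt_path_comp.
  have c2 : composable w (path_comp v' u) by rewrite /composable ptgt_path_comp.
  by rewrite /parallel !psrc_path_comp // !ptgt_path_comp // !eqxx.
- move=> n t u i j [_ _ /(_ i j) /andP[/eqP s /eqP t'] _ _].
  by rewrite /parallel !psrc_walk_of !ptgt_walk_of s t' !eqxx.
Qed.

Lemma hom_comp_l w v v' : composable w v -> homotopic v v' ->
  homotopic (path_comp w v) (path_comp w v').
Proof.
move=> wv vv'; have /andP[/eqP s /eqP t] := homotopic_parallel vv'.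
rewrite -(path_comp_epath_r v) -(path_comp_epath_r v') s; apply: hom_comp => //.
- by rewrite /composable s ptgt_epath.
- by rewrite /composable -t.
- by rewrite /composable ptgt_epath.
Qed.

Lemma hom_comp_r v v' u : composable v u -> homotopic v v' ->
  homotopic (path_comp v u) (path_comp v' u).
Proof.
move=> vu vv'; have /andP[/eqP s /eqP t] := homotopic_parallel vv'.
have v'u : composable v' u by rewrite /composable -s.
rewrite -(path_comp_epath_l (path_comp v u)).
rewrite -(path_comp_epath_l (path_comp v' u)).
rewrite !ptgt_path_comp // t; apply: hom_comp => //.
  by rewrite /composable psrc_epath t.
by rewrite /composable psrc_epath.
Qed.

Lemma hom_winv_r (w : walk Q) :
  homotopic (path_comp w (winv w)) (@ewalk Q (ptgt w)).
Proof.
case: w => -[x w]; elim: w => [|l w IHw] ok.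
  pose p : walk Q := QPath ok; rewrite -[QPath ok]/p.
  have -> : path_comp p (winv p) = @ewalk Q (ptgt p); last exact: hom_refl.
  have c : composable p (winv p) by rewrite /composable ptgt_winv.
  by apply: qpath_eq; rewrite ?psrc_path_comp ?pword_path_comp.
have /andP[/eqP lw okw] := ok.
pose p : walk Q := QPath ok; rewrite -[QPath ok]/p.
pose q : walk Q := @QPath (double_quiver Q) (x, w) okw.
pose a : walk Q := @apath (double_quiver Q) l.
pose b : walk Q := @apath (double_quiver Q) (letter_inv l).
have h : homotopic (path_comp q (winv q)) (@ewalk Q (ptgt q)) := IHw okw.
have asq : asrc l = ptgt q by exact: lw.
have bt : ptgt b = ptgt q by rewrite ptgt_apath atgt_letter_inv.
have aq : composable a q by rewrite /composable psrc_apath asq.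
have qb : composable (winv q) b by rewrite /composable psrc_winv bt.
have qq : composable q (winv q) by rewrite /composable ptgt_winv.
have c1 : composable (path_comp q (winv q)) b.
  by rewrite /composable psrc_path_comp.
have c2 : composable a (path_comp (path_comp q (winv q)) b).
  by rewrite /composable !ptgt_path_comp.
have pp : composable p (winv p) by rewrite /composable ptgt_winv.
have -> : path_comp p (winv p) =
          path_comp a (path_comp (path_comp q (winv q)) b).
  apply: qpath_eq.
    by rewrite !psrc_path_comp // psrc_winv psrc_apath asrc_letter_inv.
  by rewrite !pword_path_comp // /pword /= rev_cons -cats1 catA.
have c3 : composable a (@ewalk Q (ptgt q)).
  by rewrite /composable psrc_apath asq.
have c4 : composable (@ewalk Q (ptgt q)) b by rewrite /composable bt.
have c5 : composable a (path_comp q (winv q)).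
  by rewrite /composable ptgt_path_comp.
apply: (hom_trans (hom_comp c5 c1 c3 c4 h)).
rewrite -bt path_comp_epath_l -[ptgt p]/(atgt l) /a /b.
by case: (l) => c; [exact: hom_fwd_bwd | exact: hom_bwd_fwd].
Qed.

Lemma hom_winv_l (w : walk Q) :
  homotopic (path_comp (winv w) w) (@ewalk Q (psrc w)).
Proof.
by rewrite -{2}(winvK w) -ptgt_winv; exact: hom_winv_r.
Qed.

Variable x : vert Q.

Definition closed_at : pred (walk Q) := fun w => (psrc w == x) && (ptgt w == x).

Definition closed_walk := {w : walk Q | closed_at w}.

HB.instance Definition _ := Choice.on closed_walk.

Lemma closed_composable (u v : closed_walk) : composable (val u) (val v).
Proof.
have /andP[/eqP us _] := valP u; have /andP[_ /eqP vt] := valP v.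
by rewrite /composable us vt.
Qed.

Lemma cw_one_subproof : closed_at (ewalk x).
Proof. by rewrite /closed_at ptgt_epath !eqxx. Qed.

Lemma cw_mul_subproof (u v : closed_walk) :
  closed_at (path_comp (val u) (val v)).
Proof.
have c := closed_composable u v.
rewrite /closed_at psrc_path_comp // ptgt_path_comp //.
by have /andP[_ ->] := valP u; have /andP[-> _] := valP v.
Qed.

Lemma cw_inv_subproof (u : closed_walk) : closed_at (winv (val u)).
Proof. by have /andP[us ut] := valP u; rewrite /closed_at ptgt_winv us ut. Qed.

Definition cw_one : closed_walk := Sub (ewalk x) cw_one_subproof.
Definition cw_mul (u v : closed_walk) : closed_walk :=
  Sub (path_comp (val u) (val v)) (cw_mul_subproof u v).
Definition cw_inv (u : closed_walk) : closed_walk :=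
  Sub (winv (val u)) (cw_inv_subproof u).
Definition cw_eqv (u v : closed_walk) : Prop := homotopic (val u) (val v).

Definition pi1_pregroup : pregroup.
Proof.
apply: (@PreGroup closed_walk cw_one cw_mul cw_inv cw_eqv).
- by move=> u; exact: hom_refl.
- by move=> u v; exact: hom_sym.
- by move=> u v w; exact: hom_trans.
- move=> u u' v v' uu vv; apply: (@hom_trans _ (path_comp (val u') (val v))).
    by apply: hom_comp_r => //; exact: closed_composable.
  by apply: hom_comp_l => //; exact: closed_composable.
- move=> u v w; rewrite /cw_eqv /= path_compA; first exact: hom_refl.
    exact: closed_composable.
  exact: closed_composable.
- move=> [u ux]; rewrite /cw_eqv /=; have /andP[_ /eqP ut] := ux.
  by rewrite -[X in ewalk X]ut path_comp_epath_l; exact: hom_refl.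
- move=> [u ux]; rewrite /cw_eqv /=; have /andP[/eqP us _] := ux.
  by rewrite -[X in ewalk X]us path_comp_epath_r; exact: hom_refl.
- move=> [u ux]; rewrite /cw_eqv /=; have /andP[/eqP us _] := ux.
  by rewrite -[X in ewalk X]us; exact: hom_winv_l.
- move=> [u ux]; rewrite /cw_eqv /=; have /andP[_ /eqP ut] := ux.
  by rewrite -[X in ewalk X]ut; exact: hom_winv_r.
Defined.

Definition pi1 := grp_quot pi1_pregroup.

HB.instance Definition _ := Group.on pi1.

End Homotopy.

Arguments homotopic {k Q} J _ _.
Arguments pi1 {k Q} J x.

Section Presentations.
Variables (k : fieldType) (Q : quiver).
Local Notation kQ := (path_algebra k Q).
Implicit Types (I J : ideal kQ) (a : arrow Q) (u : qpath Q) (tau : k).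

Definition arrow_ideal : ideal kQ :=
  gen (fun f => exists a, f = pelt k (apath a)).

Definition admissible J : Prop :=
  exists N, [/\ (2 <= N)%N, ideal_sub (ideal_exp arrow_ideal N) J &
                ideal_sub J (ideal_exp arrow_ideal 2)].

(* J is an admissible presentation of the algebra kQ / I. *)
Definition admissible_presentation I J : Prop :=
  admissible J /\ quot_iso J I.

Definition bypass a u : Prop :=
  [/\ u <> apath a, psrc u = asrc a & ptgt u = atgt a].

(* phi is the automorphism phi_{a,u,tau}, which requires that (a, u) is a
   bypass and tau is nonzero. *)
Definition is_transvection a u tau (phi : {lrmorphism kQ -> kQ}) : Prop :=
  [/\ bypass a u /\ tau != 0,
      bijective phi,
      forall x, phi (pelt k (epath x)) = pelt k (epath x),
      phi (pelt k (apath a)) = pelt k (apath a) + tau *: pelt k u &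
      forall b, b != a -> phi (pelt k (apath b)) = pelt k (apath b)].

(* J' = phi_{a,u,tau}(J). *)
Definition transvection_image a u tau J J' : Prop :=
  exists phi : {lrmorphism kQ -> kQ},
    is_transvection a u tau phi /\ is_image phi J J'.

(* In what follows, r and r' are relations on walks.  By extensionality, two
   homotopy relations are equal when they relate the same walks. *)

(* The vertices of Gamma, for the algebra A = kQ / I. *)
Definition gamma_vertex I (r : walk Q -> walk Q -> Prop) : Prop :=
  exists2 J, admissible_presentation I J & r = homotopic J.

(* There is exactly one arrow r -> r' in Gamma when this holds, else none. *)
Definition gamma_arrow I (r r' : walk Q -> walk Q -> Prop) : Prop :=
  exists J J' a u tau,
    [/\ admissible_presentation I J /\ admissible_presentation I J',
        r = homotopic J /\ r' = homotopic J',
        transvection_image a u tau J J',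
        ~ homotopic J (walk_of (apath a)) (walk_of u) &
        homotopic J' (walk_of (apath a)) (walk_of u)].

Definition gamma_path I : (walk Q -> walk Q -> Prop) ->
  (walk Q -> walk Q -> Prop) -> Prop := clos_refl_trans _ (gamma_arrow I).

Definition gamma_source I r : Prop :=
  gamma_vertex I r /\ forall r', ~ gamma_arrow I r' r.

End Presentations.

Variant vertex3 := v1 | v2 | v3.

Definition vertex3_code x := match x with v1 => 0 | v2 => 1 | v3 => 2 end%N.
Definition vertex3_decode n := match n with 0 => v1 | 1 => v2 | _ => v3 end%N.
Lemma vertex3_codeK : cancel vertex3_code vertex3_decode. Proof. by case. Qed.
HB.instance Definition _ := Countable.copy vertex3 (can_type vertex3_codeK).
Lemma vertex3_enumP : Finite.axiom [:: v1; v2; v3]. Proof. by case. Qed.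
HB.instance Definition _ := isFinite.Build vertex3 vertex3_enumP.

Variant arrow4 := alpha1 | alpha2 | beta1 | beta2.

Definition arrow4_code a :=
  match a with alpha1 => 0 | alpha2 => 1 | beta1 => 2 | beta2 => 3 end%N.
Definition arrow4_decode n :=
  match n with 0 => alpha1 | 1 => alpha2 | 2 => beta1 | _ => beta2 end%N.
Lemma arrow4_codeK : cancel arrow4_code arrow4_decode. Proof. by case. Qed.
HB.instance Definition _ := Countable.copy arrow4 (can_type arrow4_codeK).
Lemma arrow4_enumP : Finite.axiom [:: alpha1; alpha2; beta1; beta2].
Proof. by case. Qed.
HB.instance Definition _ := isFinite.Build arrow4 arrow4_enumP.

Lemma vertex3_gt0 : (0 < #|{: vertex3}|)%N.
Proof. by apply/card_gt0P; exists v1. Qed.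

Definition Q0 : quiver := @Quiver vertex3 arrow4
  (fun a => match a with alpha1 | alpha2 => v2 | _ => v3 end)
  (fun a => match a with alpha1 | alpha2 => v1 | _ => v2 end)
  vertex3_gt0.

Section Example.
Variable k : fieldType.

Definition arr_elt (a : arrow4) : path_algebra k Q0 := pelt k (@apath Q0 a).

Local Notation a1 := (arr_elt alpha1).
Local Notation a2 := (arr_elt alpha2).
Local Notation b1 := (arr_elt beta1).
Local Notation b2 := (arr_elt beta2).

Definition I0 := gens [:: a1 * b1; a2 * b2].
Definition I1 := gens [:: (a1 - a2) * b1; a2 * b2].
Definition I2 := gens [:: a1 * (b1 - b2); a2 * b2].
Definition I3 := gens [:: a1 * b1 - a2 * b1 - a1 * b2; a2 * b2].
Definition I4 := gens [:: a1 * b1 + a2 * b2; a2 * b1 + a1 * b2].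

End Example.

(* Main.v *)
Require Import Defs.
From Stdlib Require Import List Relations.
From HB Require Import structures.
From mathcomp Require Import all_boot all_order all_algebra.
From mathcomp Require Import finmap boolp ring zify.

Set Implicit Arguments.
Unset Strict Implicit.
Unset Printing Implicit Defensive.

Import GRing.Theory.
Local Open Scope ring_scope.

(* An ideal of kQ is admissible iff it is a subspace of the four-dimensional
   span of the paths alpha_i beta_j, and then its homotopy relation is determined
   by which of these four paths are homotopic, that is, by the finest coordinate
   decomposition of k^4 along which the subspace splits.  Cancelling a common
   arrow, everything reduces to four flags: alpha1 ~ alpha2, beta1 ~ beta2 and
   the two diagonal identifications.  Any two flags of different kinds force all
   of them, and exactly one diagonal flag cannot occur for a presentation of A:
   an isomorphism kQ / J ~ A shows that J is spanned by two tensors of rank one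
   in general position.  This leaves the five relations.  A transvection of the
   alphas commutes with the projections onto the columns {alpha_1 beta_j,
   alpha_2 beta_j}, hence preserves the property of splitting along columns
   (neither beta1 ~ beta2 nor a diagonal flag); similarly for the betas and the
   rows, and this determines the arrows.  Fundamental groups are computed with
   the maximal tree {alpha2, beta2}: every walk is homotopic to a normal form
   read off from a group-valued function on letters compatible with J. *)

(** * Ideals and endomorphisms of path algebras *)

(** A minimal relation of J may be any element of J, so generators alone never show that two paths
    are not homotopic. The proof works instead with stability under coordinate projections.
    Projecting onto a union of homotopy classes preserves J; conversely, if J is stable under the
    projections of a partition of the paths, every minimal relation lies inside one block. Absence
    of flags thus becomes a linear property of J, which can be carried through automorphisms and is
    detected by counting letters in an abelian group. Presence of a flag is shown by one element of
    J, provided that no element of J supported inside it separates the two paths.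

    An isomorphism between kQ/J and A need not fix the vertices. It is used only through products of
    lifted arrows, whose coefficients at trivial paths vanish by nilpotency. The characteristic
    enters through the factors 1/2 of phi: the lines spanned by alpha1 - alpha2 and alpha1 + alpha2
    must be different. *)

Lemma idealN_mem (A : pzRingType) (J : ideal A) (a : A) : J a -> J (- a).
Proof.
by move=> Ja; rewrite -[- a]sub0r; apply: idealB => //;
  exact: ideal0.
Qed.

Lemma idealD_mem (A : pzRingType) (J : ideal A) (a b : A) :
  J a -> J b -> J (a + b).
Proof.
by move=> Ja Jb; rewrite -[b]opprK; apply: idealB => //;
  exact: idealN_mem.
Qed.

Lemma ideal_sum (A : pzRingType) (J : ideal A) (I : Type) (r : seq I)
  (P : pred I) (F : I -> A) :
  (forall i, P i -> J (F i)) -> J (\sum_(i <- r | P i) F i).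
Proof.
move=> JF; elim/big_rec: _ => [|i a Pi Ja]; first exact: ideal0.
by apply: idealD_mem => //; exact: JF.
Qed.

Lemma idealZ (k : fieldType) (A : algType k) (J : ideal A) (c : k) (a : A) :
  J a -> J (c *: a).
Proof. by move=> Ja; rewrite -mulr_algl; exact: idealMl. Qed.

Lemma gen_incl (A : pzRingType) (S : A -> Prop) (a : A) : S a -> gen S a.
Proof. by move=> Sa J; exact. Qed.

Lemma gen_sub (A : pzRingType) (S : A -> Prop) (J : ideal A) :
  (forall a, S a -> J a) -> ideal_sub (gen S) J.
Proof. by move=> SJ a; apply. Qed.

Section Automorphisms.
Variables (k : fieldType) (Q : quiver).
Local Notation kQ := (path_algebra k Q).
Implicit Types (f : kQ) (p q : qpath Q).

Definition path_lin (h : qpath Q -> kQ) f : kQ :=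
  \sum_(p <- psupp f) pcoef p f *: h p.

Lemma path_linw h f (d : {fset qpath Q}) : (psupp f `<=` d)%fset ->
  path_lin h f = \sum_(p <- d) pcoef p f *: h p.
Proof.
move=> le; rewrite /path_lin (big_fset_incl _ le) //= => p _ /psupp_out ->.
by rewrite scale0r.
Qed.

Lemma path_lin_linear h : linear (path_lin h).
Proof.
move=> c f g.
pose d := (psupp (c *: f + g)%R `|` psupp f `|` psupp g)%fset.
rewrite !(@path_linw _ _ d); first last.
- by apply/fsubsetP => p; rewrite !inE => ->; rewrite ?orbT.
- by apply/fsubsetP => p; rewrite !inE => ->; rewrite ?orbT.
- by apply/fsubsetP => p; rewrite !inE => ->; rewrite ?orbT.
rewrite scaler_sumr -big_split /=; apply: eq_bigr => p _.
by rewrite pcoefD pcoefZ scalerDl scalerA.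
Qed.

Lemma path_lin_pelt h p : path_lin h (pelt k p) = h p.
Proof.
rewrite (@path_linw _ _ [fset p]%fset).
  by rewrite big_seq_fset1 pcoef_pelt eqxx scale1r.
apply/fsubsetP => q; rewrite psupp_in pcoef_pelt !inE [q == p]eq_sym.
by case: (p == q); rewrite ?eqxx.
Qed.

Lemma linear_ext (f g : {linear kQ -> kQ}) :
  (forall p, f (pelt k p) = g (pelt k p)) -> f =1 g.
Proof.
move=> fg; elim/pa_ind => [|a b fa fb|c p]; first by rewrite !raddf0.
  by rewrite !linearD fa fb.
by rewrite !linearZ fg.
Qed.

Variable g : arrow Q -> kQ.
Hypothesis g_tgt : forall a, pelt k (epath (atgt a)) * g a = g a.
Hypothesis g_src : forall a, g a * pelt k (epath (asrc a)) = g a.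

(** The product ends with the trivial path rather than with 1, so that trivial paths are sent to
    themselves and the image of a path keeps its end idempotents. *)
Definition word_prod x w : kQ :=
  foldr (fun a f => g a * f) (pelt k (epath x)) w.
Definition path_prod p := word_prod (psrc p) (pword p).

Lemma epathM x y : pelt k (@epath Q x) * pelt k (epath y) =
  if x == y then pelt k (epath x) else 0.
Proof.
rewrite peltM /composable psrc_epath ptgt_epath; case: eqP => // <-.
by rewrite -{1}[x]ptgt_epath path_comp_epath_l.
Qed.

Lemma path_prod_tgt p : pelt k (epath (ptgt p)) * path_prod p = path_prod p.
Proof.
case: p => -[x [|a w]] ok; rewrite /path_prod /psrc /pword /ptgt /=.
  by rewrite epathM eqxx.
by rewrite mulrA g_tgt.
Qed.

Lemma path_prod_src p : path_prod p * pelt k (epath (psrc p)) = path_prod p.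
Proof.
case: p => -[x w] ok; rewrite /path_prod /psrc /pword /=.
by elim: w {ok} => [|a w IHw] /=; rewrite ?epathM ?eqxx // -mulrA IHw.
Qed.

Lemma word_prodM x w f :
  word_prod x w * f = foldr (fun a h => g a * h) (pelt k (epath x) * f) w.
Proof. by elim: w => //= a w IHw; rewrite -mulrA IHw. Qed.

Lemma path_prodM p q : composable p q ->
  path_prod (path_comp p q) = path_prod p * path_prod q.
Proof.
move=> pq; rewrite /path_prod psrc_path_comp // pword_path_comp // word_prodM.
by rewrite (eqP pq) path_prod_tgt /word_prod foldr_cat.
Qed.

(** The end idempotents can be inserted between the two factors, and trivial paths at distinct
    vertices are orthogonal. *)
Lemma path_prodM0 p q : ~~ composable p q -> path_prod p * path_prod q = 0.
Proof.
move=> /negbTE pq; rewrite -path_prod_src -[path_prod q]path_prod_tgt.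
by rewrite mulrA -(mulrA (path_prod p)) epathM -/(composable p q) pq mulr0
  mul0r.
Qed.

Lemma path_lin_monoid : monoid_morphism (path_lin path_prod).
Proof.
pose L := GRing.isLinear.Build k kQ kQ _ _ (path_lin_linear path_prod).
pose phi : {linear kQ -> kQ} := HB.pack (path_lin path_prod) L.
rewrite -[path_lin _]/(phi : kQ -> kQ).
have phiE p : phi (pelt k p) = path_prod p by exact: path_lin_pelt.
have phiZ c f : phi (c *: f) = c *: phi f by exact: linearZ.
split.
  by rewrite pa_oneE raddf_sum; apply: eq_bigr => x _; exact: phiE.
move=> a b; elim/pa_ind: a => [|a1 a2 IH1 IH2|c p].
- by rewrite mul0r !linear0 mul0r.
- by rewrite mulrDl !linearD IH1 IH2 mulrDl.
elim/pa_ind: b => [|b1 b2 IH1 IH2|d q].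
- by rewrite mulr0 !linear0 mulr0.
- by rewrite mulrDr !linearD IH1 IH2 mulrDr.
rewrite -scalerAl -scalerAr !phiZ -scalerAl -scalerAr !phiE peltM.
case: ifPn => pq; first by rewrite phiE path_prodM.
by rewrite linear0 path_prodM0.
Qed.

(** Universal property of the path algebra: arrows may go to any elements with the right end
    idempotents. It provides the transvections, the automorphism phi and, with non-invertible data,
    the projections of [col_part_map] and [row_part_map]. *)
Lemma path_algebra_map : exists phi : {lrmorphism kQ -> kQ},
  (forall x, phi (pelt k (epath x)) = pelt k (epath x)) /\
  (forall a, phi (pelt k (apath a)) = g a).
Proof.
pose L := GRing.isLinear.Build k kQ kQ _ _ (path_lin_linear path_prod).
pose M := GRing.isMonoidMorphism.Build kQ kQ _ path_lin_monoid.
pose phi : {lrmorphism kQ -> kQ} := HB.pack (path_lin path_prod) L M.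
exists phi; split=> [x|a]; rewrite [LHS]path_lin_pelt //.
by rewrite /path_prod /= g_src.
Qed.

End Automorphisms.

Section AutomorphismInverse.
Variables (k : fieldType) (Q : quiver).
Local Notation kQ := (path_algebra k Q).
Implicit Types phi psi : {lrmorphism kQ -> kQ}.

Lemma lrmorphism_path_ext phi psi :
  (forall x, phi (pelt k (epath x)) = psi (pelt k (epath x))) ->
  (forall a, phi (pelt k (apath a)) = psi (pelt k (apath a))) -> phi =1 psi.
Proof.
move=> ext exta; apply: linear_ext => -[[x w] ok].
elim: w ok => [|a w IHw] ok.
  have -> : QPath ok = epath x by exact: qpath_eq.
  exact: ext.
have /andP[/eqP aw okw] := ok.
pose p : qpath Q := @QPath Q (x, w) okw.
have c : composable (apath a) p by apply/eqP.
have -> : pelt k (QPath ok) = pelt k (apath a) * pelt k p.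
  rewrite peltM c; congr (pelt k _); apply: qpath_eq.
    by rewrite psrc_path_comp.
  by rewrite pword_path_comp.
by rewrite !rmorphM /= exta (IHw okw).
Qed.

End AutomorphismInverse.

Lemma quot_pi0 (k : fieldType) (A : algType k) (J : ideal A) :
  quot_pi J 0 = 0.
Proof. by apply: (addrI (quot_pi J 0)); rewrite -quot_piD !addr0. Qed.

Section QuotientIsomorphisms.
Variables (k : fieldType) (A B : algType k).

Lemma quot_iso_of (J : ideal A) (I : ideal B) (psi : {lrmorphism A -> B}) :
  bijective psi -> (forall a, J a <-> I (psi a)) -> quot_iso J I.
Proof.
move=> [phi psiK phiK] JI.
pose f (u : quot_alg J) : quot_alg I := quot_pi I (psi (quot_repr u)).
pose f' (u : quot_alg I) : quot_alg J := quot_pi J (phi (quot_repr u)).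
have fE a : f (quot_pi J a) = quot_pi I (psi a).
  by apply/quot_piP; rewrite -raddfB; apply/JI; exact: quot_pi_repr.
have f'E a : f' (quot_pi I a) = quot_pi J (phi a).
  apply/quot_piP/JI; rewrite linearB /= !phiK; exact: quot_pi_repr.
have fM : monoid_morphism f.
  split; first by rewrite -!quot_pi1 fE rmorph1.
  by elim/quot_ind=> a; elim/quot_ind=> b;
    rewrite -quot_pi_mul !fE rmorphM quot_pi_mul.
have fD : nmod_morphism f.
  split; last by elim/quot_ind=> a; elim/quot_ind=> b;
    rewrite -quot_piD !fE raddfD quot_piD.
  by rewrite -[LHS]/(f 0) -!quot_pi0 fE linear0.
pose N := GRing.isNmodMorphism.Build _ _ f fD.
pose M := GRing.isMonoidMorphism.Build _ _ f fM.
pose F : {rmorphism quot_alg J -> quot_alg I} := HB.pack f N M.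
have FE a : F (quot_pi J a) = quot_pi I (psi a) by exact: fE.
exists F; split.
  move=> c; elim/quot_ind=> a.
  by rewrite -quot_pi_scale !FE linearZ /= quot_pi_scale.
exists f'; elim/quot_ind=> a; first by rewrite FE f'E psiK.
by rewrite f'E FE phiK.
Qed.
End QuotientIsomorphisms.

(** Each inclusion tests the minimality of a generated ideal against another ideal: the image of
    [gen S], which is an ideal because phi is surjective, and the preimage of [gen T]. *)
Lemma image_gen (A B : pzRingType) (phi : {rmorphism A -> B})
  (S : A -> Prop) (T : B -> Prop) : bijective phi ->
  (forall a, S a -> gen T (phi a)) ->
  (forall b, T b -> exists2 a, gen S a & b = phi a) ->
  is_image phi (gen S) (gen T).
Proof.
move=> [psi phiK psiK] ST TS b; split=> [Tb|[a Sa ->]].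
  pose im b := exists2 a, gen S a & b = phi a.
  have im0 : im 0 by exists 0; [exact: ideal0 | rewrite rmorph0].
  have imB x y : im x -> im y -> im (x - y).
    move=> [a Sa ->] [a' Sa' ->]; exists (a - a'); first exact: idealB.
    by rewrite rmorphB.
  have imMl x y : im y -> im (x * y).
    move=> [a Sa ->]; exists (psi x * a); first exact: idealMl.
    by rewrite rmorphM psiK.
  have imMr x y : im y -> im (y * x).
    move=> [a Sa ->]; exists (a * psi x); first exact: Defs.idealMr.
    by rewrite rmorphM psiK.
  exact: (Tb (Ideal im0 imB imMl imMr)).
have pre0 : gen T (phi 0) by rewrite rmorph0; exact: ideal0.
have preB x y : gen T (phi x) -> gen T (phi y) -> gen T (phi (x - y)).
  by rewrite rmorphB; exact: idealB.
have preMl x y : gen T (phi y) -> gen T (phi (x * y)).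
  by move=> Ty; rewrite rmorphM; apply: idealMl.
have preMr x y : gen T (phi y) -> gen T (phi (y * x)).
  by move=> Ty; rewrite rmorphM; apply: Defs.idealMr.
exact: (Sa (@Ideal _ (fun x => gen T (phi x)) pre0 preB preMl preMr)).
Qed.

Section MinimalRelations.
Variables (k : fieldType) (Q : quiver) (J : ideal (path_algebra k Q)).
Variables (T : finType) (u : T -> qpath Q) (t : T -> k).
Hypothesis u_inj : injective u.
Hypothesis u_par : forall i j, parallel (u i) (u j).

(* The homotopy class of a path is a union of supports of minimal relations, so
   the ideal contains the part of each of its elements lying in that class. *)
Lemma ideal_homotopic_part (C : pred T) (S : {set T}) :
  (forall i j, homotopic J (walk_of (u i)) (walk_of (u j)) -> C i = C j) ->
  (forall i, i \in S -> t i != 0) ->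
  J (\sum_(i in S) t i *: pelt k (u i)) ->
  J (\sum_(i in S | C i) t i *: pelt k (u i)).
Proof.
move=> CJ; have [n] := ubnP #|S|; elim: n S => // n IHn S leSn tS JS.
(* Either a proper nonempty subsum lies in J, and induction applies to it and to its complement, or
   the whole sum is a minimal relation and [C] is constant on its support. *)
have [/existsP[R /and3P[R0 RS /asboolP JR]]|no] := boolP
  [exists R : {set T}, [&& R != set0, R \proper S &
     `[< J (\sum_(i in R) t i *: pelt k (u i)) >]]].
  have sRS := proper_sub RS.
  have split (F : T -> path_algebra k Q) : \sum_(i in S) F i =
      \sum_(i in R) F i + \sum_(i in S :\: R) F i.
    by rewrite (big_setID R) /= (setIidPr sRS).
  have splitC : \sum_(i in S | C i) t i *: pelt k (u i) =
      \sum_(i in R | C i) t i *: pelt k (u i) +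
      \sum_(i in S :\: R | C i) t i *: pelt k (u i).
    by rewrite big_mkcondr split -!big_mkcondr.
  rewrite splitC; apply: idealD_mem; apply: IHn => //.
  - by apply: leq_trans (proper_card RS) _; rewrite -ltnS.
  - by move=> i iR; apply: tS; exact: (subsetP sRS).
  - apply: leq_trans (proper_card _) _; last by rewrite -ltnS; exact: leSn.
    rewrite properEneq subsetDl andbT; apply: contraNneq R0 => /setDidPl.
    by move/setDidPl => e;
      rewrite -subset0 -(setDv S) -{2}e setDDr setDv set0U (setIidPr sRS).
  - by move=> i; rewrite inE => /andP[_]; exact: tS.
  - move: JS; rewrite split => JS.
    by rewrite -[X in J X](addKr (\sum_(i in R) t i *: pelt k (u i))) addrC;
      apply: idealB.
have [->|/set0Pn[i0 i0S]] := eqVneq S set0.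
  by rewrite big1 => [|i]; [exact: ideal0 | rewrite inE].
have CS i j : i \in S -> j \in S -> C i = C j; last first.
  have [Ci0|Ci0] := boolP (C i0).
    have <- // : \sum_(i in S) t i *: pelt k (u i) =
                 \sum_(i in S | C i) t i *: pelt k (u i).
    apply: eq_bigl => i; case iS: (i \in S) => //=.
    by rewrite (CS i i0) ?Ci0.
  rewrite big1 => [|i /andP[iS]]; first exact: ideal0.
  by rewrite (CS i i0) // (negbTE Ci0).
move=> iS jS; apply: CJ.
(* Minimal relations are indexed by ordinals, so [S] is reindexed by [enum_val]. *)
have sumE (R : {set 'I_#|S|}) : \sum_(l in R) t (enum_val
  l) *: pelt k (u (enum_val l)) =
    \sum_(l in [set enum_val l | l in R]) t l *: pelt k (u l).
  by rewrite big_imset //= => l l' _ _; exact: enum_val_inj.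
rewrite -(enum_rankK_in iS iS) -(enum_rankK_in iS jS).
apply: (@hom_rel _ _ J _ (t \o enum_val) (u \o enum_val)); split.
- by move=> l; apply: tS; exact: enum_valP.
- by move=> l l' /u_inj /enum_val_inj.
- by move=> l l'; exact: u_par.
- by move: JS; rewrite big_enum_val.
move=> R R0 RT; rewrite sumE => JR; move/negP: no; apply; apply/existsP.
exists [set enum_val l | l in R]; apply/and3P; split; last exact/asboolP.
  by rewrite imset_eq0.
rewrite properEcard; apply/andP; split.
  by apply/subsetP => l /imsetP[l' _ ->]; exact: enum_valP.
rewrite card_imset; last exact: enum_val_inj.
by have := proper_card RT; rewrite cardsT card_ord.
Qed.
End MinimalRelations.

(** * Homotopy of walks *)

Section HomotopyRelations.
Variables (k : fieldType) (Q : quiver).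
Implicit Types J : ideal (path_algebra k Q).

Lemma homotopic_sub J J' :
  (forall n (t : 'I_n -> k) u i j, minimal_relation J t u ->
     homotopic J' (walk_of (u i)) (walk_of (u j))) ->
  forall v w, homotopic J v w -> homotopic J' v w.
Proof.
move=> JJ' v w; elim=> {v w}.
- exact: hom_refl.
- by move=> v w _; exact: hom_sym.
- by move=> u v w _ uv _; exact: hom_trans.
- exact: hom_fwd_bwd.
- exact: hom_bwd_fwd.
- by move=> w v v' u c1 c2 c3 c4 _ h; exact: hom_comp.
- exact: JJ'.
Qed.

Variable J : ideal (path_algebra k Q).
Local Notation DQ := (double_quiver Q).

(** Homotopy on bare words with a common source: composition becomes concatenation, and the proofs
    of well-formedness are hidden under the existential. *)
Definition hword x (w w' : seq (arrow DQ)) : Prop :=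
  exists ok ok', homotopic J (@QPath DQ (x, w) ok) (@QPath DQ (x, w') ok').

Lemma homotopic_hword v w : psrc v = psrc w ->
  homotopic J v w <-> hword (psrc v) (pword v) (pword w).
Proof.
case: v w => -[x v] okv [[y w] okw]; rewrite /psrc /pword /= => xy.
rewrite xy {x xy} in okv *; split=> [h|[ok [ok' h]]]; first by exists okv, okw.
by rewrite (bool_irrelevance okv ok) (bool_irrelevance okw ok').
Qed.

Lemma hword_homotopic v w : psrc v = psrc w ->
  hword (psrc v) (pword v) (pword w) -> homotopic J v w.
Proof. by move=> vw h; apply/homotopic_hword. Qed.

Lemma hword_refl (x : vert DQ) w : word_ok x w -> hword x w w.
Proof. by move=> ok; exists ok, ok; exact: hom_refl. Qed.

Lemma hword_sym x w w' : hword x w w' -> hword x w' w.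
Proof. by move=> [ok [ok' h]]; exists ok', ok; exact: hom_sym. Qed.

Lemma hword_trans x w1 w2 w3 : hword x w1 w2 -> hword x w2 w3 -> hword x w1 w3.
Proof.
move=> [o1 [o2 h]] [o2' [o3 h']]; exists o1, o3; apply: hom_trans h _.
by rewrite (bool_irrelevance o2 o2').
Qed.

Lemma hword_ctx (x y : vert DQ) w1 w w' w2 :
  word_ok (word_tgt x w) w1 -> word_ok y w2 -> word_tgt y w2 = x ->
  hword x w w' -> hword y (w1 ++ w ++ w2) (w1 ++ w' ++ w2).
Proof.
move=> ok1 ok2 yx; rewrite -{x}yx in ok1 *; move=> [ok [ok' h]].
have /andP[_ /eqP tw] := homotopic_parallel h.
pose W1 : walk Q := @QPath DQ (word_tgt (word_tgt y w2) w, w1) ok1.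
pose W2 : walk Q := @QPath DQ (y, w2) ok2.
pose W : walk Q := @QPath DQ (word_tgt y w2, w) ok.
pose W' : walk Q := @QPath DQ (word_tgt y w2, w') ok'.
have c1 : composable W1 W by exact: eqxx.
have c2 : composable W W2 by exact: eqxx.
have c3 : composable W1 W' by apply/eqP; exact: tw.
have c4 : composable W' W2 by exact: eqxx.
have c5 : composable W1 (path_comp W W2) by rewrite /composable ptgt_path_comp.
have c6 : composable W1 (path_comp W' W2) by rewrite /composable ptgt_path_comp.
have /homotopic_hword := hom_comp c1 c2 c3 c4 h.
by rewrite !psrc_path_comp // !pword_path_comp //; apply.
Qed.

Lemma hword_cancel (x : vert DQ) l w : word_ok x w -> atgt l = word_tgt x w ->
  hword x (l :: letter_inv l :: w) w.
Proof.
move=> ok lw; have okl : word_ok (atgt l) [:: l; letter_inv l].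
  by case: (l) => a; rewrite /= !eqxx.
have h : hword (atgt l) [:: l; letter_inv l] [::].
  have c : composable (@apath DQ l) (@apath DQ (letter_inv l)).
    by rewrite /composable psrc_apath ptgt_apath atgt_letter_inv.
  have e : path_comp (@apath DQ l) (@apath DQ (letter_inv l)) =
      @QPath DQ (atgt l, [:: l; letter_inv l]) okl.
    apply: qpath_eq; first by rewrite psrc_path_comp // psrc_apath
      asrc_letter_inv.
    by rewrite pword_path_comp.
  exists okl, isT; rewrite -e; case: (l) => a; first exact: hom_fwd_bwd.
  exact: hom_bwd_fwd.
by have := @hword_ctx (atgt l) x [::] _ _ w isT ok (esym lw) h.
Qed.

End HomotopyRelations.

Section Pi1.
Variables (k : fieldType) (Q : quiver) (x : vert Q).
Implicit Types J : ideal (path_algebra k Q).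

Lemma inj_surj_bijective (A B : Type) (f : A -> B) :
  injective f -> (forall b, exists a, f a = b) -> bijective f.
Proof.
move=> f_inj f_surj; exists (fun b => sval (cid (f_surj b))) => [a|b].
  by apply: f_inj; exact: svalP (cid (f_surj (f a))).
exact: svalP (cid (f_surj b)).
Qed.

(** The identity on closed walks descends to the quotients. *)
Lemma pi1_surjects J J' : (forall v w, homotopic J v w -> homotopic J' v w) ->
  surjects_onto (pi1 J x) (pi1 J' x).
Proof.
move=> JJ'; pose f (c : pi1 J x) : pi1 J' x :=
  @grp_pi (pi1_pregroup J' x) (grp_repr c).
have fE (u : pi1_pregroup J x) : f (grp_pi u) = @grp_pi (pi1_pregroup J' x) u.
  by apply/grp_piP; apply: JJ'; exact: (@grp_pi_repr (pi1_pregroup J x)).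
have fM : {morph f : c d / (c * d)%g}.
  elim/grp_ind=> u; elim/grp_ind=> v.
  by rewrite -grp_pi_mul !fE grp_pi_mul.
pose F : {multiplicative pi1 J x -> pi1 J' x} :=
  HB.pack f (isMultiplicative.Build _ _ f fM).
exists F; elim/grp_ind=> u; exists (@grp_pi (pi1_pregroup J x) u).
exact: fE.
Qed.

Lemma pi1_valuation J (G : Type) (op : G -> G -> G) (F : walk Q -> G) :
  (forall v w, composable v w -> F (path_comp v w) = op (F v) (F w)) ->
  (forall v w, closed_at x v -> closed_at x w ->
     homotopic J v w <-> F v = F w) ->
  (forall g, exists2 w, closed_at x w & F w = g) ->
  exists f : pi1 J x -> G,
    bijective f /\ (forall c d, f (c * d)%g = op (f c) (f d)).
Proof.
move=> FM FJ Fsurj.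
pose f (c : pi1 J x) : G := F (val (grp_repr c : closed_walk x)).
have fE (u : pi1_pregroup J x) : f (grp_pi u) = F (val (u : closed_walk x)).
  by apply/FJ; [exact: valP | exact: valP |];
  exact: (@grp_pi_repr (pi1_pregroup J x)).
exists f; split; last first.
  elim/grp_ind=> u; elim/grp_ind=> v; rewrite -grp_pi_mul !fE.
  by rewrite FM //; exact: closed_composable.
apply: inj_surj_bijective => [|g].
  elim/grp_ind=> u; elim/grp_ind=> v; rewrite !fE => uv.
  by apply/grp_piP/FJ => //; exact: valP.
have [w wx <-] := Fsurj g.
by exists (@grp_pi (pi1_pregroup J x) (Sub w wx : closed_walk x)); rewrite fE.
Qed.
End Pi1.

(** * Words in the free group of the quiver *)

Local Notation DQ := (double_quiver Q0).
Local Notation fword := (seq (bool * bool)).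

(* The generators of the free group of Q0: (false, _) is the loop
   alpha2^-1 alpha1 at v2, and (true, _) is the loop beta1 beta2^-1; they come
   from the maximal tree {alpha2, beta2}.  The second component is true for the
   inverse loop. *)
Definition letter_fword (l : arrow DQ) : fword :=
  match l with
  | inl alpha1 => [:: (false, false)] | inr alpha1 => [:: (false, true)]
  | inl beta1 => [:: (true, false)] | inr beta1 => [:: (true, true)]
  | _ => [::]
  end.

Definition walk_fword (w : seq (arrow DQ)) : fword :=
  flatten (map letter_fword w).

Definition loop_word (l : bool * bool) : seq (arrow DQ) :=
  match l with
  | (false, false) => [:: inr alpha2; inl alpha1]
  | (false, true) => [:: inr alpha1; inl alpha2]
  | (true, false) => [:: inl beta1; inr beta2]
  | (true, true) => [:: inl beta2; inr beta1]
  end.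

Definition loops_word (s : fword) : seq (arrow DQ) := flatten (map loop_word s).

(** The branches of the maximal tree rooted at [v2]. *)
Definition tree_from (y : vertex3) : seq (arrow DQ) :=
  match y with v1 => [:: inl alpha2] | v2 => [::] | v3 => [:: inr beta2] end.
Definition tree_to (y : vertex3) : seq (arrow DQ) :=
  match y with v1 => [:: inr alpha2] | v2 => [::] | v3 => [:: inl beta2] end.

Lemma loops_word_cat s1 s2 : loops_word (s1 ++ s2) =
  loops_word s1 ++ loops_word s2.
Proof. by rewrite /loops_word map_cat flatten_cat. Qed.

Lemma walk_fword_cat w1 w2 : walk_fword (w1 ++ w2) =
  walk_fword w1 ++ walk_fword w2.
Proof. by rewrite /walk_fword map_cat flatten_cat. Qed.

Lemma walk_fword_loops s : walk_fword (loops_word s) = s.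
Proof.
elim: s => // -[[] []] s IHs;
  rewrite /loops_word /= -/(loops_word s) -{2}IHs //.
Qed.

Lemma walk_fword_tree x s :
  walk_fword (tree_from x ++ loops_word s ++ tree_to x) = s.
Proof.
rewrite !walk_fword_cat walk_fword_loops.
by case: x; rewrite /= cats0.
Qed.

Lemma loops_word_ok s : @word_ok DQ v2 (loops_word s) /\
  word_tgt (v2 : vert DQ) (loops_word s) = v2.
Proof.
elim: s => // l s [ok tgt]; rewrite /loops_word /= -/(loops_word s).
by rewrite word_ok_cat word_tgt_cat ok tgt; case: l => -[] [].
Qed.

Lemma tree_to_ok x : @word_ok DQ x (tree_to x) /\ word_tgt (x :
  vert DQ) (tree_to x) = v2.
Proof. by case: x. Qed.

Lemma tree_from_ok x :
  @word_ok DQ v2 (tree_from x) /\ word_tgt (v2 : vert DQ) (tree_from x) = x.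
Proof. by case: x. Qed.

Lemma tree_loops_ok x y s :
  @word_ok DQ x (tree_from y ++ loops_word s ++ tree_to x) /\
  word_tgt (x : vert DQ) (tree_from y ++ loops_word s ++ tree_to x) = y.
Proof.
have [o1 t1] := loops_word_ok s; have [o2 t2] := tree_to_ok x.
have [o3 t3] := tree_from_ok y.
by rewrite !word_ok_cat !word_tgt_cat t2 t1 o1 o2 o3 t3.
Qed.

Section Loops.
Variables (k : fieldType) (J : ideal (path_algebra k Q0)).

(** A letter slides past the branches of the tree and leaves its generator behind, or nothing if it
    belongs to the tree. *)
Lemma letter_normal_form (l : arrow DQ) :
  hword J (v2 : vert DQ) (l :: tree_from (asrc l))
    (tree_from (atgt l) ++ loops_word (letter_fword l)).
Proof.
have canc (x : vert DQ) l' w : word_ok x w -> atgt l' = word_tgt x w ->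
    hword J x w (l' :: letter_inv l' :: w).
  by move=> ok t; apply: hword_sym; exact: hword_cancel.
case: l => -[]; try exact: hword_refl; rewrite /= ?cats0.
- exact: (canc _ (inl alpha2) [:: inl alpha1]).
- exact: (@hword_cancel _ _ J v2 (inl beta2) [::]).
- exact: (@hword_cancel _ _ J v2 (inr alpha2) [::]).
- exact: (canc _ (inr beta2) [:: inr beta1]).
Qed.

(** The classical argument for graphs: pushing the letters across the tree one at a time rewrites a
    walk as a product of loops at the root, between two branches. *)
Lemma walk_normal_form (x : vert DQ) w : word_ok x w ->
  hword J x w
    (tree_from (word_tgt x w) ++ loops_word (walk_fword w) ++ tree_to x).
Proof.
elim: w => [_|l w IHw /andP[/eqP lw okw]].
  case: x; try exact: hword_refl; rewrite /=; apply: hword_sym.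
    exact: (@hword_cancel _ _ J v1 (inl alpha2) [::]).
  exact: (@hword_cancel _ _ J v3 (inr beta2) [::]).
have [o t] := tree_to_ok x.
have [ol tl] := loops_word_ok (walk_fword w).
have okl : word_ok (word_tgt x w) [:: l] by apply/andP; split=> //; apply/eqP.
have h1 := @hword_ctx _ _ J x x [:: l] _ _ [::] okl isT erefl (IHw okw).
rewrite !cats0 in h1; apply: hword_trans h1 _.
have o2 : @word_ok DQ x (loops_word (walk_fword w) ++ tree_to x).
  by rewrite word_ok_cat t ol.
have := @hword_ctx _ _ J v2 x [::] _ _ _ isT o2 _ (letter_normal_form l).
rewrite word_tgt_cat t tl lw => /(_ erefl).
by rewrite /walk_fword /= loops_word_cat -!catA.
Qed.

(** The congruence on words in the two generators that presents the fundamental group at [v2]. *)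
Definition feqv s s' : Prop := hword J (v2 :
  vert DQ) (loops_word s) (loops_word s').

Lemma feqv_ctx s1 s s' s2 : feqv s s' -> feqv (s1 ++ s ++ s2) (s1 ++ s' ++ s2).
Proof.
move=> h; rewrite /feqv !loops_word_cat.
have [o1 t1] := loops_word_ok s1; have [o2 t2] := loops_word_ok s2.
have [o t] := loops_word_ok s.
apply: (@hword_ctx _ _ J v2 v2) => //; by rewrite t.
Qed.

Lemma feqv_refl s : feqv s s.
Proof. by apply: hword_refl; case: (loops_word_ok s). Qed.

Lemma feqv_cancel l s : feqv (l :: fletter_inv l :: s) s.
Proof.
have [o t] := loops_word_ok s.
(* A loop followed by its inverse has four letters; the intermediate word is what remains once the
   inner pair has cancelled. *)
rewrite /feqv; apply: (@hword_trans _ _ J v2 _ (match l with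
  | (false, false) => inr alpha2 :: inl alpha2 :: loops_word s
  | (false, true) => inr alpha1 :: inl alpha1 :: loops_word s
  | (true, false) => inl beta1 :: inr beta1 :: loops_word s
  | (true, true) => inl beta2 :: inr beta2 :: loops_word s end)); last first.
  by case: l => -[] []; apply: (@hword_cancel _ _ J v2); rewrite ?t.
case: l => -[] []; rewrite /loops_word /= -/(loops_word s).
- apply: (@hword_ctx _ _ J v2 v2 [:: inl beta2] [:: inr beta1; inl beta1;
    inr beta2]
   [:: inr beta2] (loops_word s)) => //.
  exact: (@hword_cancel _ _ J v2 (inr beta1) [:: inr beta2]).
- apply: (@hword_ctx _ _ J v2 v2 [:: inl beta1] [:: inr beta2; inl beta2;
    inr beta1]
   [:: inr beta1] (loops_word s)) => //.
  exact: (@hword_cancel _ _ J v2 (inr beta2) [:: inr beta1]).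
- apply: (@hword_ctx _ _ J v2 v2 [:: inr alpha1] [:: inl alpha2; inr alpha2;
    inl alpha1]
   [:: inl alpha1] (loops_word s)) => //.
  exact: (@hword_cancel _ _ J v2 (inl alpha2) [:: inl alpha1]).
apply: (@hword_ctx _ _ J v2 v2 [:: inr alpha2] [:: inl alpha1; inr alpha1;
  inl alpha2]
   [:: inl alpha2] (loops_word s)) => //.
exact: (@hword_cancel _ _ J v2 (inl alpha1) [:: inl alpha2]).
Qed.

Lemma free_feqv s s' : free_eqv s s' -> feqv s s'.
Proof.
elim=> {s s'}.
- exact: feqv_refl.
- by move=> s s' _; exact: hword_sym.
- by move=> s1 s2 s3 _ h1 _; exact: hword_trans.
move=> s1 l s2.
by have := feqv_ctx s1 [::] (feqv_cancel l s2); rewrite !cats0.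
Qed.

End Loops.

(** * Fundamental groups from valuations and normal forms *)

Section Valuations.
Variables (G : Type) (one : G) (op : Monoid.law one) (phi : bool * bool -> G).
Hypothesis phiV : forall l, op (phi l) (phi (fletter_inv l)) = one.

Definition fval (s : fword) : G := foldr (fun l g => op (phi l) g) one s.

Lemma fval_cat s1 s2 : fval (s1 ++ s2) = op (fval s1) (fval s2).
Proof.
elim: s1 => [|l s1 IHs] /=; first by rewrite Monoid.mul1m.
by rewrite IHs Monoid.mulmA.
Qed.

Definition wval (w : walk Q0) : G := fval (walk_fword (pword w)).

Lemma wval_comp v w : composable v w -> wval (path_comp v w) =
  op (wval v) (wval w).
Proof.
by move=> vw;
  rewrite /wval pword_path_comp // walk_fword_cat fval_cat.
Qed.

Variables (k : fieldType) (J : ideal (path_algebra k Q0)).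
Hypothesis phiJ : forall n (t : 'I_n -> k) u i j, minimal_relation J t u ->
  wval (walk_of (u i)) = wval (walk_of (u j)).

Lemma wval_homotopic v w : homotopic J v w -> wval v = wval w.
Proof.
have cancel2 l : fval [:: l; fletter_inv l] = one.
  by rewrite /= Monoid.mulm1 phiV.
elim=> {v w} //.
- by move=> u v w _ -> _ ->.
- move=> a; have c : composable (fwd a) (bwd a) by exact: eqxx.
  rewrite /wval pword_path_comp //.
  by case: a {c} => //; [exact: (cancel2 (false, false)) |
    exact: (cancel2 (true, false))].
- move=> a; have c : composable (bwd a) (fwd a) by exact: eqxx.
  rewrite /wval pword_path_comp //.
  by case: a {c} => //; [exact: (cancel2 (false, true)) |
    exact: (cancel2 (true, true))].
move=> w v v' u c1 c2 c3 c4 _ vv.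
have c5 : composable w (path_comp v u) by rewrite /composable ptgt_path_comp.
have c6 : composable w (path_comp v' u) by rewrite /composable ptgt_path_comp.
by rewrite !wval_comp // vv.
Qed.

Variable sigma : G -> fword.
Hypothesis sigma1 : feqv J [::] (sigma one).
Hypothesis sigmaM : forall l g, feqv J (l :: sigma g) (sigma (op (phi l) g)).
Hypothesis sigmaK : forall g, fval (sigma g) = g.

Lemma feqv_normal_form s : feqv J s (sigma (fval s)).
Proof.
elim: s => // l s IHs /=; apply: hword_trans (sigmaM l _).
by have := feqv_ctx [:: l] [::] IHs; rewrite !cats0.
Qed.

(** The valuation is a homotopy invariant because it agrees on the paths of a minimal relation. It
    is complete because the words [sigma g] are stable, up to homotopy, under left multiplication by
    a letter: every word is then homotopic to the normal form of its value. *)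
Lemma pi1_of_valuation (x : vert Q0) : exists f : pi1 J x -> G,
  bijective f /\ (forall c d, f (c * d)%g = op (f c) (f d)).
Proof.
apply: (pi1_valuation wval_comp) => [v w /andP[/eqP vs /eqP vt]
  /andP[/eqP ws /eqP wt]|g].
  split=> [|vw]; first exact: wval_homotopic.
  apply: hword_homotopic; rewrite vs ?ws //.
  have norm (u : walk Q0) : psrc u = x -> ptgt u = x -> hword J x (pword u)
      (tree_from x ++ loops_word (sigma (wval u)) ++ tree_to x).
    move=> us ut; have ok := valP u; rewrite -/(psrc u) us in ok.
    have := walk_normal_form J ok; rewrite -{2}us -/(ptgt u) ut => h.
    apply: hword_trans h _; have := feqv_normal_form (walk_fword (pword u)).
    have [o1 t1] := tree_from_ok x; have [o2 t2] := tree_to_ok x.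
    apply: (@hword_ctx _ _ J v2) => //.
    by have [_ ->] := loops_word_ok (walk_fword (pword u)).
  by apply: hword_trans (norm v vs vt) _; rewrite vw; apply/hword_sym/norm.
have [ok tgt] := tree_loops_ok x x (sigma g).
exists (@QPath DQ (x, _) ok); last by rewrite /wval walk_fword_tree.
by apply/andP; split; apply/eqP.
Qed.
End Valuations.

(** * Admissible ideals of kQ *)

Section PathCoefficients.
Variables (k : fieldType) (Q : quiver).
Implicit Types (f g : path_algebra k Q) (p q r : qpath Q).

(** [L] lists the factorizations of r into two paths. This computes coefficients of products without
    any reference to supports. *)
Lemma pcoefM r (L : seq (qpath Q * qpath Q)) f g : uniq L ->
  (forall p q, ((p, q) \in L) = composable p q && (path_comp p q == r)) ->
  pcoef r (f * g) = \sum_(s <- L) pcoef s.1 f * pcoef s.2 g.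
Proof.
move=> uL rL; elim/pa_ind: f => [|f1 f2 IH1 IH2|c p].
- by rewrite mul0r raddf0 big1 // => s _; rewrite raddf0 mul0r.
- rewrite mulrDl pcoefD IH1 IH2 -big_split.
  by apply: eq_bigr => s _; rewrite pcoefD mulrDl.
elim/pa_ind: g => [|g1 g2 IH1 IH2|d q].
- by rewrite mulr0 raddf0 big1 // => s _; rewrite raddf0 mulr0.
- rewrite mulrDr pcoefD IH1 IH2 -big_split.
  by apply: eq_bigr => s _; rewrite pcoefD mulrDr.
rewrite -scalerAl -scalerAr !pcoefZ.
under eq_bigr => s _ do rewrite !pcoefZ !pcoef_pelt.
have -> : pcoef r (pelt k p * pelt k q) = ((p, q) \in L)%:R.
  rewrite peltM rL; case: ifP => _ /=; first by rewrite pcoef_pelt.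
  by rewrite raddf0.
have [pqL|pqL] := boolP ((p, q) \in L).
  rewrite (bigD1_seq (p, q)) //= !eqxx big1 => [|[s s'] /=];
    first by rewrite !mulr1 addr0.
  by rewrite xpair_eqE negb_and => /orP[] /negbTE; rewrite eq_sym => ->;
    rewrite !(mulr0, mul0r).
rewrite big_seq big1 ?mulr0 // => s sL; case: eqP => [ps|];
  last by rewrite !(mulr0, mul0r).
case: eqP => [qs|]; last by rewrite !(mulr0, mul0r).
by rewrite ps qs -surjective_pairing sL in pqL.
Qed.

End PathCoefficients.

(** Index [true] stands for 1 and [false] for 2, so that pairs of Booleans index the four paths of
    length 2. *)
Definition al (b : bool) : arrow Q0 := if b then alpha1 else alpha2.
Definition be (b : bool) : arrow Q0 := if b then beta1 else beta2.

Lemma qp_ok (p : bool * bool) : @word_ok Q0 v3 [:: al p.1; be p.2].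
Proof. by case: p => -[] []. Qed.

Definition qp (p : bool * bool) : qpath Q0 := @QPath Q0 (v3, [:: al p.1;
  be p.2]) (qp_ok p).

Lemma qp_inj : injective qp.
Proof. by move=> [[] []] [[] []] /(congr1 (@pword Q0)). Qed.

Lemma qp_parallel p p' : parallel (qp p) (qp p').
Proof. by case: p => -[] []; case: p' => -[] []. Qed.

Variant Q0_path_spec : qpath Q0 -> Prop :=
| Q0_trivial x : Q0_path_spec (epath x)
| Q0_arrow a : Q0_path_spec (apath a)
| Q0_length2 p : Q0_path_spec (qp p).

Lemma Q0_pathP q : Q0_path_spec q.
Proof.
case: q => -[x [|a [|b [|c w]]]] ok.
- have -> : QPath ok = epath x by exact: qpath_eq.
  exact: Q0_trivial.
- have -> : QPath ok = apath a; last exact: Q0_arrow.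
  by apply: qpath_eq => //; have /andP[/eqP ax _] := ok; exact: esym ax.
- have [p [pa pb px]] : exists p, [/\ al p.1 = a, be p.2 = b & x = v3].
    move: ok; case: a; case: b; case: x => //= _.
    + by exists (true, true).
    + by exists (true, false).
    + by exists (false, true).
    + by exists (false, false).
  have -> : QPath ok = qp p; last exact: Q0_length2.
  by apply: qpath_eq => //; rewrite /pword /= pa pb.
by exfalso; move: ok; case: a => //; case: b => //; case: c.
Qed.

Lemma Q0_closed_path (q : qpath Q0) : psrc q = ptgt q -> q = epath (psrc q).
Proof. by case: (Q0_pathP q) => [x|a|p] //; [case: a | case: p => -[] []]. Qed.

Section Coefficients.
Variable k : fieldType.
Local Notation kQ := (path_algebra k Q0).
Implicit Types (f g h : kQ) (J : ideal kQ).

Definition epc (x : vertex3) f : k := pcoef (@epath Q0 x) f.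
Definition apc (a : arrow4) f : k := pcoef (@apath Q0 a) f.
Definition qpc (p : bool * bool) f : k := pcoef (qp p) f.

Lemma comp_word_cat (p q r : qpath Q0) :
  composable p q && (path_comp p q == r) =
  [&& psrc p == ptgt q, psrc q == psrc r & pword p ++ pword q == pword r].
Proof.
rewrite /composable; case c: (psrc p == ptgt q) => //=.
have pq : composable p q by exact: c.
apply/eqP/andP => [<-|[/eqP e1 /eqP e2]].
  by rewrite psrc_path_comp // pword_path_comp // !eqxx.
by apply: qpath_eq; rewrite ?psrc_path_comp ?pword_path_comp.
Qed.

Lemma epcM x f g : epc x (f * g) = epc x f * epc x g.
Proof.
rewrite /epc (@pcoefM _ _ _ [:: (@epath Q0 x,
  @epath Q0 x)]) ?big_seq1 // => p q.
rewrite inE xpair_eqE comp_word_cat.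
by case: (Q0_pathP p) => [y|[]|[[] []]]; case: (Q0_pathP q) => [z|[]|[[] []]]
  //;
  case: x; try (case: y); try (case: z).
Qed.

Lemma apcM a f g : apc a (f * g) =
  epc (@atgt Q0 a) f * apc a g + apc a f * epc (@asrc Q0 a) g.
Proof.
rewrite /apc (@pcoefM _ _ _ [:: (@epath Q0 (@atgt Q0 a), @apath Q0 a);
   (@apath Q0 a, @epath Q0 (@asrc Q0 a))]) ?big_cons ?big_nil ?addr0 // => [|p
     q].
  by case: a.
rewrite !inE !xpair_eqE comp_word_cat.
by case: (Q0_pathP p) => [y|[]|[[] []]]; case: (Q0_pathP q) => [z|[]|[[] []]]
  //;
  case: a => //; try (case: y); try (case: z).
Qed.

Lemma qpcM p f g : qpc p (f * g) =
  epc v1 f * qpc p g + apc (al p.1) f * apc (be p.2) g + qpc p f * epc v3 g.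
Proof.
rewrite /qpc (@pcoefM _ _ _ [:: (@epath Q0 v1, qp p);
   (@apath Q0 (al p.1), @apath Q0 (be p.2)); (qp p, @epath Q0 v3)])
   ?big_cons ?big_nil ?addr0 ?addrA // => [|q r].
  by case: p => -[] [].
rewrite !inE !xpair_eqE comp_word_cat.
by case: p => -[] []; case: (Q0_pathP q) => [y|[]|[[] []]];
  case: (Q0_pathP r) => [z|[]|[[] []]] //; try (case: y); try (case: z).
Qed.
End Coefficients.

Section Length2.
Variable k : fieldType.
Local Notation kQ := (path_algebra k Q0).
Implicit Types (f g h : kQ) (J : ideal kQ) (p : bool * bool).

Definition length2 f : Prop := (forall x, epc x f = 0) /\ (forall a, apc a f =
  0).

Lemma length2_ext f g : length2 f -> length2 g ->
  (forall p, qpc p f = qpc p g) -> f = g.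
Proof.
move=> [f0 f1] [g0 g1] fg; apply: pcoef_ext => q; case: (Q0_pathP q) => [x|a|p].
- by rewrite -![LHS]/(epc x f) f0 -[RHS]/(epc x g) g0.
- by rewrite -![LHS]/(apc a f) f1 -[RHS]/(apc a g) g1.
- exact: fg.
Qed.

Lemma epcD x f g : epc x (f + g) = epc x f + epc x g. Proof. exact: pcoefD. Qed.
Lemma apcD a f g : apc a (f + g) = apc a f + apc a g. Proof. exact: pcoefD. Qed.
Lemma qpcD p f g : qpc p (f + g) = qpc p f + qpc p g. Proof. exact: pcoefD. Qed.
Lemma epcZ x c f : epc x (c *: f) = c * epc x f. Proof. exact: pcoefZ. Qed.
Lemma apcZ a c f : apc a (c *: f) = c * apc a f. Proof. exact: pcoefZ. Qed.
Lemma qpcZ p c f : qpc p (c *: f) = c * qpc p f. Proof. exact: pcoefZ. Qed.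
Lemma epc0 x : epc x (0 : kQ) = 0. Proof. exact: raddf0. Qed.
Lemma apc0 a : apc a (0 : kQ) = 0. Proof. exact: raddf0. Qed.
Lemma qpc0 p : qpc p (0 : kQ) = 0. Proof. exact: raddf0. Qed.
Lemma epcN x f : epc x (- f) = - epc x f. Proof. exact: raddfN. Qed.
Lemma apcN a f : apc a (- f) = - apc a f. Proof. exact: raddfN. Qed.
Lemma qpcN p f : qpc p (- f) = - qpc p f. Proof. exact: raddfN. Qed.
Lemma epc_arr x a : epc x (arr_elt k a) = 0.
Proof. by rewrite /epc pcoef_pelt; case: eqP => // /(congr1 (@pword Q0)). Qed.
Lemma apc_arr b a : apc b (arr_elt k a) = (a == b)%:R.
Proof. by rewrite /apc pcoef_pelt; case: a; case: b. Qed.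
Lemma qpc_arr p a : qpc p (arr_elt k a) = 0.
Proof. by rewrite /qpc pcoef_pelt; case: eqP => // /(congr1 (@pword Q0)). Qed.

Definition coefE := (epcD, apcD, qpcD, epcZ, apcZ, qpcZ, epc0, apc0, qpc0, epcN,
  apcN, qpcN, epcM, apcM, qpcM, epc_arr, apc_arr, qpc_arr).

Lemma length2_0 : length2 0.
Proof. by split=> ?; rewrite coefE. Qed.

Lemma length2D f g : length2 f -> length2 g -> length2 (f + g).
Proof.
by move=> [f0 f1] [g0 g1]; split=> ?;
  rewrite coefE ?f0 ?f1 ?g0 ?g1 addr0.
Qed.

Lemma length2Z c f : length2 f -> length2 (c *: f).
Proof. by move=> [f0 f1]; split=> ?; rewrite coefE ?f0 ?f1 mulr0. Qed.

Lemma length2B f g : length2 f -> length2 g -> length2 (f - g).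
Proof.
by move=> lf lg; rewrite -scaleN1r; apply: length2D => //;
  exact: length2Z.
Qed.

Lemma length2_sum (I : Type) (r : seq I) (P : pred I) (F : I -> kQ) :
  (forall i, P i -> length2 (F i)) -> length2 (\sum_(i <- r | P i) F i).
Proof.
by move=> lF; elim/big_ind: _ => //; [exact: length2_0 | exact: length2D].
Qed.

Lemma length2_arrM a b : length2 (arr_elt k a * arr_elt k b).
Proof. by split=> ?; rewrite !coefE !(mul0r, mulr0, addr0). Qed.

(** Paths of length 2 run from [v3] to [v1] and cannot be prolonged, so h acts through its
    coefficient at [v1]. Together with [length2_Mr] this makes every subspace of their span a
    two-sided ideal. *)
Lemma length2_Ml h f : length2 f -> h * f = epc v1 h *: f.
Proof.
move=> [f0 f1]; apply: length2_ext; first by split=> ?;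
  rewrite coefE ?f0 ?f1 !(mulr0, addr0).
  exact: length2Z.
by move=> p; rewrite !coefE f0 f1 !(mulr0, addr0).
Qed.

Lemma length2_Mr h f : length2 f -> f * h = epc v3 h *: f.
Proof.
move=> [f0 f1]; apply: length2_ext; first by split=> ?;
  rewrite coefE ?f0 ?f1 !(mul0r, addr0).
  exact: length2Z.
by move=> p; rewrite !coefE f0 f1 !(mul0r, add0r) mulrC.
Qed.

Definition E p : kQ := pelt k (qp p).

Lemma EE p : E p = arr_elt k (al p.1) * arr_elt k (be p.2).
Proof.
by rewrite /E /arr_elt peltM; case: p => -[] []; congr (pelt k _);
  apply: qpath_eq;
  rewrite ?psrc_path_comp ?pword_path_comp.
Qed.

Lemma length2_E p : length2 (E p).
Proof. by rewrite EE; exact: length2_arrM. Qed.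

Lemma qpcE p p' : qpc p (E p') = (p' == p)%:R.
Proof. by rewrite /qpc /E pcoef_pelt (inj_eq qp_inj). Qed.

Definition lin2 (c : bool * bool -> k) : kQ := \sum_p c p *: E p.

Lemma length2_lin2 c : length2 (lin2 c).
Proof. by apply: length2_sum => p _; apply: length2Z; exact: length2_E. Qed.

Lemma qpc_lin2 c p : qpc p (lin2 c) = c p.
Proof.
rewrite /qpc pcoef_sum (bigD1 p) //= pcoefZ -/(qpc _ _) qpcE eqxx mulr1 big1
  ?addr0 //.
by move=> p' /negbTE p'p; rewrite pcoefZ -/(qpc _ _) qpcE p'p mulr0.
Qed.

Lemma lin2K f : length2 f -> lin2 (fun p => qpc p f) = f.
Proof.
by move=> lf; apply: length2_ext => // [|p]; [exact:
  length2_lin2 | rewrite qpc_lin2].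
Qed.

Lemma big_bool2 (V : nmodType) (F : bool * bool -> V) :
  \sum_p F p = F (true, true) + F (true, false) + F (false, true) + F (false,
    false).
Proof.
rewrite (eq_bigr (fun p => F (p.1, p.2))) => [|p _];
  last by rewrite -surjective_pairing.
by rewrite -(pair_bigA _ (fun i j => F (i, j))) /= !big_bool /= !addrA.
Qed.

Section Span.
Variables g1 g2 : kQ.
Hypotheses (lg1 : length2 g1) (lg2 : length2 g2).

Definition span2 h : Prop := exists x y, h = x *: g1 + y *: g2.

Lemma length2_span2 h : span2 h -> length2 h.
Proof. by move=> [x [y ->]]; apply: length2D; exact: length2Z. Qed.

Lemma span2Z c h : span2 h -> span2 (c *: h).
Proof.
by move=> [x [y ->]]; exists (c * x), (c * y);
  rewrite scalerDr !scalerA.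
Qed.

Lemma gens2P h : gens [:: g1; g2] h <-> span2 h.
Proof.
have s0 : span2 0 by exists 0, 0; rewrite !scale0r addr0.
have sB f f' : span2 f -> span2 f' -> span2 (f - f').
  move=> [x [y ->]] [x' [y' ->]]; exists (x - x'), (y - y').
  by rewrite !scalerBl opprD addrACA.
have sl f f' : span2 f' -> span2 (f * f').
  by move=> s; rewrite (length2_Ml _ (length2_span2 s)); exact: span2Z.
have sr f f' : span2 f' -> span2 (f' * f).
  by move=> s; rewrite (length2_Mr _ (length2_span2 s)); exact: span2Z.
split=> [gh|[x [y ->]]].
  apply: (gh (Ideal s0 sB sl sr)) => f; rewrite !inE => /orP[] /eqP -> /=.
    by exists 1, 0; rewrite scale1r scale0r addr0.
  by exists 0, 1; rewrite scale1r scale0r add0r.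
by apply: idealD_mem; apply: (@idealZ k kQ); apply: gen_incl;
  rewrite !inE eqxx ?orbT.
Qed.

End Span.

Lemma arrow_ideal_epc f x : arrow_ideal k Q0 f -> epc x f = 0.
Proof.
have i0 : epc x (0 : kQ) = 0 by rewrite coefE.
have iB f' g : epc x f' = 0 -> epc x g = 0 -> epc x (f' - g) = 0.
  by move=> h1 h2; rewrite !coefE h1 h2 subr0.
have il f' g : epc x g = 0 -> epc x (f' * g) = 0.
  by move=> h2; rewrite !coefE h2 mulr0.
have ir f' g : epc x g = 0 -> epc x (g * f') = 0.
  by move=> h2; rewrite !coefE h2 mul0r.
move=> Af; apply: (Af (@Ideal _ (fun f => epc x f =
  0) i0 iB il ir)) => g [a ->].
exact: epc_arr.
Qed.

Definition length2_ideal : ideal kQ.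
Proof.
apply: (@Ideal _ length2); [exact: length2_0 | exact: length2B | |] => f g lg.
  by rewrite length2_Ml //; exact: length2Z.
by rewrite length2_Mr //; exact: length2Z.
Defined.

Lemma arrow_ideal2 : ideal_sub (ideal_exp (arrow_ideal k Q0) 2) length2_ideal.
Proof.
apply: gen_sub => _ [f [g [Af Ag ->]]].
have {}Ag : arrow_ideal k Q0 g.
  by apply: (Ag (arrow_ideal k Q0)) => _ [g1 [g2 [Ag1 _ ->]]];
    exact: Defs.idealMr.
by split=> x; rewrite !coefE !(arrow_ideal_epc _ Af,
  arrow_ideal_epc _ Ag) !(mul0r, mulr0, addr0).
Qed.

Definition zero_ideal : ideal kQ.
Proof.
apply: (@Ideal kQ (fun f => f = 0)) => //.
- by move=> a b -> ->; rewrite subr0.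
- by move=> a b ->; rewrite mulr0.
- by move=> a b ->; rewrite mul0r.
Defined.

Lemma arrow_ideal3 : ideal_sub (ideal_exp (arrow_ideal k Q0) 3) zero_ideal.
Proof.
apply: gen_sub => _ [f [g [Af /arrow_ideal2 Ag ->]]].
by rewrite /= length2_Ml // (arrow_ideal_epc _ Af) scale0r.
Qed.

Lemma admissibleP J : admissible J <-> ideal_sub J length2_ideal.
Proof.
split=> [[N [_ _ J2]] f /J2|J2]; first exact: arrow_ideal2.
(* There is no path of length 3, so the third power of the arrow ideal vanishes. *)
exists 3%N; split=> // f.
  by move/arrow_ideal3 => ->; exact: ideal0.
move/J2 => /lin2K <-; apply: ideal_sum => p _; apply: (@idealZ k kQ);
  rewrite EE.
apply: gen_incl; exists (arr_elt k (al p.1)), (arr_elt k (be p.2)); split=> //.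
  by apply: gen_incl; exists (al p.1).
(* The first power of an ideal is by definition its product with the unit ideal, hence the extra
   factor 1. *)
rewrite -[arr_elt k (be _)]mulr1.
apply: gen_incl; exists (arr_elt k (be p.2)), 1; split=> //.
  by apply: gen_incl; exists (be p.2).
by apply: gen_incl; rewrite inE.
Qed.

Lemma gens2_admissible g1 g2 : length2 g1 -> length2 g2 -> admissible (gens [::
  g1; g2]).
Proof.
by move=> l1 l2; apply/admissibleP => f /(gens2P l1 l2); exact: length2_span2.
Qed.

End Length2.

(** * Linear substitutions of the arrows *)

Section Substitutions.
Variable k : fieldType.
Local Notation kQ := (path_algebra k Q0).
Local Notation a_ i := (arr_elt k (al i)).
Local Notation b_ j := (arr_elt k (be j)).
Implicit Types (I J : ideal kQ) (M N : bool -> bool -> k).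

Definition isomorphic_by (phi psi : {lrmorphism kQ -> kQ}) I J : Prop :=
  [/\ cancel phi psi, cancel psi phi & is_image phi I J].

Lemma isomorphic_by_quot phi psi I J : isomorphic_by phi psi I J ->
  quot_iso J I.
Proof.
move=> [phiK psiK IJ]; apply: (@quot_iso_of _ _ _ _ _ psi); first by exists phi.
move=> a; split=> [/IJ [b Ib ->]|Ia]; first by rewrite phiK.
by apply/IJ; exists (psi a); rewrite ?psiK.
Qed.

Lemma isomorphic_by_comp phi psi phi' psi' I J K :
  isomorphic_by phi psi I J -> isomorphic_by phi' psi' J K ->
  isomorphic_by (phi' \o phi) (psi \o psi') I K.
Proof.
move=> [phiK psiK IJ] [phiK' psiK' JK]; split.
- by move=> f /=; rewrite phiK' phiK.
- by move=> f /=; rewrite psiK psiK'.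
move=> c; split=> [/JK [b /IJ [a Ia ->] ->]|[a Ia ->]]; first by exists a.
by apply/JK; exists (phi a) => //; apply/IJ; exists a.
Qed.

Definition subst M N (a : arrow Q0) : kQ :=
  match a with
  | alpha1 => M true true *: a_ true + M true false *: a_ false
  | alpha2 => M false true *: a_ true + M false false *: a_ false
  | beta1 => N true true *: b_ true + N true false *: b_ false
  | beta2 => N false true *: b_ true + N false false *: b_ false
  end.

Definition inverse2 M M' : Prop :=
  forall i l, M i true * M' true l + M i false * M' false l = (i == l)%:R.

Lemma arr_tgt a : pelt k (epath (@atgt Q0 a)) * arr_elt k a = arr_elt k a.
Proof.
by rewrite /arr_elt -ptgt_apath peltM /composable eqxx path_comp_epath_l.
Qed.

Lemma arr_src a : arr_elt k a * pelt k (epath (@asrc Q0 a)) = arr_elt k a.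
Proof.
by rewrite /arr_elt -psrc_apath peltM /composable eqxx path_comp_epath_r.
Qed.

Lemma subst_map M N : exists phi : {lrmorphism kQ -> kQ},
  (forall x, phi (pelt k (epath x)) = pelt k (epath x)) /\
  (forall a, phi (arr_elt k a) = subst M N a).
Proof.
have at_ i : pelt k (@epath Q0 v1) * a_ i = a_ i by have := arr_tgt (al i);
  case: i.
have as_ i : a_ i * pelt k (@epath Q0 v2) = a_ i by have := arr_src (al i);
  case: i.
have bt_ i : pelt k (@epath Q0 v2) * b_ i = b_ i by have := arr_tgt (be i);
  case: i.
have bs_ i : b_ i * pelt k (@epath Q0 v3) = b_ i by have := arr_src (be i);
  case: i.
apply: path_algebra_map => -[]; rewrite /subst.
all: by rewrite ?(mulrDr, mulrDl) -?(scalerAl, scalerAr) ?(at_, as_, bt_, bs_).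
Qed.

Lemma subst_automorphism M M' N N' : inverse2 M M' -> inverse2 M' M ->
  inverse2 N N' -> inverse2 N' N ->
  exists phi psi : {lrmorphism kQ -> kQ},
  [/\ cancel phi psi, cancel psi phi,
      forall x, phi (pelt k (epath x)) = pelt k (epath x) &
      forall a, phi (arr_elt k a) = subst M N a].
Proof.
move=> MM MM' NN NN'.
have [phi [phie phia]] := subst_map M N.
have [psi [psie psia]] := subst_map M' N'.
have inv2 (X X' : bool -> bool -> k) (c : bool -> kQ) i : inverse2 X X' ->
    X i true *: (X' true true *: c true + X' true false *: c false) +
    X i false *: (X' false true *: c true + X' false false *: c false) = c i.
  move=> XX; rewrite !scalerDr !scalerA addrACA -!scalerDl !XX.
  by case: i; rewrite ?scale1r ?scale0r ?addr0 ?add0r.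
have K (chi chi' : {lrmorphism kQ -> kQ}) X X' Y Y' : inverse2 X X' ->
  inverse2 Y Y' ->
    (forall a, chi (arr_elt k a) = subst X Y a) ->
    (forall a, chi' (arr_elt k a) = subst X' Y' a) ->
    forall a, chi' (chi (arr_elt k a)) = arr_elt k a.
  move=> XX YY e e' a; rewrite e; case: a;
    rewrite /subst linearD !linearZ /= !e' /subst.
  - exact: (inv2 _ _ (fun i => a_ i) true).
  - exact: (inv2 _ _ (fun i => a_ i) false).
  - exact: (inv2 _ _ (fun i => b_ i) true).
  - exact: (inv2 _ _ (fun i => b_ i) false).
have can (chi chi' : {lrmorphism kQ -> kQ}) :
    (forall x, chi (pelt k (epath x)) = pelt k (epath x)) ->
    (forall x, chi' (pelt k (epath x)) = pelt k (epath x)) ->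
    (forall a, chi' (chi (arr_elt k a)) = arr_elt k a) -> cancel chi chi'.
  move=> e e' a f; rewrite -[LHS]/((chi' \o chi) f).
  rewrite -[RHS]/((idfun : {lrmorphism kQ -> kQ}) f).
  by apply: lrmorphism_path_ext => [x|b] /=; [rewrite e e' | exact: a].
exists phi, psi; split=> //.
  by apply: can => //; exact: (K _ _ M M' N N').
by apply: can => //; exact: (K _ _ M' M N' N).
Qed.

(** The scalars form two 2 by 2 matrices which express the images of the generators in the target
    generators and conversely; they certify the two inclusions. *)
Lemma image_gens2 (phi psi : {lrmorphism kQ -> kQ}) f1 f2 g1 g2
    x1 y1 x2 y2 z1 w1 z2 w2 :
  cancel phi psi -> cancel psi phi ->
  phi f1 = x1 *: g1 + y1 *: g2 -> phi f2 = x2 *: g1 + y2 *: g2 ->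
  g1 = z1 *: phi f1 + w1 *: phi f2 -> g2 = z2 *: phi f1 + w2 *: phi f2 ->
  isomorphic_by phi psi (gens [:: f1; f2]) (gens [:: g1; g2]).
Proof.
move=> phiK psiK e1 e2 e3 e4; split=> //; apply: image_gen; first by exists psi.
  have G x y : gens [:: g1; g2] (x *: g1 + y *: g2).
    by apply: idealD_mem; apply: (@idealZ k kQ); apply: gen_incl;
      rewrite !inE eqxx ?orbT.
  by move=> f; rewrite !inE => /orP[] /eqP -> /=; [rewrite e1|rewrite e2];
    exact: G.
have F x y : gens [:: f1; f2] (x *: f1 + y *: f2).
  by apply: idealD_mem; apply: (@idealZ k kQ); apply: gen_incl;
    rewrite !inE eqxx ?orbT.
move=> g; rewrite !inE => /orP[] /eqP ->.
  by exists (z1 *: f1 + w1 *: f2); [exact: F | rewrite /= linearD !linearZ].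
by exists (z2 *: f1 + w2 *: f2); [exact: F | rewrite /= linearD !linearZ].
Qed.

Definition unit2 (i j : bool) : k := (i == j)%:R.
(** The elementary matrix with entry tau in row [i0], off the diagonal. *)
Definition elem2 (i0 : bool) (tau : k) (i j : bool) : k :=
  if i == j then 1 else if i == i0 then tau else 0.

Lemma unit2_inv : inverse2 unit2 unit2.
Proof. by move=> [] []; rewrite /unit2 /=; ring. Qed.

Lemma elem2_inv i tau : inverse2 (elem2 i tau) (elem2 i (- tau)).
Proof. by case: i => -[] []; rewrite /elem2 /=; ring. Qed.

Lemma elem2_inv' i tau : inverse2 (elem2 i (- tau)) (elem2 i tau).
Proof. by case: i => -[] []; rewrite /elem2 /=; ring. Qed.

Lemma transvection_al i tau : tau != 0 -> exists phi psi : {lrmorphism kQ ->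
  kQ},
  [/\ cancel phi psi, cancel psi phi,
      is_transvection (al i) (@apath Q0 (al (~~ i))) tau phi &
      forall a, phi (arr_elt k a) = subst (elem2 i tau) unit2 a].
Proof.
move=> tau0; have [phi [psi [phiK psiK phie phia]]] :=
  subst_automorphism (elem2_inv i tau) (elem2_inv' i tau) unit2_inv unit2_inv.
exists phi, psi; split=> //; split.
- by split=> //; case: i {phia}; split=> // /(congr1 (@pword Q0)).
- by exists psi.
- exact: phie.
- rewrite -/(arr_elt k (al i)) phia; case: i {phia} => /=.
    by rewrite /elem2 /= scale1r.
  by rewrite /elem2 /= scale1r addrC.
move=> b bi; rewrite -/(arr_elt k b) phia; case: i b bi {phia} => -[] //= _;
  by rewrite /elem2 /unit2 /= !(scale1r, scale0r) ?(addr0, add0r).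
Qed.

Lemma transvection_be i tau : tau != 0 -> exists phi psi : {lrmorphism kQ ->
  kQ},
  [/\ cancel phi psi, cancel psi phi,
      is_transvection (be i) (@apath Q0 (be (~~ i))) tau phi &
      forall a, phi (arr_elt k a) = subst unit2 (elem2 i tau) a].
Proof.
move=> tau0; have [phi [psi [phiK psiK phie phia]]] :=
  subst_automorphism unit2_inv unit2_inv (elem2_inv i tau) (elem2_inv' i tau).
exists phi, psi; split=> //; split.
- by split=> //; case: i {phia}; split=> // /(congr1 (@pword Q0)).
- by exists psi.
- exact: phie.
- rewrite -/(arr_elt k (be i)) phia; case: i {phia} => /=.
    by rewrite /elem2 /= scale1r.
  by rewrite /elem2 /= scale1r addrC.
move=> b bi; rewrite -/(arr_elt k b) phia; case: i b bi {phia} => -[] //= _;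
  by rewrite /elem2 /unit2 /= !(scale1r, scale0r) ?(addr0, add0r).
Qed.

End Substitutions.

(** * The explicit automorphisms between the presentations *)

Section Images.
Variable k : fieldType.
Local Notation kQ := (path_algebra k Q0).
Local Notation a1 := (arr_elt k alpha1).
Local Notation a2 := (arr_elt k alpha2).
Local Notation b1 := (arr_elt k beta1).
Local Notation b2 := (arr_elt k beta2).

(* The image of I4 under the transvection alpha1 -> alpha1 + alpha2. *)
Definition I5 : ideal kQ :=
  gens [:: a1 * b1 + a2 * b1 + a2 * b2; a2 * b1 + a1 * b2 + a2 * b2].

Ltac by_coef := apply: length2_ext;
  [by split=> ?; rewrite !coefE; ring | by split=> ?; rewrite !coefE; ring |
   by move=> [[] []]; rewrite !coefE /=; field].

Lemma neqN1 : (-1 : k) != 0. Proof. by rewrite oppr_eq0 oner_eq0. Qed.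

Lemma I0_to_I1 : exists phi psi,
  is_transvection (alpha1 : arrow Q0) (@apath Q0 alpha2) (-1) phi /\
  isomorphic_by phi psi (I0 k) (I1 k).
Proof.
have [phi [psi [phiK psiK tphi phia]]] := transvection_al true neqN1.
exists phi, psi; split=> //.
apply: (@image_gens2 _ _ _ _ _ _ _ 1 0 0 1 1 0 0 1) => //;
  rewrite !rmorphM /= !phia /subst /elem2 /unit2 /=; by_coef.
Qed.

Lemma I0_to_I2 : exists phi psi,
  is_transvection (beta1 : arrow Q0) (@apath Q0 beta2) (-1) phi /\
  isomorphic_by phi psi (I0 k) (I2 k).
Proof.
have [phi [psi [phiK psiK tphi phia]]] := transvection_be true neqN1.
exists phi, psi; split=> //.
apply: (@image_gens2 _ _ _ _ _ _ _ 1 0 0 1 1 0 0 1) => //;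
  rewrite !rmorphM /= !phia /subst /elem2 /unit2 /=; by_coef.
Qed.

Lemma I1_to_I3 : exists phi psi,
  is_transvection (beta1 : arrow Q0) (@apath Q0 beta2) (-1) phi /\
  isomorphic_by phi psi (I1 k) (I3 k).
Proof.
have [phi [psi [phiK psiK tphi phia]]] := transvection_be true neqN1.
exists phi, psi; split=> //.
(* The product (alpha1 - alpha2)(beta1 - beta2) is the first generator of [I3] plus alpha2 beta2. *)
apply: (@image_gens2 _ _ _ _ _ _ _ 1 1 0 1 1 (-1) 0 1) => //;
  rewrite !rmorphM /= ?rmorphB /= !phia /subst /elem2 /unit2 /=; by_coef.
Qed.

Lemma I2_to_I3 : exists phi psi,
  is_transvection (alpha1 : arrow Q0) (@apath Q0 alpha2) (-1) phi /\
  isomorphic_by phi psi (I2 k) (I3 k).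
Proof.
have [phi [psi [phiK psiK tphi phia]]] := transvection_al true neqN1.
exists phi, psi; split=> //.
apply: (@image_gens2 _ _ _ _ _ _ _ 1 1 0 1 1 (-1) 0 1) => //;
  rewrite !rmorphM /= ?rmorphB /= !phia /subst /elem2 /unit2 /=; by_coef.
Qed.

Lemma I4_to_I5 : exists phi psi,
  is_transvection (alpha1 : arrow Q0) (@apath Q0 alpha2) 1 phi /\
  isomorphic_by phi psi (I4 k) I5.
Proof.
have [phi [psi [phiK psiK tphi phia]]] := transvection_al true (oner_neq0 k).
exists phi, psi; split=> //.
apply: (@image_gens2 _ _ _ _ _ _ _ 1 0 0 1 1 0 0 1) => //;
  rewrite !rmorphD !rmorphM /= !phia /subst /elem2 /unit2 /=; by_coef.
Qed.

Lemma I0_to_I4 : (2%:R : k) != 0 -> exists phi psi : {lrmorphism kQ -> kQ},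
  [/\ forall x, phi (pelt k (epath x)) = pelt k (epath x),
      phi a1 = 2%:R^-1 *: (a1 - a2) /\ phi a2 = 2%:R^-1 *: (a1 + a2),
      phi b1 = 2%:R^-1 *: (b1 - b2) /\ phi b2 = b1 + b2 &
      isomorphic_by phi psi (I0 k) (I4 k)].
Proof.
move=> two0; pose half : k := 2%:R^-1.
(* [M] and [N] are the matrices of phi on the alphas and on the betas, [M'] and [N'] their
   inverses. *)
pose M (i j : bool) := if i || j then (if j then half else - half) else half.
pose M' (i j : bool) : k :=
  if i && ~~ j then 1 else if ~~ i && j then -1 else 1.
pose N (i j : bool) : k := if i then (if j then half else - half) else 1.
pose N' (i j : bool) : k := if j then (if i then 1 else -1) else half.
have MM : inverse2 M M' by move=> [] []; rewrite /M /M' /half /=; field.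
have MM' : inverse2 M' M by move=> [] []; rewrite /M /M' /half /=; field.
have NN : inverse2 N N' by move=> [] []; rewrite /N /N' /half /=; field.
have NN' : inverse2 N' N by move=> [] []; rewrite /N /N' /half /=; field.
have [phi [psi [phiK psiK phie phia]]] := subst_automorphism MM MM' NN NN'.
exists phi, psi; split=> //.
- by rewrite !phia /subst /M /= !scalerDr scalerN scaleNr.
- by rewrite !phia /subst /N /= !scalerDr scalerN scaleNr !scale1r.
(* If g and h are the generators of [I4], then (alpha1 - alpha2)(beta1 - beta2) = g - h and (alpha1
   + alpha2)(beta1 + beta2) = g + h. Hence phi sends alpha1 beta1 to (g - h)/4 and alpha2 beta2 to
   (g + h)/2. *)
apply: (@image_gens2 _ _ _ _ _ _ _ (half ^+ 2) (- half ^+ 2) half half 2%:R 1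
  (- 2%:R) 1) => //;
  rewrite !rmorphM /= !phia /subst /M /N /half /=; by_coef.
Qed.
End Images.

(** * Homotopy relations of admissible ideals *)

Section Splitting.
Variable k : fieldType.
Local Notation kQ := (path_algebra k Q0).
Implicit Types (f g : kQ) (J : ideal kQ) (p : bool * bool).

Definition hom2 J p p' : Prop := homotopic J (walk_of (qp p)) (walk_of (qp p')).
Definition homA J a b : Prop :=
  homotopic J (walk_of (@apath Q0 a)) (walk_of (@apath Q0 b)).

Lemma hom2_al J i i' j : hom2 J (i, j) (i', j) <-> homA J (al i) (al i').
Proof.
pose e (b : bool) : arrow DQ := inl (al b).
have tj : @atgt Q0 (be j) = v2 by case: (j).
have sj : @asrc Q0 (be j) = v3 by case: (j).
have [si si'] : @asrc Q0 (al i) = v2 /\ @asrc Q0 (al i') = v2 by case: (i);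
  case: (i').
split=> h.
  apply: hword_homotopic; first by rewrite !psrc_walk_of !psrc_apath si si'.
  move/homotopic_hword: h => /(_ erefl) h.
  change (hword J (@asrc Q0 (al i)) [:: e i] [:: e i']); rewrite si.
  have ok2 : @word_ok DQ v2 [:: inr (be j)] by case: (j).
  have := @hword_ctx _ _ J v3 v2 [::] _ _ [:: inr (be j)] isT ok2 sj h.
  rewrite /= => h'.
  have c b : hword J (v2 : vert DQ) [:: e b; inl (be j); inr (be j)] [:: e b].
    have okb : @word_ok DQ (@word_tgt DQ v2 [:: inl (be j); inr (be j)]) [::
      e b].
      by rewrite /=; case: b; case: (j).
    apply: (@hword_ctx _ _ J v2 v2 [:: e b] [:: inl (be j); inr (be j)] [::]
      [::]) => //.
    exact: (@hword_cancel _ _ J v2 (inl (be j)) [::]).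
  exact: hword_trans (hword_sym (c i)) (hword_trans h' (c i')).
apply: hword_homotopic => //.
move/homotopic_hword: h;
  rewrite !psrc_walk_of !psrc_apath si si' => /(_ erefl) h.
have ok2 : @word_ok DQ v3 [:: inl (be j)] by case: (j).
exact: (@hword_ctx _ _ J v2 v3 [::] _ _ [:: inl (be j)] isT ok2 tj h).
Qed.

Lemma hom2_be J i j j' : hom2 J (i, j) (i, j') <-> homA J (be j) (be j').
Proof.
pose e (b : bool) : arrow DQ := inl (be b).
have ti : @atgt Q0 (al i) = v1 by case: (i).
have si : @asrc Q0 (al i) = v2 by case: (i).
have [sj sj'] : @asrc Q0 (be j) = v3 /\ @asrc Q0 (be j') = v3 by case: (j);
  case: (j').
split=> h.
  apply: hword_homotopic; first by rewrite !psrc_walk_of !psrc_apath sj sj'.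
  move/homotopic_hword: h => /(_ erefl) h.
  change (hword J (@asrc Q0 (be j)) [:: e j] [:: e j']); rewrite sj.
  have ok1 : @word_ok DQ v1 [:: inr (al i)] by case: (i).
  have := @hword_ctx _ _ J v3 v3 [:: inr (al i)] _ _ [::] _ isT erefl h.
  rewrite !cats0 /= => h'.
  have c b : hword J (v3 : vert DQ) [:: inr (al i); inl (al i); e b] [:: e b].
    apply: (@hword_cancel _ _ J v3 (inr (al i)) [:: e b]).
      by case: b.
    by rewrite /=; case: b; case: (i).
  apply: hword_trans (hword_sym (c j)) (hword_trans (h' _) (c j')).
  by case: (i).
apply: hword_homotopic => //.
move/homotopic_hword: h;
  rewrite !psrc_walk_of !psrc_apath sj sj' => /(_ erefl) h.
have ok1 : @word_ok DQ (@word_tgt DQ v3 [:: e j]) [:: inl (al i)].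
  by case: (i); case: (j).
have := @hword_ctx _ _ J v3 v3 [:: inl (al i)] _ _ [::] ok1 isT erefl h.
by rewrite !cats0.
Qed.

(** The coefficients of a minimal relation are nonzero and its paths distinct, so each of these
    paths occurs in an element of J and has length 2. *)
Lemma minimal_relation_qp J n (t : 'I_n -> k) (u : 'I_n -> qpath Q0) :
  admissible J -> minimal_relation J t u ->
  exists v : 'I_n -> bool * bool, forall i, u i = qp (v i).
Proof.
move=> /admissibleP J2 [t0 u_inj _ Ju _].
have [l0 l1] := J2 _ Ju.
have coef i : pcoef (u i) (\sum_j t j *: pelt k (u j)) = t i.
  rewrite pcoef_sum (bigD1 i) //= pcoefZ pcoef_pelt eqxx mulr1 big1 ?addr0 //
    => j ji.
  by rewrite pcoefZ pcoef_pelt (inj_eq u_inj) (negbTE ji) mulr0.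
have ex i : exists p, u i = qp p.
  have := coef i; have := t0 i; case: (Q0_pathP (u i)) => [x|a|p].
  - by rewrite -[pcoef _ _]/(epc x _) l0 => /eqP t0i /esym.
  - by rewrite -[pcoef _ _]/(apc a _) l1 => /eqP t0i /esym.
  - by exists p.
by exists (fun i => sval (cid (ex i))) => i; case: cid.
Qed.

Lemma homotopic_sub2 J J' : admissible J ->
  (forall p p', hom2 J p p' -> hom2 J' p p') ->
  forall v w, homotopic J v w -> homotopic J' v w.
Proof.
move=> aJ JJ'; apply: homotopic_sub => n t u i j m.
have [v uv] := minimal_relation_qp aJ m.
by rewrite !uv; apply: JJ'; rewrite /hom2 -!uv; exact: hom_rel m.
Qed.

Definition part (X : eqType) (kappa : bool * bool -> X) x f : kQ :=
  lin2 (fun p => if kappa p == x then qpc p f else 0).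

(** For a colouring [kappa] of the four paths, J is the direct sum of its intersections with the
    spans of the colours, at least when J is admissible. *)
Definition splits (X : eqType) (kappa : bool * bool -> X) J : Prop :=
  forall f x, J f -> J (part kappa x f).

Lemma part_sum (X : eqType) (kappa : bool * bool -> X) x f :
  part kappa x f = \sum_(p | kappa p == x) qpc p f *: E k p.
Proof.
rewrite [RHS]big_mkcond /part /lin2; apply: eq_bigr => p _.
by case: eqP; rewrite ?scale0r.
Qed.

(** A colour that is constant on homotopy classes defines unions of such classes, to which
    [ideal_homotopic_part] applies. *)
Lemma splits_of_hom2 (X : eqType) (kappa : bool * bool -> X) J : admissible J ->
  (forall p p', hom2 J p p' -> kappa p = kappa p') -> splits kappa J.
Proof.
move=> /admissibleP J2 hk f x Jf; rewrite part_sum.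
pose S := [set p | qpc p f != 0].
have C p p' : homotopic J (walk_of (qp p)) (walk_of (qp p')) ->
    (fun p => kappa p == x) p = (fun p => kappa p == x) p'.
  by move=> h /=; rewrite (hk _ _ h).
have := @ideal_homotopic_part _ _ J _ qp (fun p => qpc p f) qp_inj qp_parallel
  _ S C.
have sumS (P : pred (bool * bool)) : \sum_(p in S | P p) qpc p
  f *: pelt k (qp p) =
    \sum_(p | P p) qpc p f *: E k p.
  rewrite big_mkcond [RHS]big_mkcond; apply: eq_bigr => p _.
  by rewrite inE; case: (P p); rewrite ?andbF ?andbT //; case: eqP => [->|];
    rewrite ?scale0r.
rewrite sumS; apply; first by move=> p; rewrite inE.
have := sumS predT; under eq_bigl => p do rewrite andbT.
move=> ->; have <- : f = \sum_p qpc p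
  f *: E k p by rewrite {1}(esym (lin2K (J2 _ Jf))).
by [].
Qed.

(** The part of a minimal relation in one of its colours is a nonempty subsum lying in J, hence the
    whole relation. *)
Lemma splits_minimal_relation (X : eqType) (kappa : bool * bool -> X) J
    n (t : 'I_n -> k) (u : 'I_n -> qpath Q0) (v : 'I_n -> bool * bool) i j :
  splits kappa J -> minimal_relation J t u -> (forall i, u i = qp (v i)) ->
  kappa (v i) = kappa (v j).
Proof.
move=> sJ [t0 u_inj _ Ju minu] uv.
pose S := [set l | kappa (v l) == kappa (v i)].
have iS : i \in S by rewrite inE.
have JS : J (\sum_(l in S) t l *: pelt k (u l)).
  have -> : \sum_(l in S) t l *: pelt k (u l) =
      part kappa (kappa (v i)) (\sum_l t l *: pelt k (u l)); last exact: sJ.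
  have lsum (P : pred 'I_n) : length2 (\sum_(l | P l) t l *: pelt k (u l)).
    by apply: length2_sum => l _; apply: length2Z; rewrite uv; exact: length2_E.
  apply: length2_ext; [exact: lsum | exact: length2_lin2 | move=> p].
  rewrite qpc_lin2 /qpc !pcoef_sum big_mkcond /=.
  case: ifP => pi; [apply: eq_bigr | apply: big1] => l _; rewrite inE.
    case: ifP => // li; rewrite pcoefZ pcoef_pelt uv (inj_eq qp_inj).
    by case: eqP => [e|]; [rewrite -e li in pi | rewrite mulr0].
  case: ifP => // li; rewrite pcoefZ pcoef_pelt uv (inj_eq qp_inj).
  by case: eqP => [e|]; [rewrite -e li in pi | rewrite mulr0].
have [ST|ST] := eqVneq S setT.
  by have := in_setT j; rewrite -ST inE => /eqP ->.
case: (minu S) => //; first by apply/set0Pn; exists i.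
by rewrite properEneq ST subsetT.
Qed.

(** The criterion for proving homotopies. The part of f in the class of p0 lies in J, involves p0
    and has its support inside that of f; by hypothesis it involves p1, which is therefore in the
    same class. *)
Lemma hom2_class J f p0 p1 : admissible J -> J f -> qpc p0 f != 0 ->
  (forall g, J g -> (forall p, qpc p f = 0 -> qpc p g = 0) -> qpc p0 g != 0 ->
     qpc p1 g != 0) -> hom2 J p0 p1.
Proof.
move=> aJ Jf f0 Jg; apply: contrapT => no.
have sJ : splits (fun p => `[< hom2 J p0 p >]) J.
  apply: splits_of_hom2 => // p p' pp'.
  apply/asboolP/asboolP => [h|h]; first exact: hom_trans pp'.
  exact: hom_trans (hom_sym pp').
have h00 : `[< hom2 J p0 p0 >] by apply/asboolP; exact: hom_refl.
have := Jg _ (sJ f true Jf); rewrite !qpc_lin2 h00 f0.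
have -> : `[< hom2 J p0 p1 >] = false by apply/asboolP.
rewrite /= eqxx => H; suff /H/(_ isT): forall p : bool * bool, qpc p f = 0 ->
  qpc p (part (fun p => `[< hom2 J p0 p >]) true f) = 0 by [].
by move=> p p0f; rewrite qpc_lin2 p0f; case: ifP.
Qed.

Section ZmodValuation.
Variables (V : zmodType) (m n : V).

(** An abelian invariant with values m and n on the two generators. It is a homotopy invariant as
    soon as its values on the four paths are constant on the blocks of a splitting of J. *)
Definition zletter (l : bool * bool) : V :=
  match l with (false, s) => if s then - m else m
             | (true, s) => if s then - n else n end.

Lemma zletterV l : (+%R : V -> V -> V) (zletter l) (zletter (fletter_inv l)) =
  0.
Proof. by case: l => -[] []; rewrite /= ?addrN ?addNr. Qed.

Definition zval : walk Q0 -> V := wval (+%R : Monoid.law 0) zletter.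

Lemma zval_qp p : zval (walk_of (qp p)) =
  (if p.1 then m else 0) + (if p.2 then n else 0).
Proof. by case: p => -[] []; rewrite /zval /wval /= ?addr0 ?add0r. Qed.

Lemma zval_arrow a : zval (walk_of (@apath Q0 a)) =
  match a with alpha1 => m | beta1 => n | _ => 0 end.
Proof. by case: a; rewrite /zval /wval /= ?addr0. Qed.

Section Splits.
Variables (X : eqType) (kappa : bool * bool -> X) (J : ideal kQ).
Hypothesis (aJ : admissible J) (sJ : splits kappa J).
Hypothesis kappa_mn : forall p p', kappa p = kappa p' ->
  (if p.1 then m else 0) + (if p.2 then n else 0) =
  (if p'.1 then m else 0) + (if p'.2 then n else 0).

Lemma zval_minimal_relation l (t : 'I_l -> k) u i j : minimal_relation J t u ->
  zval (walk_of (u i)) = zval (walk_of (u j)).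
Proof.
move=> mr; have [v uv] := minimal_relation_qp aJ mr.
by rewrite !uv !zval_qp; apply: kappa_mn;
  exact: splits_minimal_relation sJ mr uv.
Qed.

Lemma zval_homotopic v w : homotopic J v w -> zval v = zval w.
Proof.
apply: wval_homotopic; first exact: zletterV.
exact: zval_minimal_relation.
Qed.

End Splits.

End ZmodValuation.

End Splitting.

(** * The flags of an admissible ideal and the splittings that detect them *)

Section Flags.
Variable k : fieldType.
Local Notation kQ := (path_algebra k Q0).
Implicit Types (f g : kQ) (J : ideal kQ) (p : bool * bool) (s : bool).

Definition homAlpha J : Prop := homA J alpha1 alpha2.
Definition homBeta J : Prop := homA J beta1 beta2.
Definition homDiag J s : Prop := hom2 J (true, s) (false, ~~ s).

(** When both indices differ, [p.1 == p.2] tells which diagonal contains p and p'. *)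
Definition flag_rel (A B : Prop) (D : bool -> Prop) p p' : Prop :=
  if p.1 == p'.1 then (if p.2 == p'.2 then True else B)
  else if p.2 == p'.2 then A else D (p.1 == p.2).

Lemma hom2P J p p' :
  hom2 J p p' <-> flag_rel (homAlpha J) (homBeta J) (homDiag J) p p'.
Proof.
have hs q q' : hom2 J q q' <-> hom2 J q' q by split; exact: hom_sym.
have hA j : hom2 J (true, j) (false, j) <-> homAlpha J by exact: hom2_al.
have hA' j : hom2 J (false, j) (true, j) <-> homAlpha J by rewrite hs.
have hB i : hom2 J (i, true) (i, false) <-> homBeta J by exact: hom2_be.
have hB' i : hom2 J (i, false) (i, true) <-> homBeta J by rewrite hs.
have hD s : hom2 J (false, ~~ s) (true, s) <-> homDiag J s by rewrite hs.
case: p p' => -[] [] [[] []]; rewrite /flag_rel /=.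
all: first [by split=> // _; exact: hom_refl | exact: hA | exact: hA' |
  exact: hB
  | exact: hB' | exact: (hD true) | exact: (hD false) | by []].
Qed.

Lemma homAlphaBeta_diag J s : homAlpha J -> homBeta J -> homDiag J s.
Proof.
move=> hA hB; apply: (@hom_trans _ _ _ _ (walk_of (qp (false, s)))).
  by apply/hom2P; rewrite /flag_rel eqxx.
by apply/hom2P; rewrite /flag_rel eqxx; case: s.
Qed.

Lemma homAlpha_diag_beta J s : homAlpha J -> homDiag J s -> homBeta J.
Proof.
move=> hA hD; have : hom2 J (false, s) (false, ~~ s).
  apply: hom_trans hD; apply: hom_sym.
  by apply/hom2P; rewrite /flag_rel eqxx.
by move/hom2P; rewrite /flag_rel eqxx; case: s {hD}.
Qed.

Lemma homBeta_diag_alpha J s : homBeta J -> homDiag J s -> homAlpha J.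
Proof.
move=> hB hD; have : hom2 J (true, ~~ s) (false, ~~ s).
  apply: hom_trans hD.
  by apply/hom2P; rewrite /flag_rel eqxx; case: s.
by move/hom2P; rewrite /flag_rel eqxx; case: s {hD}.
Qed.

Lemma homotopic_flags_sub J J' : admissible J -> (homAlpha J -> homAlpha J') ->
  (homBeta J -> homBeta J') -> (forall s, homDiag J s -> homDiag J' s) ->
  forall v w, homotopic J v w -> homotopic J' v w.
Proof.
move=> aJ hA hB hD; apply: homotopic_sub2 => // p p' /hom2P h; apply/hom2P.
move: h; rewrite /flag_rel; case: ifP => _; case: ifP => _ //; exact: hD.
Qed.

Lemma homotopic_flags_eq J J' : admissible J -> admissible J' ->
  (homAlpha J <-> homAlpha J') -> (homBeta J <-> homBeta J') ->
  (forall s, homDiag J s <-> homDiag J' s) -> homotopic J = homotopic J'.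
Proof.
move=> aJ aJ' [A A'] [B B'] D.
apply: funext => v; apply: funext => w; apply: propext; split.
  by apply: homotopic_flags_sub => // s; case: (D s).
by apply: homotopic_flags_sub => // s; case: (D s).
Qed.

Lemma homDiag_eq J J' s : homotopic J = homotopic J' -> homDiag J s ->
  homDiag J' s.
Proof. by rewrite /homDiag /hom2 => ->. Qed.

Definition row_split : ideal kQ -> Prop := splits (@fst bool bool).
Definition col_split : ideal kQ -> Prop := splits (@snd bool bool).

(** If J splits along rows, the signed number of letters alpha1 is a homotopy invariant with values
    in the integers, and it separates the pairs in question. Conversely, without these flags
    homotopic paths have the same first index. *)
Lemma row_splitP J : admissible J ->
  row_split J <-> ~ homAlpha J /\ (forall s, ~ homDiag J s).
Proof.
move=> aJ; split=> [sJ|[nA nD]].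
  have H : forall p p' : bool * bool, p.1 = p'.1 ->
    (if p.1 then 1 else 0) + (if p.2 then 0 else 0) =
    (if p'.1 then 1 else 0) + (if p'.2 then 0 else 0) :> int.
    by move=> [[] []] [[] []].
  split=> [|s] /(zval_homotopic aJ sJ H); first by rewrite !zval_arrow.
  by rewrite !zval_qp; case: s.
apply: splits_of_hom2 => // p p' /hom2P; rewrite /flag_rel.
by case: eqP => // _; case: ifP => // _ /nD.
Qed.

Lemma col_splitP J : admissible J ->
  col_split J <-> ~ homBeta J /\ (forall s, ~ homDiag J s).
Proof.
move=> aJ; split=> [sJ|[nB nD]].
  have H : forall p p' : bool * bool, p.2 = p'.2 ->
    (if p.1 then 0 else 0) + (if p.2 then 1 else 0) =
    (if p'.1 then 0 else 0) + (if p'.2 then 1 else 0) :> int.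
    by move=> [[] []] [[] []].
  split=> [|s] /(zval_homotopic aJ sJ H); first by rewrite !zval_arrow.
  by rewrite !zval_qp; case: s.
apply: splits_of_hom2 => // p p' /hom2P; rewrite /flag_rel.
by case: ifP => _; case: eqP => // _ /nD.
Qed.

Definition diag_split : ideal kQ -> Prop := splits (fun p => p.1 (+) p.2).

(** The number of letters alpha1 and beta1 modulo 2 is constant on each diagonal, hence a homotopy
    invariant. It separates alpha1 from alpha2 and beta1 from beta2. *)
Lemma diag_split_flags J : admissible J -> diag_split J -> ~ homAlpha J /\
  ~ homBeta J.
Proof.
move=> aJ sJ.
have H : forall p p' : bool * bool, p.1 (+) p.2 = p'.1 (+) p'.2 ->
  (if p.1 then 1 else 0) + (if p.2 then 1 else 0) =
  (if p'.1 then 1 else 0) + (if p'.2 then 1 else 0) :> 'Z_2.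
  by move=> [[] []] [[] []] //= _; apply/val_inj.
by split=> /(zval_homotopic aJ sJ H); rewrite !zval_arrow.
Qed.

(** * The explicit ideals in coordinates, and their flags *)

Section Examples.
Local Notation c11 := (qpc (true, true)).
Local Notation c12 := (qpc (true, false)).
Local Notation c21 := (qpc (false, true)).
Local Notation c22 := (qpc (false, false)).

(** Replaces a span by the linear equations [R] that cut it out; splittings and [hom2_class] are
    then checked on coefficients. *)
Lemma gens2_coords f1 f2 (R : kQ -> Prop) : length2 f1 -> length2 f2 ->
  (forall x y h, (forall p, qpc p h = x * qpc p f1 + y * qpc p f2) -> R h) ->
  (forall h, R h -> exists x y, forall p, qpc p h =
    x * qpc p f1 + y * qpc p f2) ->
  forall h, gens [:: f1; f2] h <-> length2 h /\ R h.
Proof.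
move=> l1 l2 R1 R2 h; split=> [/(gens2P l1 l2) s|[lh /R2 [x [y e]]]].
  split; first exact: length2_span2 s.
  by case: s => [x [y ->]]; apply: (R1 x y) => p; rewrite !coefE.
apply/(gens2P l1 l2); exists x, y; apply: length2_ext => //.
  by apply: length2D; exact: length2Z.
by move=> p; rewrite e !coefE.
Qed.

Ltac l2_coef := by split=> ?; rewrite !coefE; ring.
Lemma I0P h : I0 k h <-> length2 h /\ c12 h = 0 /\ c21 h = 0.
Proof.
apply: (gens2_coords (R := fun h => c12 h = 0 /\ c21 h = 0));
  [l2_coef | l2_coef | |].
  by move=> x y g e; rewrite !e !coefE /=; split; ring.
move=> g [e e']; exists (c11 g), (c22 g).
by move=> [[] []]; rewrite !coefE /= ?e ?e'; ring.
Qed.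

Lemma I1P h : I1 k h <-> length2 h /\ c12 h = 0 /\ c21 h = - c11 h.
Proof.
apply: (gens2_coords (R := fun h => c12 h = 0 /\ c21 h = - c11 h));
  [l2_coef | l2_coef | |].
  by move=> x y g e; rewrite !e !coefE /=; split; ring.
move=> g [e e']; exists (c11 g), (c22 g).
by move=> [[] []]; rewrite !coefE /= ?e ?e'; ring.
Qed.

Lemma I2P h : I2 k h <-> length2 h /\ c21 h = 0 /\ c12 h = - c11 h.
Proof.
apply: (gens2_coords (R := fun h => c21 h = 0 /\ c12 h = - c11 h));
  [l2_coef | l2_coef | |].
  by move=> x y g e; rewrite !e !coefE /=; split; ring.
move=> g [e e']; exists (c11 g), (c22 g).
by move=> [[] []]; rewrite !coefE /= ?e ?e'; ring.
Qed.

Lemma I3P h : I3 k h <-> length2 h /\ c21 h = - c11 h /\ c12 h = - c11 h.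
Proof.
apply: (gens2_coords (R := fun h => c21 h = - c11 h /\ c12 h = - c11 h));
  [l2_coef | l2_coef | |].
  by move=> x y g e; rewrite !e !coefE /=; split; ring.
move=> g [e e']; exists (c11 g), (c22 g).
by move=> [[] []]; rewrite !coefE /= ?e ?e'; ring.
Qed.

Lemma I4P h : I4 k h <-> length2 h /\ c22 h = c11 h /\ c21 h = c12 h.
Proof.
apply: (gens2_coords (R := fun h => c22 h = c11 h /\ c21 h = c12 h));
  [l2_coef | l2_coef | |].
  by move=> x y g e; rewrite !e !coefE /=; split; ring.
move=> g [e e']; exists (c11 g), (c12 g).
by move=> [[] []]; rewrite !coefE /= ?e ?e'; ring.
Qed.

Lemma I5P h : I5 k h <-> length2 h /\ c21 h = c11 h + c12 h /\ c22 h =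
  c11 h + c12 h.
Proof.
apply: (gens2_coords (R := fun h => c21 h = c11 h + c12 h /\ c22 h =
  c11 h + c12 h)); [l2_coef | l2_coef | |].
  by move=> x y g e; rewrite !e !coefE /=; split; ring.
move=> g [e e']; exists (c11 g), (c12 g).
by move=> [[] []]; rewrite !coefE /= ?e ?e'; ring.
Qed.

Lemma I0_admissible : admissible (I0 k). Proof.
by apply: gens2_admissible;
  l2_coef.
Qed.
Lemma I1_admissible : admissible (I1 k). Proof.
by apply: gens2_admissible;
  l2_coef.
Qed.
Lemma I2_admissible : admissible (I2 k). Proof.
by apply: gens2_admissible;
  l2_coef.
Qed.
Lemma I3_admissible : admissible (I3 k). Proof.
by apply: gens2_admissible;
  l2_coef.
Qed.
Lemma I4_admissible : admissible (I4 k). Proof.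
by apply: gens2_admissible;
  l2_coef.
Qed.
Lemma I5_admissible : admissible (I5 k). Proof.
by apply: gens2_admissible;
  l2_coef.
Qed.

Lemma I0_row_split : row_split (I0 k).
Proof.
move=> f x /I0P[lf [e e']]; apply/I0P; split; first exact: length2_lin2.
by rewrite !qpc_lin2 e e' /= !if_same.
Qed.

Lemma I0_col_split : col_split (I0 k).
Proof.
move=> f x /I0P[lf [e e']]; apply/I0P; split; first exact: length2_lin2.
by rewrite !qpc_lin2 e e' /= !if_same.
Qed.

Lemma I1_col_split : col_split (I1 k).
Proof.
move=> f x /I1P[lf [e e']]; apply/I1P; split; first exact: length2_lin2.
by rewrite !qpc_lin2 e e' /= !if_same; case: ifP; rewrite ?oppr0.
Qed.

Lemma I2_row_split : row_split (I2 k).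
Proof.
move=> f x /I2P[lf [e e']]; apply/I2P; split; first exact: length2_lin2.
by rewrite !qpc_lin2 e e' /= !if_same; case: ifP; rewrite ?oppr0.
Qed.

Lemma I4_diag_split : diag_split (I4 k).
Proof.
move=> f x /I4P[lf [e e']]; apply/I4P; split; first exact: length2_lin2.
by rewrite !qpc_lin2 e e' /=; case: x.
Qed.

Lemma I0_flags : [/\ ~ homAlpha (I0 k), ~ homBeta (I0 k) & forall s,
  ~ homDiag (I0 k) s].
Proof.
by have [nA nD] := (row_splitP I0_admissible).1 I0_row_split;
   have [nB _] := (col_splitP I0_admissible).1 I0_col_split.
Qed.

Lemma gens_first (f1 f2 : kQ) : gens [:: f1; f2] f1.
Proof. by apply: gen_incl; rewrite inE eqxx. Qed.

Lemma gens_second (f1 f2 : kQ) : gens [:: f1; f2] f2.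
Proof. by apply: gen_incl; rewrite !inE eqxx orbT. Qed.

Lemma I1_flags : [/\ homAlpha (I1 k), ~ homBeta (I1 k) & forall s,
  ~ homDiag (I1 k) s].
Proof.
have [nB nD] := (col_splitP I1_admissible).1 I1_col_split; split=> //.
apply/(hom2_al _ true false true).
apply: (hom2_class I1_admissible (@gens_first _ _)).
  by rewrite !coefE /= !(mul0r, mulr0, mulr1, addr0, add0r, subr0) oner_eq0.
by move=> g /I1P[_ [_ ->]] _; rewrite oppr_eq0.
Qed.

Lemma I2_flags : [/\ ~ homAlpha (I2 k), homBeta (I2 k) & forall s,
  ~ homDiag (I2 k) s].
Proof.
have [nA nD] := (row_splitP I2_admissible).1 I2_row_split; split=> //.
apply/(hom2_be _ true true false).
apply: (hom2_class I2_admissible (@gens_first _ _)).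
  by rewrite !coefE /= !(mul0r, mulr0, mulr1, addr0, add0r, subr0) oner_eq0.
by move=> g /I2P[_ [_ ->]] _; rewrite oppr_eq0.
Qed.

Lemma I3_flags : homAlpha (I3 k) /\ homBeta (I3 k).
Proof.
split; [apply/(hom2_al _ true false true) | apply/(hom2_be _ true true false)].
  apply: (hom2_class I3_admissible (@gens_first _ _)).
    by rewrite !coefE /= !(mul0r, mulr0, mulr1, addr0, add0r, subr0) oner_eq0.
  by move=> g /I3P[_ [-> _]] _; rewrite oppr_eq0.
apply: (hom2_class I3_admissible (@gens_first _ _)).
  by rewrite !coefE /= !(mul0r, mulr0, mulr1, addr0, add0r, subr0) oner_eq0.
by move=> g /I3P[_ [_ ->]] _; rewrite oppr_eq0.
Qed.

Lemma I5_flags : homAlpha (I5 k) /\ homBeta (I5 k).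
Proof.
(* The first generator does not involve alpha1 beta2. An element of [I5] supported inside it
   therefore has equal coefficients at alpha1 beta1 and alpha2 beta1, as [hom2_class] requires. *)
have e12 : c12 (arr_elt k alpha1 * arr_elt k beta1 + arr_elt k alpha2 * arr_elt
  k beta1
    + arr_elt k alpha2 * arr_elt k beta2) = 0.
  by rewrite !coefE /=; ring.
split; [apply/(hom2_al _ true false true) | apply/(hom2_be _ false true false)].
  apply: (hom2_class I5_admissible (@gens_first _ _)).
    by rewrite !coefE /= !(mul0r, mulr0, mulr1, addr0, add0r, subr0) oner_eq0.
  by move=> g /I5P[_ [-> _]] /(_ _ e12) ->; rewrite addr0.
apply: (hom2_class I5_admissible (@gens_first _ _)).
  by rewrite !coefE /= !(mul0r, mulr0, mulr1, addr0, add0r, subr0) oner_eq0.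
by move=> g /I5P[_ [-> ->]].
Qed.

Lemma I4_flags : [/\ ~ homAlpha (I4 k), ~ homBeta (I4 k) & forall s,
  homDiag (I4 k) s].
Proof.
have [nA nB] := diag_split_flags I4_admissible I4_diag_split; split=> // -[].
  apply: (hom2_class I4_admissible (@gens_first _ _)).
    by rewrite !coefE /= !(mul0r, mulr0, mulr1, addr0, add0r, subr0) oner_eq0.
  by move=> g /I4P[_ [-> _]].
apply: (hom2_class I4_admissible (@gens_second _ _)).
  by rewrite !coefE /= !(mul0r, mulr0, mulr1, addr0, add0r, subr0) oner_eq0.
by move=> g /I4P[_ [_ ->]].
Qed.

End Examples.
End Flags.

(** * Presentations and transvections *)

Section Presentations.
Variable k : fieldType.
Local Notation kQ := (path_algebra k Q0).
Implicit Types (f g : kQ) (J : ideal kQ) (p : bool * bool) (s : bool).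

(* In A = kQ / I, the products (alpha1, beta1) and (alpha2, beta2) vanish while
   alpha1 beta2 and alpha2 beta1 are linearly independent.  Transporting this
   through an isomorphism kQ / J ~ A shows that J is spanned by two tensors
   a (x) b and a' (x) b' of rank one with a, a' and b, b' independent. *)
Lemma presentation_tensors J : admissible_presentation (I0 k) J ->
  exists a b a' b' : bool -> k,
  [/\ J (lin2 (fun p => a p.1 * b p.2)), J (lin2 (fun p => a' p.1 * b' p.2)) &
      forall c d, J (lin2 (fun p => c * (a p.1 * b' p.2) + d * (a' p.1 * b
        p.2))) ->
      c = 0 /\ d = 0].
Proof.
move=> [/admissibleP J2 [F [Fsc [G FK GK]]]].
(* Elements of kQ whose classes modulo J correspond to the arrows of A. *)
pose lift (x : arrow4) : kQ := quot_repr (G (quot_pi (I0 k) (arr_elt k x))).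
have Flift x : F (quot_pi J (lift x)) = quot_pi (I0 k) (arr_elt k x).
  by rewrite /lift quot_reprK GK.
have FM f g : F (quot_pi J (f * g)) = F (quot_pi J f) * F (quot_pi J g).
  by rewrite quot_pi_mul rmorphM.
have FZ c f : F (quot_pi J (c *: f)) = c *: F (quot_pi J f).
  by rewrite quot_pi_scale Fsc.
have FD f g : F (quot_pi J (f + g)) = F (quot_pi J f) + F (quot_pi J g).
  by rewrite quot_piD raddfD.
have FJ f g : F (quot_pi J f) = quot_pi (I0 k) g -> J f <-> I0 k g.
  move=> e; rewrite -[f in J f]subr0 -[g in I0 k g]subr0.
  split=> [/quot_piP e'|/quot_piP e'].
    by apply/quot_piP; rewrite -e e' !quot_pi0 raddf0.
  by apply/quot_piP; apply: (can_inj FK); rewrite e e' !quot_pi0 raddf0.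
have FMa x y : F (quot_pi J (lift x * lift y)) =
    quot_pi (I0 k) (arr_elt k x * arr_elt k y).
  by rewrite FM !Flift quot_pi_mul.
(* Arrows have square zero, so the squares of their lifts lie in J and have no coefficient at
   trivial paths. These coefficients are multiplicative, so the lifts have none either, and a
   product of two lifts is a tensor of their arrow coefficients. *)
have sq x : J (lift x * lift x).
  apply/(FJ _ _ (FMa x x)).
  have -> : arr_elt k x * arr_elt k x = 0; last exact: ideal0.
  apply: length2_ext; [exact: length2_arrM | exact: length2_0 | move=> p].
  by case: p x => -[] [] []; rewrite !coefE /= !(mul0r, mulr0, addr0).
have e0 y x : epc y (lift x) = 0.
  have [/(_ y) + _] := J2 _ (sq x).
  by rewrite epcM => /eqP; rewrite mulf_eq0 orbb => /eqP.
have prodE x y : lift x * lift y =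
  lin2 (fun p => apc (al p.1) (lift x) * apc (be p.2) (lift y)).
  apply: length2_ext; [by split=> z; rewrite !coefE !e0 !(mul0r, mulr0,
    addr0) | exact: length2_lin2 |].
  by move=> p; rewrite qpc_lin2 !coefE !e0 !(mul0r, mulr0, addr0, add0r).
pose a x b := apc (al b) (lift x); pose c x b := apc (be b) (lift x).
exists (a alpha1), (c beta1), (a alpha2), (c beta2); split.
- rewrite -prodE; apply/(FJ _ _ (FMa _ _)); exact: gens_first.
- rewrite -prodE; apply/(FJ _ _ (FMa _ _)); exact: gens_second.
move=> x y.
have -> : lin2 (fun p => x * (a alpha1 p.1 * c beta2 p.2) + y * (a alpha2 p.1 *
  c beta1 p.2)) =
    x *: (lift alpha1 * lift beta2) + y *: (lift alpha2 * lift beta1).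
  rewrite !prodE; apply: length2_ext; first exact: length2_lin2.
    by apply: length2D; apply: length2Z; exact: length2_lin2.
  by move=> p; rewrite !coefE !qpc_lin2.
have e : F (quot_pi J (x *: (lift alpha1 * lift beta2) +
  y *: (lift alpha2 * lift beta1))) =
    quot_pi (I0 k) (x *: (arr_elt k alpha1 * arr_elt k beta2) +
                    y *: (arr_elt k alpha2 * arr_elt k beta1)).
  by rewrite FD !FZ !FMa quot_piD !quot_pi_scale.
move/(FJ _ _ e)/I0P => [_ []]; rewrite !coefE /=.
by rewrite !(mul0r, mulr0, mulr1, addr0, add0r).
Qed.

Lemma lin2_ext (c d : bool * bool -> k) : c =1 d -> lin2 c = lin2 d.
Proof. by move=> cd; apply: eq_bigr => p _; rewrite cd. Qed.

Lemma ideal_lin2 J (c : bool * bool -> k) : (forall p, J (c p *: E k p)) ->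
  J (lin2 c).
Proof. by move=> Jc; apply: ideal_sum => p _; exact: Jc. Qed.

Lemma idealZV J c f : c != 0 -> J (c *: f) -> J f.
Proof.
move=> c0 Jf; rewrite -[f]scale1r -(mulVf c0) -scalerA.
exact: (@idealZ k kQ).
Qed.

(* If the only pair of homotopic paths of length 2 is {q, q'}, where
   q = (true, s) and q' = (false, ~~ s), then J is the sum of the line spanned
   by a form supported on {q, q'} and of a coordinate subspace. *)
Lemma homDiag_only_ideal J s : admissible J ->
  ~ homAlpha J -> ~ homBeta J -> homDiag J s -> ~ homDiag J (~~ s) ->
  let q := (true, s) in let q' := (false, ~~ s) in
  (forall f, J f -> [/\ J (qpc q f *: E k q + qpc q' f *: E k q'),
     J (qpc (true, ~~ s) f *: E k (true, ~~ s)) & J (qpc (false, s)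
       f *: E k (false, s))]) /\
  exists x y, [/\ J (x *: E k q + y *: E k q'), ~ J (E k q), ~ J (E k q'),
    x != 0 & y != 0].
Proof.
move=> aJ nA nB hD nD q q'.
have cls p p' : hom2 J p p' -> p != p' -> p.1 != p'.1 /\ p.1 (+) p.2 = ~~ s /\
  p'.1 (+) p'.2 = ~~ s.
  move/hom2P; rewrite /flag_rel; case: p p' => -[] [] [[] []] //=; move: nD hD;
    case: (s) => //=.
have parts f : J f -> [/\ J (qpc q f *: E k q + qpc q' f *: E k q'),
   J (qpc (true, ~~ s) f *: E k (true, ~~ s)) & J (qpc (false, s)
     f *: E k (false, s))].
  pose kappa p : nat :=
    if p.1 (+) p.2 (+) s then 0%N else if p.1 then 1%N else 2%N.
  have sJ : splits kappa J.
    apply: splits_of_hom2 => // p p' h; have [->//|pp'] := eqVneq p p'.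
    by have [_ [e e']] := cls _ _ h pp'; rewrite /kappa e e'; case: (s).
  move=> Jf; split.
  - have := sJ f 0%N Jf; rewrite part_sum big_mkcond big_bool2 /kappa /q /q'.
    by case: (s); rewrite /= !(addr0, add0r).
  - have := sJ f 1%N Jf; rewrite part_sum big_mkcond big_bool2 /kappa.
    by case: (s); rewrite /= !(addr0, add0r).
  have := sJ f 2%N Jf; rewrite part_sum big_mkcond big_bool2 /kappa.
  by case: (s); rewrite /= !(addr0, add0r).
split=> //.
(* Otherwise J would be spanned by the paths that it contains and would split along rows, against
   the diagonal flag. *)
have [f [Jf nf]] : exists f, J f /\ ~ J (qpc q f *: E k q).
  apply: contrapT => no.
  have Jq f : J f -> J (qpc q f *: E k q).
    by move=> Jf; apply: contrapT => nf; apply: no; exists f.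
  have Jq' f : J f -> J (qpc q' f *: E k q').
    move=> Jf; have [Jqq _ _] := parts f Jf.
    by rewrite -[X in J X](addKr (qpc q f *: E k q)) addrC;
      apply: idealB => //; exact: Jq.
  have Jp f p : J f -> J (qpc p f *: E k p).
    move=> Jf; have [_ J1 J2] := parts f Jf; move: (Jq f Jf) (Jq' f Jf) J1 J2.
    by rewrite /q /q'; case: p => -[] []; case: (s).
  have sJ : row_split J.
    move=> f x Jf; rewrite part_sum; apply: ideal_sum => p _; exact: Jp.
  by have [_ /(_ s)] := (row_splitP aJ).1 sJ.
have [Jqq _ _] := parts f Jf.
exists (qpc q f), (qpc q' f).
have nq : ~ J (E k q) by move=> h; apply: nf; exact: (@idealZ k kQ).
have nq' : ~ J (qpc q' f *: E k q').
  move=> h; apply: nf; rewrite -[X in J X](addrK (qpc q' f *: E k q')).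
  exact: idealB.
split=> //.
- by move=> h; apply: nq'; exact: (@idealZ k kQ).
- by apply/eqP => e; apply: nf; rewrite e scale0r; exact: ideal0.
- by apply/eqP => e; apply: nq'; rewrite e scale0r; exact: ideal0.
Qed.

(** With a single diagonal flag, J is the sum of a line on the diagonal {q, q'} and of a coordinate
    subspace on the other diagonal {o, o'}. Such a J cannot contain a (x) b and a' (x) b' while
    keeping a (x) b' and a' (x) b independent modulo J. *)
Lemma presentation_homDiag J s : admissible_presentation (I0 k) J ->
  ~ homAlpha J -> ~ homBeta J -> homDiag J s -> homDiag J (~~ s).
Proof.
move=> pJ nA nB hD; apply: contrapT => nD; have [aJ _] := pJ.
have [parts [x [y [Jxy nq nq' x0 y0]]]] := homDiag_only_ideal aJ nA nB hD nD.
have [a [b [a' [b' [Jab Jab' indep]]]]] := presentation_tensors pJ.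
pose s' := ~~ s.
have [J1 J2 J3] := parts _ Jab; have [J1' J2' J3'] := parts _ Jab'.
rewrite !qpc_lin2 /= in J1 J2 J3 J1' J2' J3';
  rewrite -/s' in J1 J2 J3 J1' J2' J3' Jxy nq'.
pose q := (true, s); pose q' := (false, s'); pose o := (true, s'); pose o' :=
  (false, s).
rewrite -/q -/q' -/o -/o' in Jxy nq nq' J1 J2 J3 J1' J2' J3'.
have AC4 (A B C D : kQ) : A + B + C + D = A + D + (B + C).
  by rewrite -!addrA; congr (_ + _); rewrite [RHS]addrC addrA.
have lin4 (c : bool * bool -> k) : lin2 c = (c q *: E k q + c
  q' *: E k q') + (c o *: E k o + c o' *: E k o').
  rewrite /lin2 big_bool2 /q /q' /o /o' /s'; case: (s) => /=.
    by rewrite AC4.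
  by rewrite AC4 addrC.
have zero1 u v : J (u *: E k q + v *: E k q') -> (u == 0) = (v == 0).
  move=> Juv; apply/eqP/eqP => e; rewrite e scale0r ?add0r ?addr0 in Juv;
    apply/eqP.
    by apply: contrapT => /negP v0; apply: nq'; exact: idealZV Juv.
  by apply: contrapT => /negP u0; apply: nq; exact: idealZV Juv.
have off c f : ~ J f -> J (c *: f) -> c = 0.
  by move=> nf Jf; apply/eqP; apply: contrapT => /negP c0; apply: nf;
    exact: idealZV Jf.
have ind1 : ~ J (lin2 (fun p => a p.1 * b' p.2)).
  move=> h; have [] := indep 1 0; last by move/eqP; rewrite oner_eq0.
  by rewrite (lin2_ext (d := fun p => a p.1 * b' p.2)) // => p;
    rewrite mul1r mul0r addr0.
have ind2 : ~ J (lin2 (fun p => a' p.1 * b p.2)).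
  move=> h; have [] := indep 0 1; last by move=> _ /eqP; rewrite oner_eq0.
  by rewrite (lin2_ext (d := fun p => a' p.1 * b p.2)) // => p;
    rewrite mul1r mul0r add0r.
have J0 (c : bool * bool -> k) : (forall p, c p = 0) -> J (lin2 c).
  by move=> c0; apply: ideal_lin2 => p; rewrite c0 scale0r; exact: ideal0.
(* If o and o' both lie in J, the span of the four paths has dimension 1 modulo J, too small for two
   independent tensors. [P] and [R] are the values of a (x) b' and a' (x) b under the linear form
   with kernel J. *)
have [[Jo Jo']|no] := pselect (J (E k o) /\ J (E k o')).
  pose P := y * (a true * b' s) - x * (a false * b' s').
  pose R := y * (a' true * b s) - x * (a' false * b s').
  have key c d : c * P + d * R = 0 -> c = 0 /\ d = 0.
    move=> cd; apply: indep; rewrite lin4 /=; apply: idealD_mem; last first.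
      by apply: idealD_mem; apply: (@idealZ k kQ).
    set u := c * (a true * _) + _; set v := c * (a false * _) + _.
    have -> : u *: E k q + v *: E k q' = (u / x) *: (x *: E k q + y *: E k q').
      rewrite scalerDr !scalerA divfK //; congr (_ + _ *: _).
      have : y * u = x * v by apply/eqP; rewrite -subr_eq0 -cd /P /R /u /v;
        apply/eqP; ring.
      by move=> e; rewrite mulrAC [u * y]mulrC e mulrC mulKf.
    exact: (@idealZ k kQ).
  have [R0 P0] : R = 0 /\ - P = 0 by apply: key; ring.
  have [] := key 1 0; first by rewrite mul0r addr0 mul1r -[P]opprK P0 oppr0.
  by move/eqP; rewrite oner_eq0.
(* If o is not in J, a tensor lying in J has no coefficient at o, and its coefficients at q and q'
   vanish together. Having rank one, it is then concentrated at o'; the case of o' is symmetric. *)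
have side (u v w z : k) : u * w = 0 -> (u * z == 0) = (v * w == 0) ->
    ~ (u = 0 /\ v = 0) -> ~ (w = 0 /\ z = 0) -> [/\ u = 0, w = 0, v != 0 &
      z != 0].
  move=> /eqP; rewrite mulf_eq0 => /orP[] /eqP -> + n1 n2.
    have v0 : v != 0 by apply/eqP => v0; apply: n1.
    rewrite mul0r eqxx => /esym; rewrite mulf_eq0 (negbTE v0) => /eqP w0.
    by split=> //; apply/eqP => z0; apply: n2.
  have z0 : z != 0 by apply/eqP => z0; apply: n2.
  rewrite mulr0 eqxx mulf_eq0 (negbTE z0) orbF => /eqP u0.
  by split=> //; apply/eqP => v0; apply: n1.
have ball (c : bool -> k) : c s = 0 -> c s' = 0 -> forall i, c i = 0.
  by rewrite /s' => e e' i; move: e e'; case: i; case: (s).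
have na (c d : bool -> k) : ~ J (lin2 (fun p => c p.1 * d p.2)) ->
    [/\ ~ (c true = 0 /\ c false = 0), ~ (c false = 0 /\ c true = 0),
        ~ (d s = 0 /\ d s' = 0) & ~ (d s' = 0 /\ d s = 0)].
  move=> n; split=> -[e e']; apply: n; apply: J0 => p.
  - by case: p => -[] j /=; rewrite ?e ?e' mul0r.
  - by case: p => -[] j /=; rewrite ?e ?e' mul0r.
  - by rewrite (ball d) ?mulr0.
  - by rewrite (ball d) ?mulr0.
have [a1 a2 b1' b2'] := na _ _ ind1; have [a1' a2' b1 b2] := na _ _ ind2.
have [no1|no1] : ~ J (E k o) \/ ~ J (E k o').
  apply: contrapT => h; apply: no; split; apply: contrapT => h'; apply: h;
    by [left|right].
(* Both tensors of J are nonzero multiples of o', so o' is in J and a (x) b', also a multiple of o',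
   is in J as well. *)
- have [u0 w0 v0 z0] := side _ _ _ _ (off _ _ no1 J2) (zero1 _ _ J1) a1 b2.
  have [u0' w0' _ _] := side _ _ _ _ (off _ _ no1 J2') (zero1 _ _ J1') a1' b2'.
  apply: ind1; rewrite lin4 /= u0 w0' !(mul0r, mulr0, scale0r, add0r).
  apply: (@idealZ k kQ); apply: idealZV J3; exact: mulf_neq0.
have [u0 w0 v0 z0] := side _ _ _ _ (off _ _ no1 J3) (esym (zero1 _ _ J1)) a2 b1.
have [u0' w0' _ _] :=
  side _ _ _ _ (off _ _ no1 J3') (esym (zero1 _ _ J1')) a2' b1'.
apply: ind1; rewrite lin4 /= u0 w0' !(mul0r, mulr0, scale0r, add0r, addr0).
apply: (@idealZ k kQ); apply: idealZV J2; exact: mulf_neq0.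
Qed.

Lemma gamma_vertex_flags J : admissible_presentation (I0 k) J ->
  [\/ homotopic J = homotopic (I0 k), homotopic J = homotopic (I1 k),
      homotopic J = homotopic (I2 k) | homotopic J = homotopic (I3 k) \/
      homotopic J = homotopic (I4 k)].
Proof.
move=> pJ; have [aJ _] := pJ.
have [A|nA] := pselect (homAlpha J); have [B|nB] := pselect (homBeta J).
- apply: Or44; left; have [A3 B3] := I3_flags k.
  apply: homotopic_flags_eq; [exact: aJ | exact: I3_admissible | by [] | by []
    |].
  by move=> s; split=> _; exact: homAlphaBeta_diag.
- apply: Or42; have [A1 B1 D1] := I1_flags k.
  apply: homotopic_flags_eq; [exact: aJ | exact: I1_admissible | by [] | by []
    |].
  by move=> s; split=> D; [case: nB; exact: homAlpha_diag_beta A D | case: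
    (D1 s)].
- apply: Or43; have [A2 B2 D2] := I2_flags k.
  apply: homotopic_flags_eq; [exact: aJ | exact: I2_admissible | by [] | by []
    |].
  by move=> s; split=> D; [case: nA; exact: homBeta_diag_alpha B D | case:
    (D2 s)].
have [[s D]|nD] := pselect (exists s, homDiag J s).
  apply: Or44; right; have [A4 B4 D4] := I4_flags k.
  apply: homotopic_flags_eq; [exact: aJ | exact: I4_admissible | by [] | by []
    |].
  have D' := presentation_homDiag pJ nA nB D.
  by move=> s'; split=> // _; move: D D'; case: s; case: s'.
apply: Or41; have [A0 B0 D0] := I0_flags k.
apply: homotopic_flags_eq; [exact: aJ | exact: I0_admissible | by [] | by [] |].
by move=> s; split=> D; [case: nD; exists s | case: (D0 s)].
Qed.
End Presentations.

(** * Splittings under transvections and the arrows of Gamma *)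

Section Transvections.
Variable k : fieldType.
Local Notation kQ := (path_algebra k Q0).
Implicit Types (f g : kQ) (J K : ideal kQ) (p : bool * bool) (i j s : bool).

Lemma splits_image (X : eqType) (kappa : bool * bool -> X)
    (phi : {lrmorphism kQ -> kQ}) J J' :
  injective phi -> is_image phi J J' ->
  (forall f x, J f -> phi (part kappa x f) = part kappa x (phi f)) ->
  splits kappa J <-> splits kappa J'.
Proof.
move=> phi_inj JJ' comm; split=> [sJ _ x /JJ'[f Jf ->]|sJ' f x Jf].
  by apply/JJ'; exists (part kappa x f); [exact: sJ | rewrite comm].
have : J' (part kappa x (phi f)) by apply: sJ'; apply/JJ'; exists f.
by rewrite -comm // => /JJ' [g Jg /phi_inj ->].
Qed.

(* The projection onto a column (resp. a row) of the span of the paths of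
   length 2 is induced by an endomorphism of kQ which fixes the alphas (resp.
   the betas), hence commutes with the transvections of the alphas. *)
Lemma col_part_map x : exists chi : {lrmorphism kQ -> kQ},
  [/\ forall y, chi (pelt k (epath y)) = pelt k (epath y),
      forall i, chi (arr_elt k (al i)) = arr_elt k (al i),
      forall j, chi (arr_elt k (be j)) =
        if j == x then arr_elt k (be j) else 0 &
      forall f, length2 f -> chi f = part (@snd bool bool) x f].
Proof.
have [chi [chie chia]] :=
  subst_map (unit2 k) (fun i j => ((i == x) && (i == j))%:R : k).
have ca i : chi (arr_elt k (al i)) = arr_elt k (al i).
  by rewrite chia; case: i; rewrite /subst /unit2 /= !(scale1r,
    scale0r) ?(addr0, add0r).
have cb j : chi (arr_elt k (be j)) = if j == x then arr_elt k (be j) else 0.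
  rewrite chia; case: j; rewrite /subst /= ?andbT ?andbF;
  by case: eqP; rewrite /= !(scale1r, scale0r) ?(addr0, add0r).
exists chi; split=> // f lf;
  rewrite -{1}(lin2K lf) /lin2 part_sum [RHS]big_mkcond linear_sum.
apply: eq_bigr => p _; rewrite linearZ /= EE rmorphM /= ca cb.
by case: eqP => _; rewrite ?mulr0 ?scaler0.
Qed.

Lemma row_part_map x : exists chi : {lrmorphism kQ -> kQ},
  [/\ forall y, chi (pelt k (epath y)) = pelt k (epath y),
      forall j, chi (arr_elt k (be j)) = arr_elt k (be j),
      forall i, chi (arr_elt k (al i)) =
        if i == x then arr_elt k (al i) else 0 &
      forall f, length2 f -> chi f = part (@fst bool bool) x f].
Proof.
have [chi [chie chia]] := subst_map (fun i j => ((i == x) && (i == j))%:R :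
  k) (unit2 k).
have cb i : chi (arr_elt k (be i)) = arr_elt k (be i).
  by rewrite chia; case: i; rewrite /subst /unit2 /= !(scale1r,
    scale0r) ?(addr0, add0r).
have ca j : chi (arr_elt k (al j)) = if j == x then arr_elt k (al j) else 0.
  rewrite chia; case: j; rewrite /subst /= ?andbT ?andbF;
  by case: eqP; rewrite /= !(scale1r, scale0r) ?(addr0, add0r).
exists chi; split=> // f lf;
  rewrite -{1}(lin2K lf) /lin2 part_sum [RHS]big_mkcond linear_sum.
apply: eq_bigr => p _; rewrite linearZ /= EE rmorphM /= ca cb.
by case: eqP => _; rewrite ?mul0r ?scaler0.
Qed.

Lemma bypass_al i (u : qpath Q0) : bypass (al i) u -> u = @apath Q0 (al (~~ i)).
Proof.
move=> [na]; case: (Q0_pathP u) na => [x|a|p]; first by case: i; case: x.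
  by case: i a => -[] // na _ _; case: na.
by case: i; case: p => -[] [].
Qed.

Lemma bypass_be i (u : qpath Q0) : bypass (be i) u -> u = @apath Q0 (be (~~ i)).
Proof.
move=> [na]; case: (Q0_pathP u) na => [x|a|p]; first by case: i; case: x.
  by case: i a => -[] // na _ _; case: na.
by case: i; case: p => -[] [].
Qed.

Lemma transvection_col_split i u tau J J' : admissible J -> admissible J' ->
  transvection_image (al i : arrow Q0) u tau J J' ->
    col_split J <-> col_split J'.
Proof.
move=> /admissibleP J2 /admissibleP J2' [phi [[[byp _] bphi phie phia phib]
  JJ']].
apply: (splits_image (bij_inj bphi) JJ') => f x Jf.
have [chi [chie chia chib chiE]] := col_part_map x.
have l2 : length2 (phi f) by apply: J2'; apply/JJ'; exists f.
rewrite -chiE; last exact: J2.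
rewrite -chiE //;
  apply: (@lrmorphism_path_ext _ _ (phi \o chi) (chi \o phi)) => [y|a] /=.
  by rewrite chie !phie chie.
rewrite (bypass_al byp) in phia.
have phial j : phi (arr_elt k (al j)) =
    arr_elt k (al j) + (if j == i then tau else 0) *: arr_elt k (al (~~ i)).
  case: eqP => [->|/eqP ji]; first exact: phia.
  by rewrite scale0r addr0; apply: phib; move: ji; case: (i); case: (j).
have phibe j : phi (arr_elt k (be j)) = arr_elt k (be j).
  by apply: phib; case: (i); case: (j).
have cA j : phi (chi (arr_elt k (al j))) = chi (phi (arr_elt k (al j))).
  by rewrite chia !phial linearD linearZ /= !chia.
have cB j : phi (chi (arr_elt k (be j))) = chi (phi (arr_elt k (be j))).
  by rewrite phibe chib; case: ifP => _; [exact: phibe | rewrite linear0].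
by case: a; [exact: (cA true) | exact: (cA false) | exact: (cB true) |
  exact: (cB false)].
Qed.

Lemma transvection_row_split i u tau J J' : admissible J -> admissible J' ->
  transvection_image (be i : arrow Q0) u tau J J' ->
    row_split J <-> row_split J'.
Proof.
move=> /admissibleP J2 /admissibleP J2' [phi [[[byp _] bphi phie phia phib]
  JJ']].
apply: (splits_image (bij_inj bphi) JJ') => f x Jf.
have [chi [chie chib chia chiE]] := row_part_map x.
have l2 : length2 (phi f) by apply: J2'; apply/JJ'; exists f.
rewrite -chiE; last exact: J2.
rewrite -chiE //;
  apply: (@lrmorphism_path_ext _ _ (phi \o chi) (chi \o phi)) => [y|a] /=.
  by rewrite chie !phie chie.
rewrite (bypass_be byp) in phia.
have phibe j : phi (arr_elt k (be j)) =
    arr_elt k (be j) + (if j == i then tau else 0) *: arr_elt k (be (~~ i)).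
  case: eqP => [->|/eqP ji]; first exact: phia.
  by rewrite scale0r addr0; apply: phib; move: ji; case: (i); case: (j).
have phial j : phi (arr_elt k (al j)) = arr_elt k (al j).
  by apply: phib; case: (i); case: (j).
have cB j : phi (chi (arr_elt k (be j))) = chi (phi (arr_elt k (be j))).
  by rewrite chib !phibe linearD linearZ /= !chib.
have cA j : phi (chi (arr_elt k (al j))) = chi (phi (arr_elt k (al j))).
  by rewrite phial chia; case: ifP => _; [exact: phial | rewrite linear0].
by case: a; [exact: (cA true) | exact: (cA false) | exact: (cB true) |
  exact: (cB false)].
Qed.

(** By [col_splitP] and [row_splitP] these are the two splittings, expressed through the homotopy
    relation alone so that they pass between presentations with the same relation. *)
Definition col_flags J : Prop := ~ homBeta J /\ forall s, ~ homDiag J s.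
Definition row_flags J : Prop := ~ homAlpha J /\ forall s, ~ homDiag J s.

Lemma homAlpha_eq J K : homotopic J = homotopic K -> homAlpha J -> homAlpha K.
Proof. by rewrite /homAlpha /homA => ->. Qed.
Lemma homBeta_eq J K : homotopic J = homotopic K -> homBeta J -> homBeta K.
Proof. by rewrite /homBeta /homA => ->. Qed.
Lemma col_flags_eq J K : homotopic J = homotopic K -> col_flags J ->
  col_flags K.
Proof. by rewrite /col_flags /homBeta /homDiag /homA /hom2 => ->. Qed.
Lemma row_flags_eq J K : homotopic J = homotopic K -> row_flags J ->
  row_flags K.
Proof. by rewrite /row_flags /homAlpha /homDiag /homA /hom2 => ->. Qed.

(** A transvection of the alphas that creates the alpha flag starts at [I0], [I2] or [I4] and ends
    at [I1] or [I3]. Column splitting is shared by both ends; it holds for [I0] and [I1] only, which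
    leaves 0 to 1, 2 to 3 and 4 to 3. The betas are symmetric, with rows. *)
Lemma gamma_arrow_cases r r' : gamma_arrow (I0 k) r r' ->
  [\/ r = homotopic (I0 k) /\ (r' = homotopic (I1 k) \/ r' = homotopic (I2 k)),
      r = homotopic (I1 k) /\ r' = homotopic (I3 k),
      r = homotopic (I2 k) /\ r' = homotopic (I3 k) |
      r = homotopic (I4 k) /\ r' = homotopic (I3 k)].
Proof.
move=> [J [J' [a [u [tau [[pJ pJ'] [-> ->] tr nh h]]]]]].
have [[aJ _] [aJ' _]] := (pJ, pJ').
have [A0 B0 D0] := I0_flags k; have [A1 B1 D1] := I1_flags k.
have [A2 B2 D2] := I2_flags k; have [A3 B3] := I3_flags k.
have [A4 B4 D4] := I4_flags k.
have [[i ai]|[i ai]] : (exists i, a = al i) \/ (exists i, a = be i).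
- by case: (a); [left; exists true | left; exists false | right;
    exists true | right; exists false].
- rewrite {a}ai in tr nh h.
  have uE : u = apath (al (~~ i)).
    by case: tr => phi [[[byp _] _ _ _ _] _]; exact: bypass_al byp.
  have nA : ~ homAlpha J.
    by rewrite uE in nh => hA; apply: nh; case: (i); [exact: hA |
      exact: hom_sym].
  have A' : homAlpha J'.
    by rewrite uE in h; move: h; case: (i) => h; [exact: h | exact: hom_sym].
  have cs : col_flags J <-> col_flags J'.
    rewrite /col_flags -(col_splitP aJ) -(col_splitP aJ').
    exact: transvection_col_split tr.
  have [e'|e'] : homotopic J' = homotopic (I1 k) \/ homotopic J' =
    homotopic (I3 k).
    have [e'|e'|e'|[e'|e']] := gamma_vertex_flags pJ'.
    * by case: A0; exact: homAlpha_eq e' A'.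
    * by left.
    * by case: A2; exact: homAlpha_eq e' A'.
    * by right.
    * by case: A4; exact: homAlpha_eq e' A'.
  + have F0 : col_flags (I1 k) := conj B1 D1.
    have F : col_flags J by apply/cs; exact: col_flags_eq (esym e') F0.
    have [e|e|e|[e|e]] := gamma_vertex_flags pJ.
    * exact: Or41 (conj e (or_introl e')).
    * by case: nA; exact: homAlpha_eq (esym e) A1.
    * by case: (col_flags_eq e F) => /(_ B2).
    * by case: nA; exact: homAlpha_eq (esym e) A3.
    * by case: (col_flags_eq e F) => _ /(_ true (D4 true)).
  have F : ~ col_flags J.
    by move/cs => /(col_flags_eq e')[/(_ B3)].
  have [e|e|e|[e|e]] := gamma_vertex_flags pJ.
  + by case: F; exact: col_flags_eq (esym e) (conj B0 D0).
  + by case: nA; exact: homAlpha_eq (esym e) A1.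
  + exact: Or43 (conj e e').
  + by case: nA; exact: homAlpha_eq (esym e) A3.
  + exact: Or44 (conj e e').
rewrite {a}ai in tr nh h.
have uE : u = apath (be (~~ i)).
  by case: tr => phi [[[byp _] _ _ _ _] _]; exact: bypass_be byp.
have nB : ~ homBeta J.
  by rewrite uE in nh => hB; apply: nh; case: (i); [exact: hB | exact: hom_sym].
have B' : homBeta J'.
  by rewrite uE in h; move: h; case: (i) => h; [exact: h | exact: hom_sym].
have cs : row_flags J <-> row_flags J'.
  rewrite /row_flags -(row_splitP aJ) -(row_splitP aJ').
  exact: transvection_row_split tr.
have [e'|e'] : homotopic J' = homotopic (I2 k) \/ homotopic J' =
  homotopic (I3 k).
  have [e'|e'|e'|[e'|e']] := gamma_vertex_flags pJ'.
  - by case: B0; exact: homBeta_eq e' B'.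
  - by case: B1; exact: homBeta_eq e' B'.
  - by left.
  - by right.
  - by case: B4; exact: homBeta_eq e' B'.
- have F0 : row_flags (I2 k) := conj A2 D2.
  have F : row_flags J by apply/cs; exact: row_flags_eq (esym e') F0.
  have [e|e|e|[e|e]] := gamma_vertex_flags pJ.
  + exact: Or41 (conj e (or_intror e')).
  + by case: (row_flags_eq e F) => /(_ A1).
  + by case: nB; exact: homBeta_eq (esym e) B2.
  + by case: nB; exact: homBeta_eq (esym e) B3.
  + by case: (row_flags_eq e F) => _ /(_ true (D4 true)).
have F : ~ row_flags J.
  by move/cs => /(row_flags_eq e')[/(_ A3)].
have [e|e|e|[e|e]] := gamma_vertex_flags pJ.
- by case: F; exact: row_flags_eq (esym e) (conj A0 D0).
- exact: Or42 (conj e e').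
- by case: nB; exact: homBeta_eq (esym e) B2.
- by case: nB; exact: homBeta_eq (esym e) B3.
- exact: Or44 (conj e e').
Qed.

Lemma isomorphic_by_id J : isomorphic_by (idfun : {lrmorphism kQ ->
  kQ}) idfun J J.
Proof. by split=> // b; split=> [Jb|[a Ja ->]] //; exists b. Qed.

Section Presented.
Hypothesis two0 : (2%:R : k) != 0.

Lemma I0_presentation : admissible_presentation (I0 k) (I0 k).
Proof.
by split; [exact: I0_admissible |
  exact: isomorphic_by_quot (isomorphic_by_id _)].
Qed.

Lemma I1_presentation : admissible_presentation (I0 k) (I1 k).
Proof.
split; first exact: I1_admissible.
by have [phi [psi [_ h]]] := I0_to_I1 k; exact: isomorphic_by_quot h.
Qed.

Lemma I2_presentation : admissible_presentation (I0 k) (I2 k).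
Proof.
split; first exact: I2_admissible.
by have [phi [psi [_ h]]] := I0_to_I2 k; exact: isomorphic_by_quot h.
Qed.

Lemma I3_presentation : admissible_presentation (I0 k) (I3 k).
Proof.
split; first exact: I3_admissible.
have [phi [psi [_ h]]] := I0_to_I1 k; have [phi' [psi' [_ h']]] := I1_to_I3 k.
exact: isomorphic_by_quot (isomorphic_by_comp h h').
Qed.

Lemma I4_presentation : admissible_presentation (I0 k) (I4 k).
Proof.
split; first exact: I4_admissible.
by have [phi [psi [_ _ _ h]]] := I0_to_I4 two0; exact: isomorphic_by_quot h.
Qed.

Lemma I5_presentation : admissible_presentation (I0 k) (I5 k).
Proof.
split; first exact: I5_admissible.
have [phi [psi [_ _ _ h]]] := I0_to_I4 two0; have [phi' [psi' [_ h']]] :=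
  I4_to_I5 k.
exact: isomorphic_by_quot (isomorphic_by_comp h h').
Qed.

Lemma homotopic_I5 : homotopic (I5 k) = homotopic (I3 k).
Proof.
have [A3 B3] := I3_flags k; have [A5 B5] := I5_flags k.
apply: homotopic_flags_eq; [exact: I5_admissible | exact: I3_admissible | by []
  | by [] |].
by move=> s; split=> _; exact: homAlphaBeta_diag.
Qed.

End Presented.
End Transvections.

(** * Fundamental groups *)

Section FundamentalGroups.
Variable k : fieldType.
Local Notation kQ := (path_algebra k Q0).
Implicit Types (J : ideal kQ) (p : bool * bool).

Lemma homA_hword J a b : homA J a b ->
  hword J (@asrc Q0 a : vert DQ) [:: inl a] [:: inl b].
Proof.
move=> h; have /andP[/eqP s _] := homotopic_parallel h.
by move/homotopic_hword: h => /(_ s).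
Qed.

Lemma feqv_alpha J s : homAlpha J -> feqv J [:: (false, s)] [::].
Proof.
move=> /homA_hword h; case: s; last first.
  apply: (@hword_trans _ _ J v2 _ [:: inr alpha2; inl alpha2]).
    exact: (@hword_ctx _ _ J v2 v2 [:: inr alpha2] [:: inl alpha1] [::
      inl alpha2] [::] isT isT erefl h).
  exact: (@hword_cancel _ _ J v2 (inr alpha2) [::]).
apply: (@hword_trans _ _ J v2 _ [:: inr alpha1; inl alpha1]).
  exact: (@hword_ctx _ _ J v2 v2 [:: inr alpha1] [:: inl alpha2] [::
    inl alpha1] [::] isT isT erefl (hword_sym h)).
exact: (@hword_cancel _ _ J v2 (inr alpha1) [::]).
Qed.

Lemma feqv_beta J s : homBeta J -> feqv J [:: (true, s)] [::].
Proof.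
move=> /homA_hword h; case: s; last first.
  apply: (@hword_trans _ _ J v2 _ [:: inl beta2; inr beta2]).
    exact: (@hword_ctx _ _ J v3 v2 [::] [:: inl beta1] [:: inl beta2] [::
      inr beta2] isT isT erefl h).
  exact: (@hword_cancel _ _ J v2 (inl beta2) [::]).
apply: (@hword_trans _ _ J v2 _ [:: inl beta1; inr beta1]).
  exact: (@hword_ctx _ _ J v3 v2 [::] [:: inl beta2] [:: inl beta1] [::
    inr beta1] isT isT erefl (hword_sym h)).
exact: (@hword_cancel _ _ J v2 (inl beta1) [::]).
Qed.

Lemma feqv_trans J w1 w2 w3 : feqv J w1 w2 -> feqv J w2 w3 -> feqv J w1 w3.
Proof. exact: hword_trans. Qed.

Lemma feqv_sym J s1 s2 : feqv J s1 s2 -> feqv J s2 s1.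
Proof. exact: hword_sym. Qed.

Lemma feqv_cat J s1 s1' s2 s2' : feqv J s1 s1' -> feqv J s2 s2' ->
  feqv J (s1 ++ s2) (s1' ++ s2').
Proof.
move=> h1 h2; apply: (@feqv_trans _ _ (s1' ++ s2)).
  exact: (feqv_ctx [::] s2 h1).
by have := feqv_ctx s1' [::] h2; rewrite !cats0.
Qed.

(** Multiplying alpha1 beta1 ~ alpha2 beta2 by the inverse of alpha2 on the left and that of beta1
    on the right gives the inverse of the beta generator; the other diagonal gives the generator
    itself. This is why s is also the inversion bit. *)
Lemma feqv_diag J s : homDiag J s -> feqv J [:: (false, false)] [:: (true, s)].
Proof.
move=> h0; move/homotopic_hword: h0 => /(_ erefl); case: s => h.
  have h1 : hword J (v2 : vert DQ) [:: inr alpha2; inl alpha1; inl beta1;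
    inr beta1]
      [:: inr alpha2; inl alpha1].
    apply: (@hword_ctx _ _ J v2 v2 [:: inr alpha2; inl alpha1] [:: inl beta1;
      inr beta1] [::] [::]) => //.
    exact: (@hword_cancel _ _ J v2 (inl beta1) [::]).
  have h2 : hword J (v2 : vert DQ) [:: inr alpha2; inl alpha2; inl beta2;
    inr beta1]
      [:: inl beta2; inr beta1].
    exact: (@hword_cancel _ _ J v2 (inr alpha2) [:: inl beta2; inr beta1]).
  apply: (hword_trans (hword_sym h1)); apply: hword_trans _ h2.
  exact: (@hword_ctx _ _ J v3 v2 [:: inr alpha2] [:: inl alpha1; inl beta1] [::
    inl alpha2; inl beta2] [:: inr beta1] isT isT erefl h).
have h1 : hword J (v2 : vert DQ) [:: inr alpha2; inl alpha1; inl beta2;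
  inr beta2]
    [:: inr alpha2; inl alpha1].
  apply: (@hword_ctx _ _ J v2 v2 [:: inr alpha2; inl alpha1] [:: inl beta2;
    inr beta2] [::] [::]) => //.
  exact: (@hword_cancel _ _ J v2 (inl beta2) [::]).
have h2 : hword J (v2 : vert DQ) [:: inr alpha2; inl alpha2; inl beta1;
  inr beta2]
    [:: inl beta1; inr beta2].
  exact: (@hword_cancel _ _ J v2 (inr alpha2) [:: inl beta1; inr beta2]).
apply: (hword_trans (hword_sym h1)); apply: hword_trans _ h2.
exact: (@hword_ctx _ _ J v3 v2 [:: inr alpha2] [:: inl alpha1; inl beta2] [::
  inl alpha2; inl beta1] [:: inr beta2] isT isT erefl h).
Qed.

Lemma feqv_cancelr J l : feqv J [:: l; fletter_inv l] [::].
Proof. exact: feqv_cancel. Qed.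

Lemma feqv_inv J l l' : feqv J [:: l] [:: l'] ->
  feqv J [:: fletter_inv l] [:: fletter_inv l'].
Proof.
move=> h.
have h1 : feqv J [:: fletter_inv l; l; fletter_inv l'] [:: fletter_inv l'].
  by have := feqv_cancel J (fletter_inv l) [:: fletter_inv l'];
    rewrite fletter_invK.
apply: feqv_trans h1; apply: feqv_sym.
have h2 := feqv_ctx [:: fletter_inv l] [:: fletter_inv l'] h.
apply: (feqv_trans h2).
by have := feqv_cat (feqv_refl J [:: fletter_inv l]) (feqv_cancelr J l');
  rewrite cats0.
Qed.

Lemma pi1_I0 (x : vert Q0) : group_iso (pi1 (I0 k) x) (free_group bool).
Proof.
pose P := free_pregroup bool; pose G : groupType := free_group bool.
pose phi l : G := @grp_pi P [:: l].
have phiV l : (phi l * phi (fletter_inv l) = 1)%g.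
  rewrite /phi -grp_pi_mul; apply/(@grp_piP P).
  exact: (free_cancel [::] l [::]).
(* Any choice of representatives serves as normal form, since [feqv] contains the free congruence;
   reduced words are avoided. *)
pose sigma (g : G) : seq (bool * bool) := @grp_repr P g.
have fvalE s : fval ( *%g : Monoid.law (1%g : G)) phi s = @grp_pi P s.
  by elim: s => //= l s ->; rewrite /phi -grp_pi_mul.
have phiJ n (t : 'I_n -> k) u i j : minimal_relation (I0 k) t u ->
    wval ( *%g : Monoid.law (1%g : G)) phi (walk_of (u i)) =
    wval ( *%g : Monoid.law (1%g : G)) phi (walk_of (u j)).
  move=> mr; have [v uv] := minimal_relation_qp (I0_admissible k) mr.
  (* [I0] is spanned by paths, so its minimal relations involve a single path and identify
     nothing. *)
  have sI : splits (fun p => p) (I0 k).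
    move=> f y /I0P[lf [e e']]; apply/I0P; split; first exact: length2_lin2.
    by rewrite !qpc_lin2 e e' !if_same.
  by rewrite !uv (splits_minimal_relation i j sI mr uv).
have [||g|f [bf fM]] := pi1_of_valuation phiV phiJ (sigma := sigma) _ _ _ x.
- apply: free_feqv; apply: free_sym; exact: (@grp_pi_repr P [::]).
- move=> l g; apply: free_feqv; apply: free_sym.
  have e : (phi l * g)%g = @grp_pi P (l :: @grp_repr P g).
    by rewrite -{1}(@grp_reprK P g) /phi -grp_pi_mul.
  change (free_eqv (sigma (phi l * g)%g) (l :: sigma g)); rewrite e.
  exact: (@grp_pi_repr P (l :: grp_repr g)).
- by rewrite fvalE; exact: grp_reprK.
pose F : {multiplicative pi1 (I0 k) x -> free_group bool} :=
  HB.pack f (isMultiplicative.Build _ _ f fM).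
by exists F.
Qed.

Definition zword (c : bool) (z : int) : seq (bool * bool) :=
  match z with Posz n => nseq n (c, false) | Negz n => nseq n.+1 (c, true) end.

Lemma fval_zword (m n : int) c z : (if c then n else m) = 1 ->
  fval (+%R : Monoid.law (0 : int)) (zletter m n) (zword c z) = z.
Proof.
move=> e; have e1 s : zletter m n (c, s) = if s then -1 else 1.
  by rewrite /zletter; case: c e => ->.
pose v := fval (+%R : Monoid.law (0 : int)) (zletter m n).
have step s w : v ((c, s) :: w) = (if s then -1 else 1) + v w by rewrite -e1.
rewrite -/v; case: z => l.
  elim: l => // l IHl; rewrite -[zword _ _]/((c, false) :: zword c (Posz l)).
  by rewrite step IHl.
elim: l => [|l IHl]; first by rewrite -[zword _ _]/[:: (c, true)] step.
rewrite -[zword _ _]/((c, true) :: zword c (Negz l)) step IHl; lia.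
Qed.

Lemma feqv_zword J c s z : feqv J ((c, s) ::
  zword c z) (zword c (z + (if s then -1 else 1))).
Proof.
case: s; case: z => [[|n]|n].
- exact: feqv_refl.
- have -> : Posz n.+1 + (if true then -1 else 1) = n by lia.
  exact: (@feqv_cancel _ J (c, true)).
- have -> : Negz n + (if true then -1 else 1) = Negz n.+1 by lia.
  exact: feqv_refl.
- exact: feqv_refl.
- have -> : Posz n.+1 + (if false then -1 else 1) = n.+2 by lia.
  exact: feqv_refl.
case: n => [|n]; first exact: (@feqv_cancel _ J (c, false)).
have -> : Negz n.+1 + (if false then -1 else 1) = Negz n by lia.
exact: (@feqv_cancel _ J (c, false)).
Qed.

(** [c] selects the surviving generator, [true] for the betas. The other one is killed by its flag,
    and the splitting makes the exponent of the survivor a homotopy invariant. *)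
Lemma pi1_Z J (x : vert Q0) (c : bool) : admissible J ->
  (forall s, feqv J [:: (~~ c, s)] [::]) ->
  splits (fun p => if c then p.2 else p.1) J ->
  group_iso_zmod (pi1 J x) int.
Proof.
move=> aJ triv sJ; pose m : int := if c then 0 else 1; pose n : int :=
  if c then 1 else 0.
have mn : (if c then n else m) = 1 by rewrite /m /n; case: (c).
have kmn p p' : (if c then p.2 else p.1) = (if c then p'.2 else p'.1) ->
  (if p.1 then m else 0) + (if p.2 then n else 0) =
  (if p'.1 then m else 0) + (if p'.2 then n else 0).
  by rewrite /m /n; case: (c); case: p p' => -[] [] [[] []].
have [||z|f [bf fM]] := pi1_of_valuation (zletterV m n)
    (zval_minimal_relation aJ sJ kmn) (sigma := zword c) _ _ _ x.
- exact: feqv_refl.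
- move=> [c' s] z; have [->|cc'] := eqVneq c' c.
    have -> : zletter m n (c, s) = if s then -1 else 1.
      by rewrite /m /n /zletter; case: (c).
    by have := feqv_zword J c s z; rewrite addrC.
  have {cc'}-> : c' = ~~ c by case: c' c cc' {mn kmn triv sJ m n} => -[].
  have -> : zletter m n (~~ c, s) = 0.
    by rewrite /m /n /zletter; case: (c); case: (s); rewrite /= ?oppr0.
  change (feqv J ((~~ c, s) :: zword c z) (zword c (0 + z))); rewrite add0r.
  exact: (feqv_ctx [::] (zword c z) (triv s)).
- exact: fval_zword.
by exists f.
Qed.

Lemma pi1_I1 (x : vert Q0) : group_iso_zmod (pi1 (I1 k) x) int.
Proof.
have [A _ _] := I1_flags k.
apply: (@pi1_Z _ x true (I1_admissible k)); last exact: I1_col_split.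
by move=> s; exact: feqv_alpha.
Qed.

Lemma pi1_I2 (x : vert Q0) : group_iso_zmod (pi1 (I2 k) x) int.
Proof.
have [_ B _] := I2_flags k.
apply: (@pi1_Z _ x false (I2_admissible k)); last exact: I2_row_split.
by move=> s; exact: feqv_beta.
Qed.

(** The two diagonal flags identify the alpha generator with the beta generator and with its
    inverse: all letters agree and square to 1. Parity of the number of letters shows that they are
    not trivial. *)
Lemma pi1_I4 (x : vert Q0) : group_iso_zmod (pi1 (I4 k) x) 'Z_2.
Proof.
have [_ _ D] := I4_flags k.
pose sigma (z : 'Z_2) : seq (bool * bool) := if z == 0 then [::] else [::
  (true, false)].
have letters l : feqv (I4 k) [:: l] [:: (true, false)].
  have a1 s : feqv (I4 k) [:: (false, false)] [:: (true, s)] := feqv_diag (D s).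
  have a2 s : feqv (I4 k) [:: (false, true)] [:: (true, s)].
    by have := feqv_inv (a1 (~~ s)); rewrite /fletter_inv /= negbK.
  case: l => -[] s; last by case: s; [exact: a2 | exact: a1].
  exact: feqv_trans (feqv_sym (a1 s)) (a1 false).
have kmn p p' : p.1 (+) p.2 = p'.1 (+) p'.2 ->
  (if p.1 then 1 else 0) + (if p.2 then 1 else 0) =
  (if p'.1 then 1 else 0) + (if p'.2 then 1 else 0) :> 'Z_2.
  by case: p p' => -[] [] [[] []] //= _; apply/val_inj.
have [||z|f [bf fM]] := pi1_of_valuation (zletterV (1 : 'Z_2) 1)
    (zval_minimal_relation (I4_admissible k) (@I4_diag_split k) kmn) (sigma :=
      sigma) _ _ _ x.
- exact: feqv_refl.
- move=> l z; have -> : zletter (1 : 'Z_2) 1 l = 1.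
    by case: l => -[] [] //=; apply/val_inj.
  have [->|->] : z = 0 \/ z = 1.
    by case: z => -[|[|n]] // i; [left|right]; apply/val_inj.
    have -> : sigma ((+%R : Monoid.law (0 : 'Z_2)) 1 0) = [:: (true, false)]
      by [].
    exact: letters.
  have -> : sigma ((+%R : Monoid.law (0 : 'Z_2)) 1 1) = [::] by [].
  have h : feqv (I4 k) [:: l] [:: (true, true)].
    exact: feqv_trans (letters l) (feqv_sym (letters (true, true))).
  apply: feqv_trans (feqv_cat h (feqv_refl _ [:: (true, false)])) _.
  exact: (@feqv_cancel _ (I4 k) (true, true)).
- by case: z => -[|[|n]] // i; apply/val_inj.
by exists f.
Qed.

Lemma pi1_I3 (x : vert Q0) : trivial_group (pi1 (I3 k) x).
Proof.
have [A B] := I3_flags k.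
have ua : associative (fun _ _ : unit => tt) by [].
have u1 : left_id tt (fun _ _ : unit => tt) by case.
have u2 : right_id tt (fun _ _ : unit => tt) by case.
pose L := Monoid.isLaw.Build unit tt (fun _ _ => tt) ua u1 u2.
pose op : Monoid.law tt := HB.pack (fun _ _ : unit => tt) L.
have phiV (l : bool * bool) : op ((fun _ : bool * bool => tt) l) ((fun _ :
  bool * bool => tt) (fletter_inv l)) = tt by [].
have phiJ n (t : 'I_n -> k) u i j : minimal_relation (I3 k) t u ->
  wval op (fun _ => tt) (walk_of (u i)) = wval op (fun _ => tt) (walk_of (u j)).
  by case: (wval _ _ _); case: (wval _ _ _).
have [||g|f [bf _] c] := pi1_of_valuation phiV phiJ (sigma :=
  fun _ => [::]) _ _ _ x.
- exact: feqv_refl.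
- by move=> [[] s] g; [exact: feqv_beta | exact: feqv_alpha].
- by case: g.
by apply: (bij_inj bf); case: (f c); case: (f 1%g).
Qed.

End FundamentalGroups.

(** * The quiver of homotopy relations *)

Section Gamma.
Variable k : fieldType.
Hypothesis two0 : (2%:R : k) != 0.
Local Notation h0 := (homotopic (I0 k)).
Local Notation h1 := (homotopic (I1 k)).
Local Notation h2 := (homotopic (I2 k)).
Local Notation h3 := (homotopic (I3 k)).
Local Notation h4 := (homotopic (I4 k)).

Lemma homotopy_relations_distinct : List.NoDup [:: h0; h1; h2; h3; h4].
Proof.
have [A0 B0 D0] := I0_flags k; have [A1 B1 D1] := I1_flags k.
have [A2 B2 D2] := I2_flags k; have [A3 B3] := I3_flags k.
have [A4 B4 D4] := I4_flags k.
have n10 e := A0 (homAlpha_eq (J := I1 k) (K := I0 k) e A1).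
have n20 e := B0 (homBeta_eq (J := I2 k) (K := I0 k) e B2).
have n30 e := A0 (homAlpha_eq (J := I3 k) (K := I0 k) e A3).
have n40 e := D0 true (homDiag_eq (J := I4 k) (J' := I0 k) e (D4 true)).
have n21 e := B1 (homBeta_eq (J := I2 k) (K := I1 k) e B2).
have n31 e := B1 (homBeta_eq (J := I3 k) (K := I1 k) e B3).
have n41 e := D1 true (homDiag_eq (J := I4 k) (J' := I1 k) e (D4 true)).
have n32 e := A2 (homAlpha_eq (J := I3 k) (K := I2 k) e A3).
have n42 e := D2 true (homDiag_eq (J := I4 k) (J' := I2 k) e (D4 true)).
have n34 e := A4 (homAlpha_eq (J := I3 k) (K := I4 k) e A3).
apply: List.NoDup_cons; first by move=> [/n10|[/n20|[/n30|[/n40|[]]]]].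
apply: List.NoDup_cons; first by move=> [/n21|[/n31|[/n41|[]]]].
apply: List.NoDup_cons; first by move=> [/n32|[/n42|[]]].
apply: List.NoDup_cons; first by move=> [e|[]]; exact: n34 (esym e).
exact: (List.NoDup_cons _ (@List.in_nil _ _) (List.NoDup_nil _)).
Qed.

Lemma gamma_vertexP r : gamma_vertex (I0 k) r <-> List.In r [:: h0; h1; h2; h3;
  h4].
Proof.
split=> [[J pJ ->]|].
  have [e|e|e|[e|e]] := gamma_vertex_flags pJ; rewrite e.
  - by left.
  - by right; left.
  - by right; right; left.
  - by right; right; right; left.
  - by right; right; right; right; left.
move=> [<-|[<-|[<-|[<-|[<-|[]]]]]].
- by exists (I0 k); first exact: I0_presentation.
- by exists (I1 k); first exact: I1_presentation.
- by exists (I2 k); first exact: I2_presentation.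
- by exists (I3 k); first exact: I3_presentation.
- by exists (I4 k); first exact: I4_presentation.
Qed.

Lemma gamma_arrow_of J J' a u tau r r' (phi psi :
  {lrmorphism path_algebra k Q0 -> path_algebra k Q0}) :
  admissible_presentation (I0 k) J -> admissible_presentation (I0 k) J' ->
  is_transvection a u tau phi -> isomorphic_by phi psi J J' ->
  r = homotopic J -> r' = homotopic J' ->
  ~ homotopic J (walk_of (apath a)) (walk_of u) ->
  homotopic J' (walk_of (apath a)) (walk_of u) -> gamma_arrow (I0 k) r r'.
Proof.
move=> pJ pJ' tr [_ _ im] er er' nh h.
exists J, J', a, u, tau.
exact: And5 (conj pJ pJ') (conj er er') (ex_intro _ phi (conj tr im)) nh h.
Qed.

Lemma gamma_arrowP r r' : gamma_arrow (I0 k) r r' <->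
  List.In (r, r') [:: (h0, h1); (h0, h2); (h1, h3); (h2, h3); (h4, h3)].
Proof.
have [A0 B0 D0] := I0_flags k; have [A1 B1 D1] := I1_flags k.
have [A2 B2 D2] := I2_flags k; have [A3 B3] := I3_flags k.
have [A4 B4 D4] := I4_flags k; have [A5 B5] := I5_flags k.
split=> [/gamma_arrow_cases [[-> [->|->]]|[-> ->]|[-> ->]|[-> ->]]|].
- by left.
- by right; left.
- by right; right; left.
- by right; right; right; left.
- by right; right; right; right; left.
move=> [[<- <-]|[[<- <-]|[[<- <-]|[[<- <-]|[[<- <-]|[]]]]]].
- have [phi [psi [tr im]]] := I0_to_I1 k.
  exact: gamma_arrow_of (I0_presentation k) (I1_presentation k) tr im erefl
    erefl A0 A1.
- have [phi [psi [tr im]]] := I0_to_I2 k.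
  exact: gamma_arrow_of (I0_presentation k) (I2_presentation k) tr im erefl
    erefl B0 B2.
- have [phi [psi [tr im]]] := I1_to_I3 k.
  exact: gamma_arrow_of (I1_presentation k) (I3_presentation k) tr im erefl
    erefl B1 B3.
- have [phi [psi [tr im]]] := I2_to_I3 k.
  exact: gamma_arrow_of (I2_presentation k) (I3_presentation k) tr im erefl
    erefl A2 A3.
(* The transvected ideal is [I5], not [I3]; an arrow of Gamma only asks for some presentations with
   the given relations, and [I5] has the relation of [I3]. *)
have [phi [psi [tr im]]] := I4_to_I5 k.
exact: gamma_arrow_of (I4_presentation two0) (I5_presentation two0) tr im erefl
  (esym (homotopic_I5 k)) A4 A5.
Qed.

Lemma gamma_arrow_target r r' : gamma_arrow (I0 k) r r' ->
  [\/ r' = h1, r' = h2 | r' = h3].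
Proof.
move/gamma_arrow_cases => [[_ [e|e]]|[_ e]|[_ e]|[_ e]].
- exact: Or31 e.
- exact: Or32 e.
- exact: Or33 e.
- exact: Or33 e.
- exact: Or33 e.
Qed.

Lemma I0_gamma_source : gamma_source (I0 k) h0.
Proof.
have [A0 B0 _] := I0_flags k; have [A1 _ _] := I1_flags k.
have [_ B2 _] := I2_flags k; have [A3 _] := I3_flags k.
split=> [|r /gamma_arrow_target [e|e|e]]; first by apply/gamma_vertexP; left.
- exact: A0 (homAlpha_eq (esym e) A1).
- exact: B0 (homBeta_eq (esym e) B2).
- exact: A0 (homAlpha_eq (esym e) A3).
Qed.

Lemma I4_gamma_source : gamma_source (I0 k) h4.
Proof.
have [A4 B4 _] := I4_flags k; have [A1 _ _] := I1_flags k.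
have [_ B2 _] := I2_flags k; have [A3 _] := I3_flags k.
split=> [|r /gamma_arrow_target [e|e|e]].
- by apply/gamma_vertexP; right; right; right; right; left.
- exact: A4 (homAlpha_eq (esym e) A1).
- exact: B4 (homBeta_eq (esym e) B2).
- exact: A4 (homAlpha_eq (esym e) A3).
Qed.

Lemma homotopic_I0_neq_I4 : h0 <> h4.
Proof.
have [_ _ D0] := I0_flags k; have [_ _ D4] := I4_flags k.
by move=> e; apply: (D0 true); exact: homDiag_eq (esym e) (D4 true).
Qed.

Lemma no_gamma_path_I0_I4 : ~ gamma_path (I0 k) h0 h4.
Proof.
(* Paths are decomposed at their last arrow, which cannot end at a source. *)
move=> /clos_rt_rtn1_iff pth.
have [_ no] := I4_gamma_source.
have H r : clos_refl_trans_n1 _ (gamma_arrow (I0 k)) h0 r -> r = h4 -> False.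
  case=> [|y z yz _]; first exact: homotopic_I0_neq_I4.
  by move=> e; rewrite e in yz; exact: no yz.
exact: H pth erefl.
Qed.

Lemma no_unique_gamma_source : ~ (exists! s, gamma_source (I0 k) s).
Proof.
move=> [s [_ u]]; apply: homotopic_I0_neq_I4.
exact: etrans (esym (u h0 I0_gamma_source)) (u h4 I4_gamma_source).
Qed.

(** [I0] has no flag, so its homotopy relation is the smallest one. *)
Lemma homotopic_I0_I4 v w : h0 v w -> h4 v w.
Proof.
have [A0 B0 D0] := I0_flags k.
apply: (homotopic_flags_sub (J := I0 k) (J' :=
  I4 k) (I0_admissible k)) => [h|h|s h].
- by case: (A0 h).
- by case: (B0 h).
- by case: (D0 s h).
Qed.

End Gamma.

Theorem mainTheorem1 (k : fieldType) (char_k : 2%N \notin [pchar k])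
  (x : vert Q0) :
  let I := I0 k in let I1 := I1 k in let I2 := I2 k in
  let I3 := I3 k in let I4 := I4 k in
  let p (a : arrow4) : qpath Q0 := @apath Q0 a in
  let e (a : arrow4) : path_algebra k Q0 := pelt k (p a) in
  let half : k := 2%:R^-1 in
  let r := homotopic I in let r1 := homotopic I1 in let r2 := homotopic I2 in
  let r3 := homotopic I3 in let r4 := homotopic I4 in
  (forall q : qpath Q0, psrc q = ptgt q -> q = epath (psrc q)) /\
  group_iso (pi1 I x) (free_group bool) /\
  [/\ admissible_presentation I I,
      admissible_presentation I I1, admissible_presentation I I2,
      admissible_presentation I I3 & admissible_presentation I I4] /\
  (@transvection_image k Q0 alpha1 (p alpha2) (-1) I I1 /\
   group_iso_zmod (pi1 I1 x) int) /\
  (@transvection_image k Q0 beta1 (p beta2) (-1) I I2 /\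
   group_iso_zmod (pi1 I2 x) int) /\
  [/\ @transvection_image k Q0 alpha1 (p alpha2) (-1) I2 I3,
      @transvection_image k Q0 beta1 (p beta2) (-1) I1 I3 &
      trivial_group (pi1 I3 x)] /\
  ((exists phi : {lrmorphism path_algebra k Q0 -> path_algebra k Q0},
     [/\ bijective phi,
         forall y, phi (pelt k (epath y)) = pelt k (epath y),
         phi (e alpha1) = half *: (e alpha1 - e alpha2) /\
         phi (e alpha2) = half *: (e alpha1 + e alpha2),
         phi (e beta1) = half *: (e beta1 - e beta2) /\
         phi (e beta2) = e beta1 + e beta2 &
         is_image phi I I4]) /\
   group_iso_zmod (pi1 I4 x) 'Z_2) /\
  [/\ NoDup (r :: r1 :: r2 :: r3 :: r4 :: nil),
      forall s, gamma_vertex I s <-> In s (r :: r1 :: r2 :: r3 :: r4 :: nil) &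
      forall s s', gamma_arrow I s s' <->
        In (s, s') ((r, r1) :: (r, r2) :: (r1, r3) :: (r2, r3) :: (r4, r3)
                    :: nil)] /\
  surjects_onto (pi1 I x) (pi1 I4 x) /\
  ~ gamma_path I r r4 /\
  ~ (exists! s, gamma_source I s).
Proof.
move=> J0 J1 J2 J3 J4 p e half r r1 r2 r3 r4.
have two0 : (2%:R : k) != 0.
  by move: char_k; rewrite inE /=.
have tr (a : arrow Q0) u tau phi psi K K' : @is_transvection k Q0 a u tau phi ->
    isomorphic_by phi psi K K' -> transvection_image a u tau K K'.
  by move=> t [_ _ im]; exists phi.
split; first exact: Q0_closed_path.
split; first exact: pi1_I0.
split.
  split; [exact: I0_presentation | exact: I1_presentation |
    exact: I2_presentation | exact: I3_presentation | exact: I4_presentation].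
split.
  by have [phi [psi [t im]]] := I0_to_I1 k; split; [exact: tr t im |
    exact: pi1_I1].
split.
  by have [phi [psi [t im]]] := I0_to_I2 k; split; [exact: tr t im |
    exact: pi1_I2].
split.
  have [phi [psi [t im]]] := I2_to_I3 k; have [phi' [psi' [t' im']]] :=
    I1_to_I3 k.
  by split; [exact: tr t im | exact: tr t' im' | exact: pi1_I3].
split.
  split; last exact: pi1_I4.
  have [phi [psi [phie phia phib [phiK psiK im]]]] := I0_to_I4 two0.
  by exists phi; split; [exists psi | exact: phie | exact: phia |
    exact: phib | exact: im].
split.
  by split; [exact: homotopy_relations_distinct | exact: gamma_vertexP |
    exact: gamma_arrowP].
split; first exact: pi1_surjects (@homotopic_I0_I4 k).
by split; [exact: no_gamma_path_I0_I4 | exact: no_unique_gamma_source].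
Qed.
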